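(* For every $a>0$ and every $n\in\mathbb{N}$, the set $B_a(K^n)$, equipped with the metric $(\mu,\nu)\mapsto\|\mu-\nu\|_{MK}$ generated by the Monge-Kantorovich norm, is a compact, hence complete, metric space, and its topology is exactly the topology induced on $B_a(K^n)$ by the weak$^*$ topology of $cabv(K^n)$ (in spite of the fact that, if $T$ is infinite, the normed space $(cabv(K^n),\|\cdot\|_{MK})$ is not complete).
   Context: $(T,d)$ is a compact metric space with at least two elements, with Borel $\sigma$-algebra $\mathcal{B}$. $K=\mathbb{R}$ or $K=\mathbb{C}$, $n\ge1$, and $X=K^n$ is equipped with its canonical Hilbert space structure, $(x\mid y)=\sum_i x_i\overline{y_i}$. $C(X)$ is the space of continuous functions $f:T\to X$ with the sup norm $\|f\|=\sup_{t\in T}\|f(t)\|$. $cabv(X)$ is the vector space over $K$ of $\sigma$-additive measures $\mu:\mathcal{B}\to X$ of bounded variation, where the variation is $|\mu|(A)=\sup\sum_i\|\mu(A_i)\|$ over finite partitions $(A_i)$ of $A$ into Borel sets; $\|\mu\|=|\mu|(T)$ is the variational norm; $B_a(X)=\{\mu\in cabv(X):\|\mu\|\le a\}$. Integral: for a simple function $f=\sum_{i=1}^m\varphi_{A_i}x_i$ ($A_i\in\mathcal{B}$, $x_i\in X$, $\varphi_{A}$ the indicator function of $A$) put $\int f\,d\mu=\sum_{i=1}^m(x_i\mid\mu(A_i))\in K$; for $f\in C(X)$ put $\int f\,d\mu=\lim_k\int f_k\,d\mu$, where $(f_k)$ is any sequence of simple functions converging uniformly to $f$ (the limit exists and does not depend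 on the sequence; the integral is linear in $f$, conjugate-linear in $\mu$, and $|\int f\,d\mu|\le\|\mu\|\|f\|$). $L(X)$ is the space of Lipschitz functions $f:T\to X$, $\|f\|_L$ is the least Lipschitz constant of $f$, $\|f\|_{BL}=\|f\|+\|f\|_L$, $BL_1(X)=\{f\in L(X):\|f\|_{BL}\le1\}$. The Monge-Kantorovich norm on $cabv(X)$ is $\|\mu\|_{MK}=\sup\{|\int f\,d\mu|: f\in BL_1(X)\}$. The weak$^*$ topology on $cabv(X)$ is the locally convex topology generated by the seminorms $\mu\mapsto|\int f\,d\mu|$, $f\in C(X)$. *)

(* Defs.v *)
From HB Require Import structures.
From mathcomp Require Import all_boot all_order all_algebra.
From mathcomp Require Import all_classical all_reals all_analysis.
From mathcomp Require Import complex.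

Set Implicit Arguments.
Unset Strict Implicit.
Unset Printing Implicit Defensive.

Import Order.TTheory GRing.Theory Num.Theory.
Import numFieldNormedType.Exports.

Local Open Scope classical_set_scope.
Local Open Scope ring_scope.

Variant scalar_kind := RealScalars | ComplexScalars.

Definition scalar_field (R : realType) (k : scalar_kind) : numFieldType :=
  match k with RealScalars => R | ComplexScalars => R[i] end.

Definition scalar_conj (R : realType) (k : scalar_kind) :
    scalar_field R k -> scalar_field R k :=
  match k with RealScalars => id | ComplexScalars => @conjc R end.

(* The library norm of [scalar_field R k] takes its values in
   [scalar_field R k]; this is the R-valued modulus. *)
Definition modulus (R : realType) (k : scalar_kind) : scalar_field R k -> R :=
  match k with
  | RealScalars => fun x : R => `|x|
  | ComplexScalars => @ComplexField.Normc.normc R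
  end.

Section HilbertSpace.
Context {R : realType} {k : scalar_kind} {n : nat}.
Implicit Types x y : 'rV[scalar_field R k]_n.

Definition inner x y : scalar_field R k :=
  \sum_(i < n) x ord0 i * scalar_conj (y ord0 i).

(* Not the library norm of row vectors, which is the max norm. *)
Definition hnorm x : R := Num.sqrt (modulus (inner x x)).

End HilbertSpace.

Definition borel (T : topologicalType) : set (set T) := <<s @open T >>.

Section VectorMeasures.
Context {R : realType} {k : scalar_kind} {n : nat} {T : metricType R}.
Local Notation K := (scalar_field R k).
Local Notation X := 'rV[K]_n.
Implicit Types (m mu nu : set T -> X) (f : T -> X).

Definition sigma_additive_on_borel m := forall A : nat -> set T,
  (forall i, borel (A i)) -> trivIset [set: nat] A ->
  (fun N => \sum_(i < N) m (A i)) @ \oo --> m (\bigcup_i A i).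

Definition measure_variation m (A : set T) : \bar R := ereal_sup
  [set v | exists (p : nat) (P : 'I_p -> set T),
     [/\ forall i, borel (P i), trivIset [set: 'I_p] P, \bigcup_i P i = A &
         v = (\sum_(i < p) hnorm (m (P i)))%:E]].

(* A measure on the Borel sets is encoded as a function on all subsets of T
   which vanishes on the non-Borel ones, so that two measures are equal iff
   they agree on the Borel sets. *)
Definition is_cabv m :=
  [/\ sigma_additive_on_borel m,
      (measure_variation m [set: T] < +oo)%E &
      forall A, ~ borel A -> m A = 0].

Record simple_fun := SimpleFun {
  simple_size : nat;
  simple_set : 'I_simple_size -> set T;
  simple_value : 'I_simple_size -> X;
  _ : forall i, borel (simple_set i)
}.

Definition simple_eval (s : simple_fun) (t : T) : X :=
  \sum_(i < simple_size s) \1_(simple_set i) t *: simple_value i.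

Definition simple_integral m (s : simple_fun) : K :=
  \sum_(i < simple_size s) inner (simple_value i) (m (simple_set i)).

(* For a measure of bounded variation and a continuous f, such a limit exists
   and does not depend on the approximating sequence; the default value 0 of
   [xget] is then not used. *)
Definition integral_of m f : K := xget 0
  [set c | exists s : nat -> simple_fun,
     {uniform, (fun j => simple_eval (s j)) @ \oo --> f} /\
     (fun j => simple_integral m (s j)) @ \oo --> c].

Definition sup_norm f : R := sup [set hnorm (f t) | t in [set: T]].

Definition lipschitz_constants f : set R :=
  [set L | 0 <= L /\ forall s t, hnorm (f s - f t) <= L * mdist s t].

Definition lipschitz_norm f : R := inf (lipschitz_constants f).

Definition BL1 : set (T -> X) :=
  [set f | lipschitz_constants f !=set0 /\ sup_norm f + lipschitz_norm f <= 1].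

Definition mk_norm m : R := sup [set modulus (integral_of m f) | f in BL1].

End VectorMeasures.

Section SpacesOfMeasures.
Context (R : realType) (k : scalar_kind) (n : nat) (T : metricType R).

Definition cabv : Type :=
  set_type [set m : set T -> 'rV[scalar_field R k]_n | is_cabv m].

HB.instance Definition _ := Choice.on cabv.

(* The differences [\val mu - \val nu] below are pointwise. *)
Definition mk_dist (mu nu : cabv) : R := mk_norm (\val mu - \val nu).

Definition cabv_ball (a : R) : set cabv :=
  [set mu | (measure_variation (\val mu) [set: T] <= a%:E)%E].

Definition weak_star : Type := cabv.

HB.instance Definition _ := Choice.on weak_star.

Definition weak_star_nbhd (mu : weak_star) (p : nat)
    (f : 'I_p -> T -> 'rV[scalar_field R k]_n) (e : R) : set weak_star :=
  [set nu | forall i, modulus (integral_of (\val nu - \val mu) (f i)) < e].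

Definition weak_star_open : set (set weak_star) :=
  [set U | forall mu, U mu ->
     exists (p : nat) (f : 'I_p -> T -> 'rV[scalar_field R k]_n) (e : R),
       [/\ forall i, continuous (f i), 0 < e & weak_star_nbhd mu f e `<=` U]].

Let weak_star_openT : weak_star_open setT.
Proof. by move=> mu _; exists 0%N, (fun=> 0), 1; split => // -[]. Qed.

Let weak_star_openI : setI_closed weak_star_open.
Proof.
move=> U V oU oV mu [/oU[p [f [e [cf e0 fU]]]] /oV[q [g [d [cg d0 gV]]]]].
exists (p + q)%N, (fun i => match fintype.split i with inl j => f j | inr j => g j end).
exists (Num.min e d); split; first by move=> i; case: (fintype.split i).
  by rewrite lt_min e0.
move=> nu H; split; [apply: fU => i|apply: gV => i].
- have := H (lshift q i); rewrite -[lshift q i]/(unsplit (inl i)) unsplitK.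
  by rewrite lt_min => /andP[].
- have := H (rshift p i); rewrite -[rshift p i]/(unsplit (inr i)) unsplitK.
  by rewrite lt_min => /andP[].
Qed.

Let weak_star_open_bigU (I : Type) (U : I -> set weak_star) :
  (forall i, weak_star_open (U i)) -> weak_star_open (\bigcup_i U i).
Proof.
move=> oU mu [i _ /oU[p [f [e [cf e0 fU]]]]].
by exists p, f, e; split => // nu /fU Unu; exists i.
Qed.

HB.instance Definition _ := isOpenTopological.Build weak_star
  weak_star_openT weak_star_openI weak_star_open_bigU.

End SpacesOfMeasures.

Record is_metric (R : realType) (S : Type) (d : S -> S -> R) : Prop := IsMetric {
  is_metric_xx : forall x, d x x = 0;
  is_metric_eq : forall x y, d x y = 0 -> x = y;
  is_metric_sym : forall x y, d x y = d y x;
  is_metric_triangle : forall y x z, d x z <= d x y + d y z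
}.

Definition metric_space (R : realType) (S : choiceType) (d : S -> S -> R)
  (dP : is_metric d) : Type := S.

HB.instance Definition _ (R : realType) (S : choiceType) (d : S -> S -> R)
  (dP : is_metric d) := Choice.on (metric_space dP).

HB.instance Definition _ (R : realType) (S : choiceType) (d : S -> S -> R)
  (dP : is_metric d) := @isMetric.Build R (metric_space dP) d
    (is_metric_xx dP) (is_metric_eq dP) (is_metric_sym dP)
    (is_metric_triangle dP).

(* The axiom of [completeType], which the library states only for pointed
   spaces. *)
Definition complete_space (M : uniformType) : Prop :=
  forall F : set_system M, ProperFilter F -> cauchy F -> exists x : M, F --> x.

Definition mk_dist_on (R : realType) (k : scalar_kind) (n : nat)
    (T : metricType R) (B : set (cabv k n T)) (mu nu : B) : R :=
  mk_dist (\val mu) (\val nu).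

(* Main.v *)
(** Compactness.  The vector measures of an ultrafilter on the ball are split
into nonnegative parts |m|, |m| + Re m_j, |m| + Im m_j.  Countably many open
sets E_j separate the points of T uniformly; on the cells of the partitions
they generate, the parts converge along the ultrafilter to finitely additive
weights.  Such weights are realised as lengths of nested intervals of the real
line, and the map sending u to the point of T singled out by the cells whose
intervals contain u pushes Lebesgue measure forward to a Borel measure on T.
Recombining these gives a vector measure, the weak-star limit; its variation is
at most a, because disjoint closed sets exhausting a Borel partition carry
Lipschitz bumps of sup norm at most 1.

Topologies.  With a Lipschitz partition of unity phi_i of small mesh, every f
in BL_1 is uniformly close to sum_i phi_i f(c_i), so finitely many integrals
control the Monge-Kantorovich norm on a ball; conversely these sums are
Lipschitz, hence Lipschitz functions are dense in C(X).

Non-completeness.  If x_i tends to t fast enough, sum_i (delta_(x_i) - delta_t)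
is Cauchy, but a limit would have mass 1 at every x_i. *)

Require Import Defs.
From HB Require Import structures.
From mathcomp Require Import all_boot all_order all_algebra.
From mathcomp Require Import all_classical all_reals all_analysis.
From mathcomp Require Import complex ring lra.

Set Implicit Arguments.
Unset Strict Implicit.
Unset Printing Implicit Defensive.

Import Order.TTheory GRing.Theory Num.Theory.
Import numFieldNormedType.Exports.

Local Open Scope classical_set_scope.
Local Open Scope ring_scope.

(** * Scalars and the Hilbert norm *)

(** The ultrafilter limit of the values on all Borel sets would only be finitely additive, so limits
    are taken on the countably many cells alone, and countable additivity is imported from Lebesgue
    measure. Adding the variation to real and imaginary parts makes the weights nonnegative, as
    lengths of intervals must be. Cells are not closed, so the point attached to [u] lies only in
    the closures of its cells, and the new measure need not give a cell the prescribed weight. This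
    is harmless: long cells have small closures, and only integrals of continuous functions are
    compared. Recombining the parts overestimates the total mass, so the radius [a] cannot be read
    off them and has to be recovered from integrals. For this reason the estimates for the integral
    concern a measure together with an arbitrary additive majorant [D] in place of its variation.
    Integrals are computed on finite partitions given by class maps, because two step functions can
    then be compared on the pair of their class maps. *)

Section ScalarField.
Context {R : realType} {k : scalar_kind}.
Local Notation K := (scalar_field R k).
Implicit Types x y : K.

Definition of_real (r : R) : K :=
  match k return scalar_field R k with
  | RealScalars => r
  | ComplexScalars => real_complex R r
  end.

Definition real_part : K -> R :=
  match k return scalar_field R k -> R with
  | RealScalars => id
  | ComplexScalars => @complex.Re R
  end.

Definition imag_part : K -> R :=
  match k return scalar_field R k -> R with
  | RealScalars => fun=> 0
  | ComplexScalars => @complex.Im R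
  end.

(** Zero over the reals, so that [scalar_parts] and [modulus_imag_unit] hold for both kinds of
    scalars. *)
Definition imag_unit : K :=
  match k return scalar_field R k with
  | RealScalars => 0
  | ComplexScalars => 'i%C
  end.

Lemma norm_modulus x : `|x| = of_real (modulus x).
Proof. by rewrite /of_real; case: k x. Qed.

Lemma of_real_lt r s : (of_real r < of_real s) = (r < s).
Proof. by rewrite /of_real; case: k => //=; rewrite ltcR. Qed.

Lemma of_real_gt0P (e : K) : 0 < e -> exists2 r : R, 0 < r & e = of_real r.
Proof.
rewrite /of_real; case: k e => /=; first by move=> e e0; exists e.
by move=> [a b]; rewrite ltcE /= => /andP[/eqP -> a0]; exists a.
Qed.

Lemma of_real0 : of_real 0 = 0.
Proof. by rewrite /of_real; case: k. Qed.

Lemma of_real1 : of_real 1 = 1.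
Proof. by rewrite /of_real; case: k. Qed.

Lemma of_realD r s : of_real (r + s) = of_real r + of_real s.
Proof. by rewrite /of_real; case: k => //; exact: rmorphD. Qed.

Lemma of_realN r : of_real (- r) = - of_real r.
Proof. by rewrite /of_real; case: k => //; exact: rmorphN. Qed.

Lemma of_realM r s : of_real (r * s) = of_real r * of_real s.
Proof. by rewrite /of_real; case: k => //; exact: rmorphM. Qed.

Lemma of_real_inj : injective of_real.
Proof. by rewrite /of_real; case: k => // r s []. Qed.

Lemma of_real_sum (I : Type) (r : seq I) (P : pred I) (F : I -> R) :
  of_real (\sum_(i <- r | P i) F i) = \sum_(i <- r | P i) of_real (F i).
Proof. exact: (big_morph of_real of_realD of_real0). Qed.

Lemma modulus_of_real r : modulus (of_real r) = `|r|.
Proof.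
by rewrite /of_real; case: k => //=; rewrite expr0n /= addr0 sqrtr_sqr.
Qed.

Lemma modulus_ge0 x : 0 <= modulus x.
Proof. by case: k x => /= [x|[a b]]; rewrite ?normr_ge0 ?sqrtr_ge0. Qed.

Lemma modulus0 : modulus (0 : K) = 0.
Proof. by rewrite -of_real0 modulus_of_real normr0. Qed.

Lemma modulus1 : modulus (1 : K) = 1.
Proof. by rewrite -of_real1 modulus_of_real normr1. Qed.

Lemma modulus_eq0 x : modulus x = 0 -> x = 0.
Proof. by move=> x0; apply: normr0_eq0; rewrite norm_modulus x0 of_real0. Qed.

Lemma modulusM x y : modulus (x * y) = modulus x * modulus y.
Proof. by apply: of_real_inj; rewrite of_realM -!norm_modulus normrM. Qed.

Lemma modulusN x : modulus (- x) = modulus x.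
Proof. by apply: of_real_inj; rewrite -!norm_modulus normrN. Qed.

Lemma of_real_le r s : (of_real r <= of_real s) = (r <= s).
Proof. by rewrite /of_real; case: k => //=; rewrite lecR. Qed.

Lemma modulusD x y : modulus (x + y) <= modulus x + modulus y.
Proof. by rewrite -of_real_le of_realD -!norm_modulus ler_normD. Qed.

Lemma modulusB x y : modulus (x - y) = modulus (y - x).
Proof. by rewrite -modulusN opprB. Qed.

Lemma modulus_sum (I : Type) (r : seq I) (P : pred I) (F : I -> K) :
  modulus (\sum_(i <- r | P i) F i) <= \sum_(i <- r | P i) modulus (F i).
Proof.
elim/big_rec2: _ => [|i u v _ uv]; first by rewrite modulus0.
by rewrite (le_trans (modulusD _ _)) // lerD2l.
Qed.

Lemma modulus_small x : (forall e : R, 0 < e -> modulus x <= e) -> x = 0.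
Proof.
move=> h; apply: modulus_eq0; apply/eqP; rewrite eq_le modulus_ge0 andbT.
by apply/ler_addgt0Pr => e e0; rewrite add0r h.
Qed.

Lemma scalar_conjD x y :
  scalar_conj (x + y) = scalar_conj x + scalar_conj y.
Proof. by case: k x y => //= x y; exact: rmorphD. Qed.

Lemma scalar_conjN x : scalar_conj (- x) = - scalar_conj x.
Proof. by case: k x => //= x; exact: rmorphN. Qed.

Lemma scalar_conj_of_real r : scalar_conj (of_real r) = of_real r.
Proof. by rewrite /of_real; case: k => //=; rewrite oppr0. Qed.

Lemma scalar_conjM x y :
  scalar_conj (x * y) = scalar_conj x * scalar_conj y.
Proof. by case: k x y => //= x y; exact: rmorphM. Qed.

Lemma modulus_conj x : modulus (scalar_conj x) = modulus x.
Proof. by case: k x => //= [[a b]] /=; rewrite sqrrN. Qed.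

Lemma mul_conj x : x * scalar_conj x = of_real (modulus x ^+ 2).
Proof.
rewrite /of_real; case: k x => /= [x|[a b]]; first by rewrite -normrX ger0_norm ?sqr_ge0.
rewrite sqr_sqrtr ?addr_ge0 ?sqr_ge0 //.
by rewrite {1}/GRing.mul /=; apply/eqP; rewrite eq_complex /=; apply/andP; split; apply/eqP; ring.
Qed.

Lemma scalar_parts x :
  x = of_real (real_part x) * 1 + of_real (imag_part x) * imag_unit.
Proof.
rewrite /of_real /real_part /imag_part /imag_unit.
case: k x => /= x; first by rewrite mul0r addr0 mulr1.
by rewrite mulr1 mulrC -complexE.
Qed.

Lemma real_partB x y : real_part (x - y) = real_part x - real_part y.
Proof. by rewrite /real_part; case: k x y => //= [[a b] [c d]]. Qed.

Lemma imag_partB x y : imag_part (x - y) = imag_part x - imag_part y.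
Proof.
by rewrite /imag_part; case: k x y => //= [x y|[a b] [c d]]; rewrite ?subr0.
Qed.

Lemma real_part_le x : `|real_part x| <= modulus x.
Proof.
rewrite /real_part; case: k x => //= [[a b]] /=.
by rewrite -sqrtr_sqr ler_wsqrtr // lerDl sqr_ge0.
Qed.

Lemma imag_part_le x : `|imag_part x| <= modulus x.
Proof.
rewrite /imag_part; case: k x => //= [x|[a b]] /=; first by rewrite normr0.
by rewrite -sqrtr_sqr ler_wsqrtr // lerDr sqr_ge0.
Qed.

Lemma modulus_imag_unit : modulus imag_unit <= 1.
Proof.
rewrite /imag_unit; case: k => //=; first by rewrite normr0.
by rewrite expr0n /= add0r expr1n sqrtr1.
Qed.

(** Balls of [K] have radii in [K]; a positive element of [K] is real, which turns them into real
    radii. *)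
Lemma nbhs_modulus x (A : set K) :
  nbhs x A <-> exists2 e : R, 0 < e & forall y, modulus (x - y) < e -> A y.
Proof.
split => [/nbhs_ballP[e /= /of_real_gt0P[r r0 ->] xA]|[e e0 xA]].
  exists r => // y xy; apply: xA.
  by rewrite /ball /= norm_modulus of_real_lt.
exists (of_real e); first by rewrite /= -of_real0 of_real_lt.
by move=> y; rewrite /ball /= norm_modulus of_real_lt; exact: xA.
Qed.

End ScalarField.

Section HilbertNorm.
Context {R : realType} {k : scalar_kind} {n : nat}.
Local Notation K := (scalar_field R k).
Implicit Types (x y z : 'rV[K]_n) (a : K).

Lemma innerDl x y z : inner (x + y) z = inner x z + inner y z.
Proof.
by rewrite /inner -big_split; apply: eq_bigr => i _; rewrite mxE mulrDl.
Qed.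

Lemma innerDr x y z : inner x (y + z) = inner x y + inner x z.
Proof.
rewrite /inner -big_split; apply: eq_bigr => i _.
by rewrite mxE scalar_conjD mulrDr.
Qed.

Lemma innerZl a x y : inner (a *: x) y = a * inner x y.
Proof.
by rewrite /inner mulr_sumr; apply: eq_bigr => i _; rewrite mxE mulrA.
Qed.

Lemma innerZr a x y : inner x (a *: y) = scalar_conj a * inner x y.
Proof.
rewrite /inner mulr_sumr; apply: eq_bigr => i _.
by rewrite mxE scalar_conjM mulrCA.
Qed.

Lemma innerNl x y : inner (- x) y = - inner x y.
Proof. by rewrite -scaleN1r innerZl mulN1r. Qed.

Lemma innerNr x y : inner x (- y) = - inner x y.
Proof.
rewrite /inner -sumrN; apply: eq_bigr => i _.
by rewrite mxE scalar_conjN mulrN.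
Qed.

Lemma innerBl x y z : inner (x - y) z = inner x z - inner y z.
Proof. by rewrite innerDl innerNl. Qed.

Lemma inner0l x : inner 0 x = 0.
Proof. by rewrite -(scale0r 0) innerZl mul0r. Qed.

Lemma inner0r x : inner x 0 = 0.
Proof. by rewrite -(subrr 0) innerDr innerNr subrr. Qed.

Lemma inner_suml (I : Type) (r : seq I) (P : pred I) (F : I -> 'rV[K]_n) y :
  inner (\sum_(i <- r | P i) F i) y = \sum_(i <- r | P i) inner (F i) y.
Proof.
exact: (big_morph (fun x => inner x y) (fun x z => innerDl x z y) (inner0l y)).
Qed.

Lemma inner_sumr (I : Type) (r : seq I) (P : pred I) (F : I -> 'rV[K]_n) y :
  inner y (\sum_(i <- r | P i) F i) = \sum_(i <- r | P i) inner y (F i).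
Proof. exact: (big_morph (inner y) (innerDr y) (inner0r y)). Qed.

Lemma inner_self x : inner x x = of_real (\sum_(i < n) modulus (x ord0 i) ^+ 2).
Proof. by rewrite of_real_sum; apply: eq_bigr => i _; rewrite mul_conj. Qed.

Lemma hnormE x : hnorm x = Num.sqrt (\sum_(i < n) modulus (x ord0 i) ^+ 2).
Proof.
rewrite /hnorm inner_self modulus_of_real ger0_norm // sumr_ge0 // => i _.
exact: sqr_ge0.
Qed.

Lemma hnorm_ge0 x : 0 <= hnorm x.
Proof. exact: sqrtr_ge0. Qed.

Lemma sqr_hnorm x : hnorm x ^+ 2 = \sum_(i < n) modulus (x ord0 i) ^+ 2.
Proof. by rewrite hnormE sqr_sqrtr // sumr_ge0 // => i _; exact: sqr_ge0. Qed.

Lemma inner_hnorm x : inner x x = of_real (hnorm x ^+ 2).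
Proof. by rewrite sqr_hnorm inner_self. Qed.

Lemma hnorm0 : hnorm (0 : 'rV[K]_n) = 0.
Proof. by rewrite /hnorm inner0l modulus0 sqrtr0. Qed.

Lemma hnormZ a x : hnorm (a *: x) = modulus a * hnorm x.
Proof.
rewrite !hnormE -(ger0_norm (modulus_ge0 a)) -sqrtr_sqr -sqrtrM ?sqr_ge0 //.
rewrite mulr_sumr; congr Num.sqrt; apply: eq_bigr => i _.
by rewrite mxE modulusM exprMn.
Qed.

Lemma hnormN x : hnorm (- x) = hnorm x.
Proof. by rewrite -scaleN1r hnormZ modulusN modulus1 mul1r. Qed.

Lemma hnormBC x y : hnorm (x - y) = hnorm (y - x).
Proof. by rewrite -hnormN opprB. Qed.

Lemma modulus_le_hnorm x i : modulus (x ord0 i) <= hnorm x.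
Proof.
rewrite -(ger0_norm (modulus_ge0 _)) -sqrtr_sqr hnormE ler_wsqrtr //.
by rewrite (bigD1 i) //= lerDl sumr_ge0 // => j _; exact: sqr_ge0.
Qed.

Lemma hnorm_eq0 x : hnorm x = 0 -> x = 0.
Proof.
move=> x0; apply/rowP => i; rewrite mxE; apply: modulus_eq0; apply/eqP.
by rewrite eq_le modulus_ge0 andbT -x0 modulus_le_hnorm.
Qed.

(* AM-GM: [2 |x_i| |y_i| <= t |x_i|^2 + |y_i|^2 / t] with [t = |y| / |x|]. *)
Lemma inner_le x y : modulus (inner x y) <= hnorm x * hnorm y.
Proof.
have [x0|x0] := eqVneq (hnorm x) 0.
  by rewrite (hnorm_eq0 x0) inner0l modulus0 hnorm0 mul0r.
have [y0|y0] := eqVneq (hnorm y) 0.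
  by rewrite (hnorm_eq0 y0) inner0r modulus0 hnorm0 mulr0.
have xgt0 : 0 < hnorm x by rewrite lt_def x0 hnorm_ge0.
have ygt0 : 0 < hnorm y by rewrite lt_def y0 hnorm_ge0.
rewrite (le_trans (modulus_sum _ _ _)) //.
have -> : hnorm x * hnorm y = \sum_(i < n)
    (hnorm y / hnorm x * modulus (x ord0 i) ^+ 2 +
     hnorm x / hnorm y * modulus (y ord0 i) ^+ 2) / 2.
  rewrite -mulr_suml big_split /= -!mulr_sumr -!sqr_hnorm.
  by field; rewrite x0 y0.
apply: ler_sum => i _; rewrite modulusM modulus_conj.
set u := modulus _; set v := modulus _.
have := sqr_ge0 (hnorm y * u - hnorm x * v).
have hxy : 0 < hnorm x * hnorm y by rewrite mulr_gt0.
rewrite -(ler_pM2l hxy) => h.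
have -> : hnorm x * hnorm y * ((hnorm y / hnorm x * u ^+ 2 + hnorm x / hnorm y * v ^+ 2) / 2)
  = ((hnorm y * u) ^+ 2 + (hnorm x * v) ^+ 2) / 2.
  by field; rewrite x0 y0.
nra.
Qed.

Lemma hnormD x y : hnorm (x + y) <= hnorm x + hnorm y.
Proof.
rewrite -(@ler_pXn2r _ 2) ?nnegrE ?addr_ge0 ?hnorm_ge0 //.
rewrite -[leLHS]ger0_norm ?sqr_ge0 // -(modulus_of_real (k := k)) -inner_hnorm.
rewrite innerDl !innerDr (le_trans (modulusD _ _)) //.
have h1 := modulusD (inner x x) (inner x y).
have h2 := modulusD (inner y x) (inner y y).
have h3 := inner_le x y; have h4 := inner_le y x.
have h5 := inner_le x x; have h6 := inner_le y y.
nra.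
Qed.

Lemma hnorm_sum (I : Type) (r : seq I) (P : pred I) (F : I -> 'rV[K]_n) :
  hnorm (\sum_(i <- r | P i) F i) <= \sum_(i <- r | P i) hnorm (F i).
Proof.
elim/big_rec2: _ => [|i u v _ uv]; first by rewrite hnorm0.
by rewrite (le_trans (hnormD _ _)) // lerD2l.
Qed.

Lemma hnorm_triangle y x z : hnorm (x - z) <= hnorm (x - y) + hnorm (y - z).
Proof. by rewrite -{1}(subrK y x) -addrA hnormD. Qed.

Lemma hnorm_delta (i : 'I_n) : hnorm (delta_mx ord0 i : 'rV[K]_n) = 1.
Proof.
rewrite hnormE (bigD1 i) //= big1 => [|j ji]; last first.
  by rewrite mxE (negbTE ji) andbF modulus0 expr0n.
by rewrite mxE !eqxx modulus1 expr1n addr0 sqrtr1.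
Qed.

Lemma hnorm_le_sum x : hnorm x <= \sum_(i < n) modulus (x ord0 i).
Proof.
rewrite {1}[x]row_sum_delta (le_trans (hnorm_sum _ _ _)) //.
by apply: ler_sum => i _; rewrite hnormZ hnorm_delta mulr1.
Qed.

(** The topology of row vectors comes from the max norm, and the Hilbert norm lies between the
    largest and the sum of the moduli of the coordinates. *)
Lemma nbhs_hnorm x (A : set 'rV[K]_n) :
  nbhs x A <-> exists2 e : R, 0 < e & forall y, hnorm (x - y) < e -> A y.
Proof.
split => [/nbhs_ballP[e /= /of_real_gt0P[r r0 ->] xA]|[e e0 xA]].
  exists r => // y xy; apply: xA; split; first by rewrite -(of_real0 (k := k)) of_real_lt.
  move=> i j; rewrite /ball /= norm_modulus of_real_lt.
  apply: le_lt_trans xy; rewrite (ord1 i).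
  by have := modulus_le_hnorm (x - y) j; rewrite !mxE.
(* Dividing by [n.+1] keeps the sum of [n] coordinates strictly below [e], also for [n = 0]. *)
have n1 : 0 < n.+1%:R :> R by [].
apply/nbhs_ballP.
exists (of_real (e / n.+1%:R)); first by rewrite /= -(of_real0 (k := k)) of_real_lt divr_gt0.
move=> y [_ xy]; apply: xA; rewrite (le_lt_trans (hnorm_le_sum _)) //.
have : \sum_(i < n) modulus ((x - y) ord0 i) <= \sum_(i < n) e / n.+1%:R.
  apply: ler_sum => i _; have := xy ord0 i.
  by rewrite /ball /= norm_modulus of_real_lt !mxE => /ltW.
move/le_lt_trans; apply; rewrite sumr_const card_ord -[ltLHS]mulr_natr -mulrA.
by rewrite gtr_pMr // mulrC ltr_pdivrMr // mul1r ltr_nat.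
Qed.

Lemma cvg_hnorm (S : Type) (F : set_system S) (FF : Filter F) (u : S -> 'rV[K]_n) (l : 'rV[K]_n) :
  u @ F --> l <-> forall e : R, 0 < e -> \forall s \near F, hnorm (l - u s) < e.
Proof.
split => [ul e e0|ul A /nbhs_hnorm[e e0 lA]].
  by apply: (ul [set y | hnorm (l - y) < e]); apply/nbhs_hnorm; exists e.
by apply: filterS (ul e e0) => s; exact: lA.
Qed.

End HilbertNorm.

Lemma cvg_modulus (R : realType) (k : scalar_kind) (S : Type)
    (F : set_system S) (FF : Filter F) (u : S -> scalar_field R k) (l : scalar_field R k) :
  u @ F --> l <-> forall e : R, 0 < e -> \forall s \near F, modulus (l - u s) < e.
Proof.
split => [ul e e0|ul A /nbhs_modulus[e e0 lA]].
  by apply: (ul [set y | modulus (l - y) < e]); apply/nbhs_modulus; exists e.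
by apply: filterS (ul e e0) => s; exact: lA.
Qed.

Lemma uniform_cvg_hnorm (R : realType) (k : scalar_kind) (n : nat) (U : choiceType)
    (S : Type) (F : set_system S) (FF : Filter F)
    (u : S -> U -> 'rV[scalar_field R k]_n) (f : U -> 'rV[scalar_field R k]_n) :
  {uniform, u @ F --> f} <->
  forall e : R, 0 < e -> \forall s \near F, forall t, hnorm (f t - u s t) < e.
Proof.
split => [uf e e0|uf A /uniform_nbhs[E [entE fA]]].
  apply: (uf [set g : U -> _ | forall t, hnorm (f t - g t) < e]).
  apply/uniform_nbhs; exists [set xy | hnorm (xy.1 - xy.2) < e]; split; last first.
    by move=> g fg t; exact: fg.
  rewrite -entourage_ballE.
  have n1 : 0 < n.+1%:R :> R by [].
  exists (of_real (e / n.+1%:R)); first by rewrite /= -(of_real0 (k := k)) of_real_lt divr_gt0.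
  move=> [x y] /= [_ xy]; rewrite (le_lt_trans (hnorm_le_sum _)) //.
  have : \sum_(i < n) modulus ((x - y) ord0 i) <= \sum_(i < n) e / n.+1%:R.
    apply: ler_sum => i _; have := xy ord0 i.
    by rewrite /ball /= norm_modulus of_real_lt !mxE => /ltW.
  move/le_lt_trans; apply; rewrite sumr_const card_ord -[ltLHS]mulr_natr -mulrA.
  by rewrite gtr_pMr // mulrC ltr_pdivrMr // mul1r ltr_nat.
move: entE; rewrite -entourage_ballE => -[e /= /of_real_gt0P[r r0 ->] eE].
apply: filterS (uf r r0) => s us; apply: fA => t _ /=; apply: eE => /=.
split; first by rewrite -(of_real0 (k := k)) of_real_lt.
move=> i j; rewrite /ball /= norm_modulus of_real_lt.
apply: le_lt_trans (us t); rewrite (ord1 i).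
by have := modulus_le_hnorm (f t - u s t) j; rewrite !mxE.
Qed.

(** * Finite codings *)

Section Codes.
Context {Om : Type}.
Implicit Types (G : set (set Om)) (A B : set Om).

Definition set_algebra G :=
  [/\ G set0, forall A, G A -> G (~` A) & forall A B, G A -> G B -> G (A `|` B)].

Definition finitely_additive (V : zmodType) G (p : set Om -> V) :=
  p set0 = 0 /\
  forall A B, G A -> G B -> A `&` B = set0 -> p (A `|` B) = p A + p B.

(* A finite partition of Om into sets of G, given by its class map. *)
Definition coding (W : Type) G (c : Om -> W) := forall w, G (c @^-1` [set w]).

Section Algebra.
Variables (G : set (set Om)) (algG : set_algebra G).

Lemma alg0 : G set0. Proof. by case: algG. Qed.

Lemma algC A : G A -> G (~` A). Proof. by case: algG => _ + _; exact. Qed.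

Lemma algU A B : G A -> G B -> G (A `|` B).
Proof. by case: algG => _ _; exact. Qed.

Lemma algT : G setT. Proof. by rewrite -setC0; apply: algC; exact: alg0. Qed.

Lemma algI A B : G A -> G B -> G (A `&` B).
Proof. by move=> GA GB; rewrite -[_ `&` _]setCK setCI; apply/algC/algU; exact: algC. Qed.

Lemma algD A B : G A -> G B -> G (A `\` B).
Proof. by move=> GA GB; rewrite setDE; apply: algI => //; exact: algC. Qed.

Section Fibers.
Variables (V : zmodType) (p : set Om -> V) (addp : finitely_additive G p).
Variables (W : finType) (c : Om -> W) (cG : coding G c).

Let fiber_seq (s : seq W) : uniq s ->
  G (c @^-1` [set w | w \in s]) /\
  p (c @^-1` [set w | w \in s]) = \sum_(w <- s) p (c @^-1` [set w]).
Proof.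
elim: s => [_|w s IH /= /andP[ws us]].
  have -> : c @^-1` [set w | w \in [::]] = set0 by rewrite -subset0 => x.
  by rewrite big_nil; split; [exact: alg0|case: addp].
have [Gs ps] := IH us.
have -> : c @^-1` [set w' | w' \in w :: s] =
    c @^-1` [set w] `|` c @^-1` [set w' | w' \in s].
  apply/seteqP; split => x /=; rewrite in_cons.
    by move=> /orP[/eqP|]; [left|right].
  by move=> [/eqP|] h; apply/orP; [left|right].
split; first exact: algU.
rewrite big_cons -ps; case: addp => _; apply => //.
by rewrite -subset0 => x /= [xw xs]; rewrite -xw xs in ws.
Qed.

Lemma additive_preimage (S : pred W) :
  p (c @^-1` [set w | S w]) = \sum_(w | S w) p (c @^-1` [set w]).
Proof.
have [_] := fiber_seq (enum_uniq S); rewrite big_enum /= => <-; congr p.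
by apply/seteqP; split => x /=; rewrite mem_enum.
Qed.

Lemma additive_total : p setT = \sum_w p (c @^-1` [set w]).
Proof. by rewrite -additive_preimage; congr p; apply/seteqP; split. Qed.

End Fibers.

Lemma coding_pair (W W' : finType) (c : Om -> W) (c' : Om -> W') :
  coding G c -> coding G c' -> coding G (fun x => (c x, c' x)).
Proof.
move=> cG cG' [w w']; have := algI (cG w) (cG' w'); congr G.
by apply/seteqP; split => x /=; [case=> -> ->|case=> <- <-].
Qed.

Lemma coding_set A : G A -> coding G (fun x => `[<A x>]).
Proof.
move=> GA [].
  by move: GA; congr G; apply/seteqP; split => x /= /asboolP.
move/algC: GA; congr G; apply/seteqP; split => x /=.
  by move=> /asboolPn/negbTE.
by move=> /negbT/asboolPn.
Qed.

(** A class of [g \o d] is the disjoint union of the classes of [d] above it, so an expression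
    additive in the mass can be computed on the finer partition. [F] is abstract because it stands
    for inner products with vector masses as well as for real and scalar weights. *)
Lemma coding_refine (V V' : zmodType) (p : set Om -> V) (W W' : finType)
    (d : Om -> W') (g : W' -> W) (F : W -> V -> V') :
  finitely_additive G p -> coding G d ->
  (forall w, F w 0 = 0) -> (forall w x y, F w (x + y) = F w x + F w y) ->
  \sum_w F w (p ((g \o d) @^-1` [set w])) =
  \sum_w' F (g w') (p (d @^-1` [set w'])).
Proof.
move=> addp dG F0 FD; rewrite [RHS](partition_big g xpredT) //=.
apply: eq_bigr => w _.
have -> : (g \o d) @^-1` [set w] = d @^-1` [set w' | g w' == w].
  by apply/seteqP; split => x /= /eqP.
rewrite (additive_preimage addp dG).
rewrite (big_morph (F w) (FD w) (F0 w)).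
by apply: eq_bigr => w' /eqP ->.
Qed.

Lemma coding_weight_le (R : numDomainType) (D : set Om -> R) (W : finType) (c : Om -> W)
    (q : W -> R) (C : R) :
  finitely_additive G D -> (forall A, G A -> 0 <= D A) -> coding G c ->
  (forall x, q (c x) <= C) ->
  \sum_w q w * D (c @^-1` [set w]) <= C * D setT.
Proof.
move=> addD D0 cG qC; rewrite (additive_total addD cG) mulr_sumr.
apply: ler_sum => w _.
(* A class that is not attained has an empty fibre, hence mass 0, so [q] needs a bound only at the
   values of [c]. *)
have [[x /= xw]|e] := pselect (exists x, c x = w).
  by rewrite ler_wpM2r ?D0 // -xw.
have -> : c @^-1` [set w] = set0 by rewrite -subset0 => x /= xw; apply: e; exists x.
by case: addD => -> _; rewrite !mulr0.
Qed.

Lemma additive_mono (R : numDomainType) (D : set Om -> R) A B :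
  finitely_additive G D -> (forall A, G A -> 0 <= D A) ->
  G A -> G B -> A `<=` B -> D A <= D B.
Proof.
move=> [_ addD] D0 GA GB AB.
rewrite -(setDUK AB) addD; first by rewrite lerDl D0 //; exact: algD.
- by [].
- exact: algD.
- by rewrite -subset0 => x [? []].
Qed.

Lemma additiveD (R : zmodType) (D : set Om -> R) A B :
  finitely_additive G D -> G A -> G B -> A `<=` B -> D (B `\` A) = D B - D A.
Proof.
move=> [_ addD] GA GB AB.
rewrite -{2}(setDUK AB) addD; first by rewrite addrC addKr.
- by [].
- exact: algD.
- by rewrite -subset0 => x [? []].
Qed.

Lemma additiveU_le (R : numDomainType) (D : set Om -> R) A B :
  finitely_additive G D -> (forall A, G A -> 0 <= D A) ->
  G A -> G B -> D (A `|` B) <= D A + D B.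
Proof.
move=> addD D0 GA GB.
have -> : A `|` B = A `|` (B `\` A) by rewrite setDE setUIr setUCr setIT.
case: (addD) => _ ->.
- by rewrite lerD2l (additive_mono addD D0 (algD GB GA) GB) // => x [].
- by [].
- exact: algD.
- by rewrite -subset0 => x [? []].
Qed.

Lemma coding_weight_local (R : numDomainType) (D : set Om -> R) (W : finType) (c : Om -> W)
    (q : W -> R) (S : set Om) (C e : R) :
  finitely_additive G D -> (forall A, G A -> 0 <= D A) -> coding G c -> G S ->
  (forall x, S x -> q (c x) <= C) -> (forall x, ~ S x -> q (c x) <= e) ->
  \sum_w q w * D (c @^-1` [set w]) <= C * D S + e * D (~` S).
Proof.
move=> addD D0 cG GS qC qe.
(* Recording membership in [S] refines the partition until each class lies in [S] or in its
   complement. *)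
pose d x := (c x, `[<S x>]).
have dG : coding G d by apply: coding_pair => //; exact: coding_set.
rewrite (@coding_refine _ _ D _ _ d fst (fun w => *%R (q w)) addD dG); last first.
- by move=> w x y; rewrite mulrDr.
- by move=> w; rewrite mulr0.
have -> : D S = \sum_(w | w.2) D (d @^-1` [set w]).
  rewrite -(additive_preimage addD dG); congr D.
  by apply/seteqP; split => x /= /asboolP.
have -> : D (~` S) = \sum_(w | ~~ w.2) D (d @^-1` [set w]).
  rewrite -(additive_preimage addD dG (fun w => ~~ w.2)); congr D.
  by apply/seteqP; split => x /= /asboolPn.
rewrite (bigID (fun w => w.2)) /= !mulr_sumr.
have H (w : W * bool) (a : R) : (forall x, d x = w -> q (c x) <= a) ->
    q w.1 * D (d @^-1` [set w]) <= a * D (d @^-1` [set w]).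
  move=> h; have [[x xw]|ex] := pselect (exists x, d x = w).
    by rewrite ler_wpM2r ?D0 // -xw /= h.
  have -> : d @^-1` [set w] = set0 by rewrite -subset0 => x /= xw; apply: ex; exists x.
  by case: addD => -> _; rewrite !mulr0.
apply: lerD; apply: ler_sum => w hw; apply: H => x dx.
  by apply: qC; apply/asboolP; rewrite -[asbool _]/((d x).2) dx.
by apply: qe; apply/asboolPn; rewrite -[asbool _]/((d x).2) dx.
Qed.

End Algebra.
End Codes.

Section CodedSums.
Context {R : realType} {k : scalar_kind} {n : nat} {Om : Type}.
Local Notation K := (scalar_field R k).
Local Notation X := 'rV[K]_n.
Variables (G : set (set Om)) (algG : set_algebra G).

(** This is the integral of the step function [v \o c] with respect to [m]. *)
Definition coded_sum (W : finType) (m : set Om -> X) (c : Om -> W) (v : W -> X) : K :=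
  \sum_w inner (v w) (m (c @^-1` [set w])).

Lemma coded_sum_refine (W W' : finType) (m : set Om -> X) (c : Om -> W)
    (d : Om -> W') (g : W' -> W) (v : W -> X) :
  finitely_additive G m -> coding G d -> (forall x, g (d x) = c x) ->
  coded_sum m c v = coded_sum m d (v \o g).
Proof.
move=> addm dG /funext <-.
rewrite /coded_sum (@coding_refine _ _ algG _ _ m _ _ d g (fun w => inner (v w))) //.
  by move=> w; rewrite inner0r.
by move=> w x y; rewrite innerDr.
Qed.

(* [D] plays the role of the variation of [m]. *)
Definition dominated (m : set Om -> X) (D : set Om -> R) :=
  [/\ finitely_additive G m, finitely_additive G D &
      forall A, G A -> hnorm (m A) <= D A].

Section Dominated.
Variables (m : set Om -> X) (D : set Om -> R) (mD : dominated m D).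

Lemma dominated_ge0 A : G A -> 0 <= D A.
Proof. by case: mD => _ _ h /h; exact/le_trans/hnorm_ge0. Qed.

Lemma coded_sum_le_weight (W : finType) (c : Om -> W) (v : W -> X) :
  coding G c ->
  modulus (coded_sum m c v) <= \sum_w hnorm (v w) * D (c @^-1` [set w]).
Proof.
move=> cG; rewrite (le_trans (modulus_sum _ _ _)) //.
apply: ler_sum => w _; rewrite (le_trans (inner_le _ _)) //.
by rewrite ler_wpM2l ?hnorm_ge0 //; case: mD => _ _; apply.
Qed.

Lemma coded_sum_local (W : finType) (c : Om -> W) (v : W -> X) (S : set Om) (C e : R) :
  coding G c -> G S -> 0 <= e ->
  (forall x, S x -> hnorm (v (c x)) <= C) -> (forall x, ~ S x -> hnorm (v (c x)) <= e) ->
  modulus (coded_sum m c v) <= C * D S + e * D setT.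
Proof.
move=> cG GS e0 vC ve; apply: le_trans (coded_sum_le_weight v cG) _.
have [_ addD _] := mD.
apply: le_trans (coding_weight_local algG addD dominated_ge0 cG GS vC ve) _.
rewrite lerD2l ler_wpM2l // (additive_mono algG addD dominated_ge0) //.
  exact: algC.
exact: algT.
Qed.

Lemma coded_sum_le (W : finType) (c : Om -> W) (v : W -> X) (C : R) :
  coding G c -> (forall x, hnorm (v (c x)) <= C) ->
  modulus (coded_sum m c v) <= C * D setT.
Proof.
move=> cG vC; apply: le_trans (coded_sum_le_weight v cG) _.
by case: (mD) => _ addD _; apply: (coding_weight_le algG) => //; exact: dominated_ge0.
Qed.

End Dominated.

Lemma coded_sumB (W : finType) (m : set Om -> X) (c : Om -> W) (u v : W -> X) :
  coded_sum m c u - coded_sum m c v = coded_sum m c (fun w => u w - v w).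
Proof. by rewrite /coded_sum -sumrB; apply: eq_bigr => w _; rewrite innerBl. Qed.

Lemma coded_sum_diff (W W' : finType) (m : set Om -> X) (c : Om -> W) (u : W -> X)
    (d : Om -> W') (v : W' -> X) :
  finitely_additive G m -> coding G c -> coding G d ->
  coded_sum m c u - coded_sum m d v =
  coded_sum m (fun x => (c x, d x)) (fun w => u w.1 - v w.2).
Proof.
move=> addm cG dG; have cdG := coding_pair algG cG dG.
by rewrite (coded_sum_refine u addm cdG (g := fst)) //
  (coded_sum_refine v addm cdG (g := snd)) // coded_sumB.
Qed.

(** Both step functions are constant on the classes of the pair [(c x, d x)]. The estimate makes the
    integral independent of the approximating sequence. *)
Lemma coded_sum_close m D (W W' : finType) (c : Om -> W) (u : W -> X)
    (d : Om -> W') (v : W' -> X) (e : R) :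
  dominated m D -> coding G c -> coding G d ->
  (forall x, hnorm (u (c x) - v (d x)) <= e) ->
  modulus (coded_sum m c u - coded_sum m d v) <= e * D setT.
Proof.
move=> mD cG dG uv; have [addm _ _] := mD.
rewrite coded_sum_diff //; apply: (coded_sum_le mD) => //.
exact: coding_pair.
Qed.

End CodedSums.

(** * Borel measures and the integral *)

Section BorelSets.
Context {T : topologicalType}.
Implicit Types A B : set T.

Lemma borel0 : borel (set0 : set T).
Proof. exact: sigma_algebra0. Qed.

Lemma borelC A : borel A -> borel (~` A).
Proof. by move=> bA; rewrite -setTD; exact: sigma_algebraCD. Qed.

Lemma borel_bigcup (F : nat -> set T) : (forall i, borel (F i)) -> borel (\bigcup_i F i).
Proof. exact: sigma_algebra_bigcup. Qed.

Lemma borelU A B : borel A -> borel B -> borel (A `|` B).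
Proof.
by move=> bA bB; rewrite -bigcup2E; apply: borel_bigcup => -[|[|i]] //=; exact: borel0.
Qed.

Lemma borel_algebra : set_algebra (@borel T).
Proof. by split; [exact: borel0|exact: borelC|exact: borelU]. Qed.

Lemma borelI A B : borel A -> borel B -> borel (A `&` B).
Proof. exact: (algI borel_algebra). Qed.

Lemma borelD A B : borel A -> borel B -> borel (A `\` B).
Proof. exact: (algD borel_algebra). Qed.

Lemma borelT : borel (setT : set T).
Proof. exact: (algT borel_algebra). Qed.

Lemma borel_bigcap (F : nat -> set T) : (forall i, borel (F i)) -> borel (\bigcap_i F i).
Proof.
move=> bF; rewrite -[\bigcap_i _]setCK setC_bigcap; apply: borelC.
by apply: borel_bigcup => i; exact: borelC.
Qed.

Lemma borel_open A : open A -> borel A.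
Proof. exact: (@sub_sigma_algebra _ setT (@open T) A). Qed.

Lemma borel_closed A : closed A -> borel A.
Proof. by move=> cA; rewrite -[A]setCK; apply: borelC; apply: borel_open; exact: closed_openC. Qed.

Lemma borel_bigsetU (N : nat) (F : nat -> set T) :
  (forall i, borel (F i)) -> borel (\big[setU/set0]_(i < N) F i).
Proof.
by move=> bF; elim/big_ind: _ => //; [exact: borel0|move=> A B; exact: borelU].
Qed.

Lemma coding_indicators (p : nat) (E : 'I_p -> set T) :
  (forall i, borel (E i)) ->
  coding (@borel T) (fun t => [ffun i : 'I_p => `[<E i t>]]).
Proof.
move=> bE; set c := fun t : T => _.
move=> w.
(* The finite intersection becomes the complement of a union over [nat], padded with the empty set
   from index [p] on. *)
have -> : c @^-1` [set w] =
    ~` \bigcup_j (if insub j is Some i then if w i then ~` E i else E i else set0).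
  apply/seteqP; split => t /=.
    move=> <- [j _]; case: insubP => // i _ _; rewrite ffunE.
    by case: asboolP.
  move=> h; apply/ffunP => i; rewrite ffunE; apply: contrapT => wi; apply: h.
  exists (val i) => //=; rewrite valK; move: wi.
  by case: asboolP; case: (w i).
apply: borelC; apply: borel_bigcup => j; case: insubP => [i _ _|_]; last exact: borel0.
by case: (w i) => //; exact: borelC.
Qed.

End BorelSets.

(** * Continuity of finite measures along monotone sequences *)

Section CountablyAdditive.
Context {R : realType} {T : topologicalType}.

(** [nrm] is the absolute value for real measures and the Hilbert norm for vector measures, so one
    proof serves both. *)
Lemma countable_finitely_additive (V : zmodType) (nrm : V -> R) (p : set T -> V) :
  (forall x, (forall e, 0 < e -> nrm x <= e) -> x = 0) ->
  (forall x y, nrm (x + y) <= nrm x + nrm y) -> (forall x, nrm (- x) = nrm x) ->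
  (forall A : nat -> set T, (forall i, borel (A i)) -> trivIset [set: nat] A ->
    forall e : R, 0 < e ->
    \forall N \near \oo, nrm (p (\bigcup_i A i) - \sum_(i < N) p (A i)) < e) ->
  finitely_additive (@borel T) p.
Proof.
move=> nrm0 nrmD nrmN pA.
have p0 : p set0 = 0.
  apply: nrm0 => e e0.
  (* For the constant sequence [set0], consecutive partial sums differ by [p set0] and are both
     close to the same limit. *)
  have := pA (fun=> set0) (fun=> borel0) (@trivIset_set0 _ _ _) (e / 2) (divr_gt0 e0 (ltr0n _ 2)).
  case=> N _ h.
  have h1 := h N (leqnn N); have h2 := h N.+1 (leqnSn N).
  move: h1 h2; rewrite /= big_ord_recr /=; set s := \sum_(i < N) _.
  set l := p (\bigcup_i _) => h1 h2.
  have -> : p set0 = (l - s) + - (l - (s + p set0)).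
    by rewrite opprB !addrA subrK addrC addKr.
  by rewrite (le_trans (nrmD _ _)) // nrmN; lra.
split => // A B bA bB AB.
apply/eqP; rewrite -subr_eq0; apply/eqP; apply: nrm0 => e e0.
have bF i : borel (bigcup2 A B i) by case: i => [|[|i]] //=; exact: borel0.
have tF : trivIset setT (bigcup2 A B) by rewrite -trivIset_bigcup2.
have [N _ h] := pA _ bF tF _ e0.
have := h N.+2 (leq_trans (leqnSn N) (leqnSn N.+1)).
rewrite /= bigcup2E !big_ord_recl /= big1 ?addr0; last by move=> i _.
by move/ltW.
Qed.

Definition countably_additive (D : set T -> R) :=
  forall A : nat -> set T, (forall i, borel (A i)) -> trivIset [set: nat] A ->
  (fun N => \sum_(i < N) D (A i)) @ \oo --> D (\bigcup_i A i).

Lemma countably_additive_finitely D :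
  countably_additive D -> finitely_additive (@borel T) D.
Proof.
move=> aD; apply: (@countable_finitely_additive _ Num.norm).
- move=> x h; apply/eqP; rewrite -normr_le0; apply/ler_addgt0Pr => e e0.
  by rewrite add0r h.
- exact: ler_normD.
- exact: normrN.
- by move=> A bA tA e e0; apply: ((cvgrPdist_lt _ _).1 (aD A bA tA)).
Qed.

Section FiniteMeasure.
Variables (D : set T -> R) (aD : countably_additive D).
Hypothesis D0 : forall A, borel A -> 0 <= D A.

Let fD := countably_additive_finitely aD.

Lemma measure_cvg_set0 (B : nat -> set T) :
  (forall i, borel (B i)) -> (forall i, B i.+1 `<=` B i) -> \bigcap_i B i = set0 ->
  forall e, 0 < e -> \forall N \near \oo, D (B N) < e.
Proof.
move=> bB decB capB e e0.
have mono i j : (i <= j)%N -> B j `<=` B i.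
  by elim: j => [|j IH]; [rewrite leqn0 => /eqP ->|rewrite leq_eqVlt => /predU1P[->//|/IH h x /decB /h]].
(* The shells are disjoint with union [B 0], and their partial sums telescope to
   [D (B 0) - D (B N)]. *)
pose C i := B i `\` B i.+1.
have bC i : borel (C i) by exact: borelD.
have tC : trivIset setT C.
  apply/trivIsetP => i j _ _; wlog ij : i j / (i < j)%N.
    move=> h; rewrite neq_ltn => /orP[] ij; first by apply: h => //; rewrite ltn_eqF.
    by rewrite setIC; apply: h => //; rewrite ltn_eqF.
  by move=> _; rewrite -subset0 => x [[_ nx] [/(mono _ _ ij)]].
have UC : \bigcup_i C i = B 0%N.
  apply/seteqP; split => [x [i _ [/(mono _ _ (leq0n i))]] //|x Bx].
  apply: contrapT => nx; suff : (\bigcap_i B i) x by rewrite capB.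
  move=> i _; elim: i => // i IH; apply: contrapT => nB.
  by apply: nx; exists i.
have sumC N : \sum_(i < N) D (C i) = D (B 0%N) - D (B N).
  elim: N => [|N IH]; first by rewrite big_ord0 subrr.
  rewrite big_ord_recr /= IH (additiveD borel_algebra fD (bB N.+1) (bB N)) //.
  by rewrite addrA subrK.
have [N0 _ h] := (cvgrPdist_lt _ _).1 (aD bC tC) e e0.
exists N0 => // N /h /=; rewrite UC sumC opprB addrC subrK.
by apply: le_lt_trans; exact: ler_norm.
Qed.

Lemma measure_cvg_bigcap (B : nat -> set T) :
  (forall i, borel (B i)) -> (forall i, B i.+1 `<=` B i) ->
  forall e, 0 < e -> \forall N \near \oo, D (B N `\` \bigcap_i B i) < e.
Proof.
move=> bB decB; apply: (@measure_cvg_set0 (fun N => B N `\` \bigcap_i B i)).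
- by move=> i; apply: borelD => //; exact: borel_bigcap.
- by move=> i x [Bx nx]; split => //; exact: decB.
- rewrite -subset0 => x h; have [_ []] := h 0%N I.
  by move=> i _; have [] := h i I.
Qed.

Lemma measure_cvg_bigcup (A : nat -> set T) :
  (forall i, borel (A i)) ->
  forall e, 0 < e ->
  \forall N \near \oo, D (\bigcup_i A i `\` \big[setU/set0]_(i < N) A i) < e.
Proof.
move=> bA; apply: measure_cvg_set0.
- by move=> i; apply: borelD; [exact: borel_bigcup|exact: borel_bigsetU].
- by move=> i x [Ax nx]; split => // ?; apply: nx; rewrite big_ord_recr /=; left.
- rewrite -subset0 => x h; have [[i _ Ai] _] := h 0%N I.
  by have [_] := h i.+1 I; apply; rewrite big_ord_recr /=; right.
Qed.

End FiniteMeasure.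
End CountablyAdditive.

(** * The integral as a limit of sums over codings *)

Section Integral.
Context {R : realType} {k : scalar_kind} {n : nat} {T : metricType R}.
Local Notation K := (scalar_field R k).
Local Notation X := 'rV[K]_n.
Implicit Types (m : set T -> X) (D : set T -> R) (f g : T -> X).

Lemma sigma_additive_finitely m :
  sigma_additive_on_borel m -> finitely_additive (@borel T) m.
Proof.
move=> am; apply: (@countable_finitely_additive R _ _ hnorm).
- move=> x h; apply: hnorm_eq0; apply/eqP; rewrite eq_le hnorm_ge0 andbT.
  by apply/ler_addgt0Pr => e e0; rewrite add0r h.
- exact: hnormD.
- exact: hnormN.
- by move=> A bA tA; apply: (cvg_hnorm _ _ _).1; exact: am.
Qed.

(** The uniform closure of the step functions. On a compact space it contains the continuous
    functions, and it always contains the indicators of Borel sets, so that bumps and indicators can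
    be integrated and subtracted in one calculus. *)
Definition simple_approximable f := forall e : R, 0 < e ->
  exists (W : finType) (c : T -> W) (v : W -> X),
    coding (@borel T) c /\ forall t, hnorm (f t - v (c t)) <= e.

(** The sets of a simple function may overlap. The classes are the patterns of membership, and the
    value on a pattern is the sum of the [x i] occurring in it. *)
Lemma simple_fun_coding (s : @simple_fun R k n T) :
  exists (W : finType) (c : T -> W) (v : W -> X),
    [/\ coding (@borel T) c, forall t, simple_eval s t = v (c t) &
        forall m, finitely_additive (@borel T) m ->
          simple_integral m s = coded_sum m c v].
Proof.
case: s => p E x bE.
pose c t := [ffun i : 'I_p => `[<E i t>]].
pose v (w : {ffun 'I_p -> bool}) : X := \sum_(i < p | w i) x i.
have cB : coding (@borel T) c by exact: coding_indicators.
exists {ffun 'I_p -> bool}, c, v; split => //.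
  move=> t; rewrite /simple_eval /v /= [RHS]big_mkcond /=.
apply: eq_bigr => i _ /=.
  rewrite ffunE indicE; case: asboolP => h.
    by rewrite mem_set // scale1r.
  by rewrite memNset // scale0r.
move=> m addm; rewrite /simple_integral /coded_sum /v /=.
under [RHS]eq_bigr do rewrite inner_suml big_mkcond.
rewrite [RHS]exchange_big /=; apply: eq_bigr => i _.
rewrite -big_mkcond -inner_sumr -(additive_preimage borel_algebra addm cB (fun w => w i)).
congr (inner _ (m _)).
by apply/seteqP; split => t /=; rewrite ffunE => /asboolP.
Qed.

Lemma coding_simple_fun (W : finType) (c : T -> W) (v : W -> X) :
  coding (@borel T) c ->
  exists s : @simple_fun R k n T, (forall t, simple_eval s t = v (c t)) /\
    forall m, simple_integral m s = coded_sum m c v.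
Proof.
move=> cB.
exists (@SimpleFun R k n T #|W| (fun i => c @^-1` [set enum_val i])
  (fun i => v (enum_val i)) (fun i => cB _)); split.
  move=> t; rewrite /simple_eval /= -(big_enum_val (fun w => \1_(c @^-1` [set w]) t *: v w)) /=.
  rewrite (bigD1 (c t)) //= big1 ?addr0; first by rewrite indicE mem_set // scale1r.
  move=> w wt; rewrite indicE memNset ?scale0r // => /= e.
  by rewrite e eqxx in wt.
by move=> m; rewrite /simple_integral /= -(big_enum_val (fun w => inner (v w) (m (c @^-1` [set w])))).
Qed.

(** Completeness of [K], deduced for both kinds of scalars from that of [R] through real and
    imaginary parts. *)
Lemma modulus_cauchy_cvg (u : nat -> K) :
  (forall e : R, 0 < e -> exists N, forall i j, (N <= i)%N -> (N <= j)%N ->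
    modulus (u i - u j) < e) ->
  exists l, forall e : R, 0 < e -> \forall N \near \oo, modulus (l - u N) < e.
Proof.
move=> uC.
have realC (g : K -> R) : (forall x y, g (x - y) = g x - g y) ->
    (forall x, `|g x| <= modulus x) -> exists l : R, (g \o u) @ \oo --> l.
  move=> gB g_le; apply/cvg_ex; apply: cauchy_cvg; apply/cauchy_ballP => e e0.
  have [N h] := uC e e0.
  exists ((g \o u) @` [set i | (N <= i)%N], (g \o u) @` [set i | (N <= i)%N]).
    by split; exists N => // i /= Ni; exists i.
  move=> [x y] /= [[i Ni <-] [j Nj <-]]; rewrite /ball /= -gB.
  by rewrite (le_lt_trans (g_le _)) // h.
have [a ua] := realC real_part real_partB real_part_le.
have [b ub] := realC imag_part imag_partB imag_part_le.
exists (of_real a * 1 + of_real b * imag_unit) => e e0.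
have e2 : 0 < e / 2 by rewrite divr_gt0.
have [N0 _ h] := filterI ((cvgrPdist_lt _ _).1 ua _ e2) ((cvgrPdist_lt _ _).1 ub _ e2).
exists N0 => // N /h [/= hA hB].
rewrite [u N]scalar_parts opprD addrACA -!mulrBl -!of_realN -!of_realD.
rewrite (le_lt_trans (modulusD _ _)) // !modulusM !modulus_of_real modulus1 mulr1.
have := ler_pM (normr_ge0 (b - imag_part (u N))) (modulus_ge0 _) (lexx _) (@modulus_imag_unit R k).
rewrite mulr1; lra.
Qed.

(** Every later property of [integral_of] is deduced from this estimate by letting [e] tend to 0;
    its definition is not opened again. *)
Lemma integral_of_approx m D f (W : finType) (c : T -> W) (v : W -> X) (e : R) :
  dominated (@borel T) m D -> simple_approximable f -> coding (@borel T) c ->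
  (forall t, hnorm (f t - v (c t)) <= e) ->
  modulus (integral_of m f - coded_sum m c v) <= e * D setT.
Proof.
move=> mD sf cB fv.
have DT : 0 <= D setT by apply: (dominated_ge0 mD); exact: borelT.
have inv_gt0 j : 0 < j.+1%:R^-1 :> R by rewrite invr_gt0.
have [s hs] : {s : nat -> @simple_fun R k n T &
    forall j, exists (W' : finType) (c' : T -> W') (v' : W' -> X),
    [/\ coding (@borel T) c', forall t, hnorm (f t - v' (c' t)) <= j.+1%:R^-1,
        forall t, simple_eval (s j) t = v' (c' t) & simple_integral m (s j) = coded_sum m c' v']}.
  apply: (@choice _ _ (fun j s => exists (W' : finType) (c' : T -> W') (v' : W' -> X),
    [/\ coding (@borel T) c', forall t, hnorm (f t - v' (c' t)) <= j.+1%:R^-1,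
        forall t, simple_eval s t = v' (c' t) & simple_integral m s = coded_sum m c' v'])) => j.
  have [W' [c' [v' [c'B fv']]]] := sf _ (inv_gt0 j).
  have [s [s1 s2]] := coding_simple_fun v' c'B.
  by exists s, W', c', v'.
have small (e' : R) : 0 < e' -> exists N, forall j, (N <= j)%N -> j.+1%:R^-1 < e' :> R.
  move=> e'0; have [N _ h] := near_infty_natSinv_lt (PosNum e'0).
  by exists N => j /h.
have sf_cvg : {uniform, (fun j => simple_eval (s j)) @ \oo --> f}.
  apply/uniform_cvg_hnorm => e' e'0; have [N hN] := small _ e'0.
  exists N => // j /= /hN hj t; have [W' [c' [v' [_ h1 h2 _]]]] := hs j.
  by rewrite h2 (le_lt_trans (h1 t)).
have [l hl] : exists l, forall e : R, 0 < e ->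
    \forall N \near \oo, modulus (l - simple_integral m (s N)) < e.
  apply: modulus_cauchy_cvg => e' e'0.
  have d0 : 0 < e' / (2 * (D setT + 1)).
    by rewrite divr_gt0 // mulr_gt0 // ltr_pwDr.
  have [N hN] := small _ d0; exists N => i j /hN hi /hN hj.
  have [Wi [ci [vi [ciB fi _ ->]]]] := hs i.
  have [Wj [cj [vj [cjB fj _ ->]]]] := hs j.
  rewrite (@le_lt_trans _ _ ((i.+1%:R^-1 + j.+1%:R^-1) * D setT)) //.
    apply: (coded_sum_close borel_algebra mD) => // t.
    apply: le_trans (hnorm_triangle (f t) _ _) _.
    by apply: lerD; [rewrite hnormBC; exact: fi|exact: fj].
  have hd : e' = e' / (2 * (D setT + 1)) * (2 * (D setT + 1)).
    by field; lra.
  rewrite [ltRHS]hd; set d := e' / _ in hd hi hj d0 *.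
  have : (i.+1%:R^-1 + j.+1%:R^-1) * D setT <= (2 * d) * D setT.
    by rewrite ler_wpM2r // mulr_natl mulr2n lerD // ltW.
  by move=> /le_lt_trans; apply; lra.
(* Since a limit exists, [xget] returns a genuine one, reached along a sequence [s'] that may differ
   from [s]. *)
have [s' [s'f s'l]] : [set c | exists s : nat -> simple_fun,
     {uniform, (fun j => simple_eval (s j)) @ \oo --> f} /\
     (fun j => simple_integral m (s j)) @ \oo --> c] (integral_of m f).
  by apply: xgetPex; exists l; exists s; split => //; apply/cvg_modulus.
apply/ler_addgt0Pr => e' e'0.
have d0 : 0 < e' / (D setT + 1) by rewrite divr_gt0 // ltr_pwDr.
have [N [/= hN1 hN2]] := filter_ex (filterI
  ((uniform_cvg_hnorm _ _ _).1 s'f _ d0) ((cvg_modulus _ _ _).1 s'l _ d0)).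
have [W' [c' [v' [c'B s'v' s'm]]]] := simple_fun_coding (s' N).
move: hN2; rewrite s'm; last by case: mD.
set d := e' / _ in d0 hN1 * => hN2.
have hc : modulus (coded_sum m c' v' - coded_sum m c v) <= (d + e) * D setT.
  apply: (coded_sum_close borel_algebra mD) => // t.
  apply: le_trans (hnorm_triangle (f t) _ _) _.
  apply: lerD; last exact: fv.
  by rewrite hnormBC -s'v' ltW.
have -> : integral_of m f - coded_sum m c v =
    (integral_of m f - coded_sum m c' v') + (coded_sum m c' v' - coded_sum m c v).
  by rewrite addrA subrK.
have hd : e' = d * (D setT + 1) by rewrite /d; field; lra.
have := modulusD (integral_of m f - coded_sum m c' v') (coded_sum m c' v' - coded_sum m c v).
lra.
Qed.

End Integral.

(** * Functions on a compact metric space *)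

Section CompactMetric.
Context {R : realType} {T : metricType R}.
Implicit Types (s t x y : T).

Lemma nbhs_mdist x (A : set T) :
  nbhs x A <-> exists2 e : R, 0 < e & forall y, mdist x y < e -> A y.
Proof.
split => [/nbhs_ballP[e e0 xA]|[e e0 xA]].
  by exists e => // y xy; apply: xA; rewrite ballEmdist.
by apply/nbhs_ballP; exists e => // y; rewrite ballEmdist; exact: xA.
Qed.

Lemma open_mdist_ball x (r : R) : open [set y | mdist x y < r].
Proof.
rewrite openE => y /= xy; apply/nbhs_mdist; exists (r - mdist x y).
  by rewrite subr_gt0.
by move=> z yz /=; have := metric_triangle x y z; lra.
Qed.

Lemma natSinv_gt0 (i : nat) : 0 < i.+1%:R^-1 :> R.
Proof. by rewrite invr_gt0. Qed.

Lemma natSinv_small (e : R) : 0 < e -> exists N, forall i, (N <= i)%N -> i.+1%:R^-1 < e.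
Proof.
by move=> e0; have [N _ h] := near_infty_natSinv_lt (PosNum e0); exists N => i /h.
Qed.

Hypothesis compactT : compact [set: T].

(** Finitely many of the neighbourhoods cover [T], and the largest of their thresholds serves
    everywhere. Uniform continuity, the separation of closed sets and the existence of accumulation
    points all come from this form of compactness. *)
Lemma compact_eventually (P : nat -> T -> Prop) :
  (forall x, exists2 r : R, 0 < r & exists N, forall y i,
     mdist x y < r -> (N <= i)%N -> P i y) ->
  exists N, forall i, (N <= i)%N -> forall x, P i x.
Proof.
move=> h; have [] := (compact_near_coveringP _).1 compactT nat \oo P _.
  move=> x _; have [r r0 [N hN]] := h x.
  exists ([set y | mdist x y < r], [set i | (N <= i)%N]).
    by split; [apply/nbhs_mdist; exists r|exists N].
  by move=> [y i] [/= xy Ni]; exact: hN.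
by move=> N _ hN; exists N => i Ni x; exact: hN.
Qed.

Lemma finite_net (e : R) : 0 < e -> exists s : seq T, forall t, exists2 c, c \in s & mdist c t < e.
Proof.
(* Along this filter on finite sequences, a centre once present stays present; compactness then
   produces one sequence that works for all points. *)
move=> e0; pose F := filter_from [set: seq T] (fun s : seq T => [set s' : seq T | {subset s <= s'}]).
have FF : Filter F.
  apply: filter_from_filter; first by exists [::].
  by move=> s s' _ _; exists (s ++ s') => // s'' /= h; split => x xs; apply: h;
    rewrite mem_cat xs ?orbT.
have [] := (compact_near_coveringP _).1 compactT _ F
  (fun (s : seq T) t => exists2 c, c \in s & mdist c t < e) _.
  move=> x _; exists ([set y | mdist x y < e], [set s : seq T | x \in s]); last first.
    by move=> [y s] [/= xy xs]; exists x.
  split; first by apply/nbhs_mdist; exists e.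
  by exists [:: x] => // s /= h; apply: h; rewrite inE.
by move=> s _ hs; exists s => t; exact: hs.
Qed.

(** [E] enumerates the balls of radius [1/(i+1)] around finite nets of that radius. If [s] and [t]
    lie in the same balls of one net, some centre is close to both. *)
Lemma separating_sequence :
  exists E : nat -> set T, (forall j, open (E j)) /\
    forall e : R, 0 < e -> exists N, forall s t,
      (forall j, (j < N)%N -> E j s <-> E j t) -> mdist s t < e.
Proof.
have [c hc] := choice (fun i => finite_net (natSinv_gt0 i)).
pose B i x := [set t : T | mdist x t < i.+1%:R^-1].
exists (fun j => if unpickle j is Some il then nth set0 [seq B il.1 x | x <- c il.1] il.2
  else set0); split.
  move=> j; case: unpickle => [[i l] /=|]; last exact: open0.
  have [lt|ge] := ltnP l (size (c i)); last by rewrite nth_default ?size_map //; exact: open0.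
  case: (c i) lt => // x0 s lt; rewrite (nth_map x0) //; exact: open_mdist_ball.
move=> e e0; have [i hi] := natSinv_small (divr_gt0 e0 (ltr0n R 2)).
(* This [N] exceeds the codes of all balls of the [i]-th net. *)
exists (\max_(l < size (c i)) (pickle (i, val l)).+1) => s t st.
have [x xc xs] := hc i s.
have lt : (index x (c i) < size (c i))%N by rewrite index_mem.
have := st (pickle (i, index x (c i))) (leq_bigmax (Ordinal lt)).
rewrite pickleK /= (nth_map x) // nth_index // => -[/(_ xs) xt _].
have := metric_triangle s x t; have := metric_sym s x.
by have := hi i (leqnn i); move: xs xt; rewrite /B /=; move: (i.+1%:R^-1) => u; lra.
Qed.

Lemma fine_coding (e : R) : 0 < e ->
  exists (W : finType) (c : T -> W), coding (@borel T) c /\ forall s t, c s = c t -> mdist s t < e.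
Proof.
move=> e0; have [E [oE hE]] := separating_sequence; have [N hN] := hE e e0.
exists {ffun 'I_N -> bool}, (fun t => [ffun i : 'I_N => `[<E i t>]]); split.
  by apply: coding_indicators => i; exact: borel_open.
move=> s t st; apply: hN => j jN.
have := congr1 (fun w : {ffun 'I_N -> bool} => w (Ordinal jN)) st.
by rewrite !ffunE => h; exact: (asbool_eq_equiv h).
Qed.

End CompactMetric.

(** * Continuous and Lipschitz maps into [X] *)

Section ContinuousFunctions.
Context {R : realType} {k : scalar_kind} {n : nat} {T : metricType R}.
Local Notation K := (scalar_field R k).
Local Notation X := 'rV[K]_n.
Implicit Types (f g : T -> X) (s t x y : T).

Definition lipschitz (L : R) f := forall s t, hnorm (f s - f t) <= L * mdist s t.

Lemma continuous_hnorm f : continuous f <->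
  forall t (e : R), 0 < e -> exists2 d : R, 0 < d & forall s, mdist t s < d -> hnorm (f t - f s) < e.
Proof.
split => [cf t e e0|h t A /nbhs_hnorm[e e0 fA]].
  have : nbhs t (f @^-1` [set y | hnorm (f t - y) < e]).
    by apply: cf; apply/nbhs_hnorm; exists e.
  by move=> /nbhs_mdist[d d0 h]; exists d.
have [d d0 hd] := h t e e0.
by apply/nbhs_mdist; exists d => // s ts; apply: fA; exact: hd.
Qed.

Lemma lipschitz_continuous L f : lipschitz L f -> continuous f.
Proof.
move=> fL; apply/continuous_hnorm => t e e0.
have L0 : 0 < `|L| + 1 by rewrite ltr_pwDr.
exists (e / (`|L| + 1)); first by rewrite divr_gt0.
move=> s ts; rewrite (le_lt_trans (fL _ _)) //.
rewrite (@le_lt_trans _ _ ((`|L| + 1) * mdist t s)) //.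
  by rewrite ler_wpM2r ?mdist_ge0 // (le_trans (ler_norm L)) // lerDl.
by rewrite mulrC -ltr_pdivlMr.
Qed.

Hypothesis compactT : compact [set: T].

Lemma uniformly_continuous f : continuous f -> forall e : R, 0 < e ->
  exists2 d : R, 0 < d & forall s t, mdist s t < d -> hnorm (f s - f t) < e.
Proof.
move=> /continuous_hnorm cf e e0.
have [|N hN] := compact_eventually compactT
  (P := fun i s => forall t, mdist s t < i.+1%:R^-1 -> hnorm (f s - f t) < e).
  move=> x; have [d d0 hd] := cf x _ (divr_gt0 e0 (ltr0n R 2)).
  exists (d / 2); first exact: divr_gt0.
  have [N hN] := natSinv_small (divr_gt0 d0 (ltr0n R 2)); exists N => y i xy Ni t yt.
  have h1 : hnorm (f x - f y) < e / 2 by apply: hd; lra.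
  have h2 : hnorm (f x - f t) < e / 2.
    apply: hd; have := hN i Ni; have := metric_triangle x y t.
    by move: yt; move: (i.+1%:R^-1) => u; lra.
  have := hnorm_triangle (f x) (f y) (f t); rewrite (hnormBC (f y) (f x)); lra.
exists N.+1%:R^-1; first exact: natSinv_gt0.
by move=> s t; exact: hN.
Qed.

Lemma uniform_approximable f :
  (forall e : R, 0 < e ->
    exists2 d : R, 0 < d & forall s t, mdist s t < d -> hnorm (f s - f t) <= e) ->
  simple_approximable f.
Proof.
move=> uf e e0; have [d d0 hd] := uf e e0.
have [W [c [cB cd]]] := fine_coding compactT d0.
(* A class takes the value of [f] at one of its points; the default 0 sits on empty classes only. *)
pose v w := if pselect (exists t, c t = w) is left h then f (projT1 (cid h)) else 0.
exists W, c, v; split => // t; rewrite /v; case: pselect => [h|[]]; last by exists t.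
by apply: hd; apply: cd; case: (cid h).
Qed.

Lemma continuous_approximable f : continuous f -> simple_approximable f.
Proof.
move=> cf; apply: uniform_approximable => e e0.
have [d d0 hd] := uniformly_continuous cf e0.
by exists d => // s t st; exact/ltW/hd.
Qed.

Lemma lipschitz_approximable L f : lipschitz L f -> simple_approximable f.
Proof. by move=> /lipschitz_continuous; exact: continuous_approximable. Qed.

Lemma approximable_bounded f : simple_approximable f ->
  exists2 C : R, 0 <= C & forall t, hnorm (f t) <= C.
Proof.
move=> /(_ 1 ltr01)[W [c [v [_ fv]]]].
exists (1 + \sum_w hnorm (v w)); first by rewrite addr_ge0 // sumr_ge0 // => w _; exact: hnorm_ge0.
move=> t; rewrite -{1}(subrK (v (c t)) (f t)) (le_trans (hnormD _ _)) // lerD //.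
by rewrite (bigD1 (c t)) //= lerDl sumr_ge0 // => w _; exact: hnorm_ge0.
Qed.

End ContinuousFunctions.

(** * Linearity and bounds of the integral *)

Section IntegralTheory.
Context {R : realType} {k : scalar_kind} {n : nat} {T : metricType R}.
Local Notation K := (scalar_field R k).
Local Notation X := 'rV[K]_n.
Implicit Types (f g : T -> X) (m : set T -> X) (D : set T -> R).

Lemma approximableD f g : simple_approximable f -> simple_approximable g ->
  simple_approximable (fun t => f t + g t).
Proof.
move=> sf sg e e0; have e2 : 0 < e / 2 by rewrite divr_gt0.
have [W [c [v [cB fv]]]] := sf _ e2; have [W' [c' [v' [cB' gv]]]] := sg _ e2.
exists (W * W')%type, (fun t => (c t, c' t)), (fun w => v w.1 + v' w.2); split.
  exact: (coding_pair borel_algebra).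
move=> t /=; rewrite opprD addrACA (le_trans (hnormD _ _)) //.
have := fv t; have := gv t; lra.
Qed.

Lemma approximableZ (a : K) f : simple_approximable f -> simple_approximable (fun t => a *: f t).
Proof.
move=> sf e e0; have a1 : 0 < modulus a + 1 by rewrite ltr_pwDr // modulus_ge0.
have [W [c [v [cB fv]]]] := sf _ (divr_gt0 e0 a1).
exists W, c, (fun w => a *: v w); split => // t.
rewrite -scalerBr hnormZ (@le_trans _ _ ((modulus a + 1) * (e / (modulus a + 1)))) //.
  by rewrite ler_pM ?modulus_ge0 ?hnorm_ge0 // lerDl.
by rewrite mulrC divfK // gt_eqF.
Qed.

Lemma approximable0 : simple_approximable (fun _ : T => 0 : X).
Proof.
move=> e e0; exists unit, (fun=> tt), (fun=> 0); split.
  by case; have := @borelT T; congr borel; apply/seteqP; split.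
by move=> t; rewrite subrr hnorm0 ltW.
Qed.

Lemma integral_ofD m D f g :
  dominated (@borel T) m D -> simple_approximable f -> simple_approximable g ->
  integral_of m (fun t => f t + g t) = integral_of m f + integral_of m g.
Proof.
move=> mD sf sg; apply/eqP; rewrite -subr_eq0; apply/eqP; apply: modulus_small => e e0.
have DT : 0 <= D setT by apply: (dominated_ge0 mD); exact: borelT.
(* The approximation errors are [2 * d] for the sum and [d] for each summand, each times [D setT];
   the [+ 1] keeps the denominator positive. *)
have D1 : 0 < 4 * (D setT + 1) by rewrite mulr_gt0 // ltr_pwDr.
have d0 : 0 < e / (4 * (D setT + 1)) by rewrite divr_gt0.
have hd : e = e / (4 * (D setT + 1)) * (4 * (D setT + 1)) by rewrite divfK // gt_eqF.
move: hd d0; set d := e / _ => hd d0.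
have [W [c [v [cB fv]]]] := sf _ d0; have [W' [c' [v' [cB' gv]]]] := sg _ d0.
have ccB := coding_pair borel_algebra cB cB'.
have hf := integral_of_approx mD sf cB fv.
have hg := integral_of_approx mD sg cB' gv.
have hfg : modulus (integral_of m (fun t => f t + g t) -
    coded_sum m (fun t => (c t, c' t)) (fun w => v w.1 + v' w.2)) <= (d + d) * D setT.
  apply: (integral_of_approx mD (approximableD sf sg) ccB) => t /=.
  by rewrite opprD addrACA (le_trans (hnormD _ _)) // lerD.
have addm : finitely_additive (@borel T) m by case: mD.
have hs : coded_sum m (fun t => (c t, c' t)) (fun w => v w.1 + v' w.2) =
    coded_sum m c v + coded_sum m c' v'.
  rewrite (coded_sum_refine borel_algebra v addm ccB (g := fst)) //.
  rewrite (coded_sum_refine borel_algebra v' addm ccB (g := snd)) //.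
  by rewrite /coded_sum -big_split; apply: eq_bigr => w _; rewrite innerDl.
move: hfg; rewrite hs.
set I := integral_of m _; set a := coded_sum m c v in hf *; set b := coded_sum m c' v' in hg * => hI.
have -> : I - (integral_of m f + integral_of m g) =
    (I - (a + b)) + - ((integral_of m f - a) + (integral_of m g - b)) by ring.
rewrite (le_trans (modulusD _ _)) // modulusN.
have := modulusD (integral_of m f - a) (integral_of m g - b).
have : 0 <= d * D setT by rewrite mulr_ge0 // ltW.
lra.
Qed.

Lemma integral_ofZ m D (a : K) f :
  dominated (@borel T) m D -> simple_approximable f ->
  integral_of m (fun t => a *: f t) = a * integral_of m f.
Proof.
move=> mD sf; apply/eqP; rewrite -subr_eq0; apply/eqP; apply: modulus_small => e e0.
have DT : 0 <= D setT by apply: (dominated_ge0 mD); exact: borelT.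
have C0 : 0 < 2 * (modulus a + 1) * (D setT + 1).
  by rewrite !mulr_gt0 // ltr_pwDr // modulus_ge0.
have [W [c [v [cB fv]]]] := sf _ (divr_gt0 e0 C0).
have hd : e = e / (2 * (modulus a + 1) * (D setT + 1)) * (2 * (modulus a + 1) * (D setT + 1)).
  by rewrite divfK // gt_eqF.
have : 0 < e / (2 * (modulus a + 1) * (D setT + 1)) by rewrite divr_gt0.
move: hd fv; set d := e / _ => hd fv d0.
have hf := integral_of_approx mD sf cB fv.
have hg : modulus (integral_of m (fun t => a *: f t) - coded_sum m c (fun w => a *: v w))
    <= (modulus a * d) * D setT.
  apply: (integral_of_approx mD (approximableZ a sf) cB) => t /=.
  by rewrite -scalerBr hnormZ ler_wpM2l ?modulus_ge0.
have hs : coded_sum m c (fun w => a *: v w) = a * coded_sum m c v.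
  by rewrite /coded_sum mulr_sumr; apply: eq_bigr => w _; rewrite innerZl.
move: hg; rewrite hs; set b := coded_sum m c v in hf * => hg.
have -> : integral_of m (fun t => a *: f t) - a * integral_of m f =
    (integral_of m (fun t => a *: f t) - a * b) + - (a * (integral_of m f - b)) by ring.
rewrite (le_trans (modulusD _ _)) // modulusN modulusM.
have h : modulus a * modulus (integral_of m f - b) <= modulus a * (d * D setT).
  by rewrite ler_wpM2l ?modulus_ge0.
have ad : 0 <= d * D setT by rewrite mulr_ge0 // ltW.
have := modulus_ge0 a.
nra.
Qed.

(** Meant for integrands that are large only on a set [S] of small mass, such as the difference
    between a bump and the indicator of its closed set. *)
Lemma integral_of_local m D f (S : set T) (C e : R) :
  dominated (@borel T) m D -> simple_approximable f -> borel S -> 0 <= e ->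
  (forall t, S t -> hnorm (f t) <= C) -> (forall t, ~ S t -> hnorm (f t) <= e) ->
  modulus (integral_of m f) <= C * D S + e * D setT.
Proof.
move=> mD sf bS e0 fC fe; apply/ler_addgt0Pr => r r0.
have DT : 0 <= D setT by apply: (dominated_ge0 mD); exact: borelT.
have DS : D S <= D setT.
  have [_ addD _] := mD.
  by apply: (additive_mono borel_algebra addD (dominated_ge0 mD) bS borelT).
have C0 : 0 < 3 * (D setT + 1) by rewrite mulr_gt0 // ltr_pwDr.
have [W [c [v [cB fv]]]] := sf _ (divr_gt0 r0 C0).
have hd : r = r / (3 * (D setT + 1)) * (3 * (D setT + 1)) by rewrite divfK // gt_eqF.
have : 0 < r / (3 * (D setT + 1)) by rewrite divr_gt0.
move: hd fv; set d := r / _ => hd fv d0.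
have hf := integral_of_approx mD sf cB fv.
have vf t : hnorm (v (c t)) <= hnorm (f t) + d.
  rewrite -(subrK (f t) (v (c t))) addrC (le_trans (hnormD _ _)) // lerD2l.
  by rewrite hnormBC.
have hs : modulus (coded_sum m c v) <= (C + d) * D S + (e + d) * D setT.
  apply: (coded_sum_local borel_algebra mD) => // [|t St|t St]; first by rewrite addr_ge0 // ltW.
  - by rewrite (le_trans (vf t)) // lerD2r fC.
  - by rewrite (le_trans (vf t)) // lerD2r fe.
rewrite -(subrK (coded_sum m c v) (integral_of m f)) (le_trans (modulusD _ _)) //.
have : d * D S <= d * D setT by rewrite ler_wpM2l // ltW.
nra.
Qed.

Lemma integral_of_le m D f (C : R) :
  dominated (@borel T) m D -> simple_approximable f -> (forall t, hnorm (f t) <= C) ->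
  modulus (integral_of m f) <= C * D setT.
Proof.
move=> mD sf fC.
have := @integral_of_local m D f setT C 0 mD sf borelT (lexx _) (fun t _ => fC t).
by rewrite mul0r addr0; apply => t [].
Qed.

Lemma integral_ofB m D f g :
  dominated (@borel T) m D -> simple_approximable f -> simple_approximable g ->
  integral_of m (fun t => f t - g t) = integral_of m f - integral_of m g.
Proof.
move=> mD sf sg; rewrite -[in RHS]mulN1r -(integral_ofZ _ mD sg).
rewrite -(integral_ofD mD sf (approximableZ _ sg)); congr integral_of.
by apply/funext => t; rewrite scaleN1r.
Qed.

Lemma integral_of_sum m D (I : finType) (f : I -> T -> X) :
  dominated (@borel T) m D -> (forall i, simple_approximable (f i)) ->
  simple_approximable (fun t => \sum_i f i t) /\
  integral_of m (fun t => \sum_i f i t) = \sum_i integral_of m (f i).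
Proof.
move=> mD sf.
have h (s : seq I) : simple_approximable (fun t => \sum_(i <- s) f i t) /\
  integral_of m (fun t => \sum_(i <- s) f i t) = \sum_(i <- s) integral_of m (f i).
  elim: s => [|i s [IH1 IH2]].
    rewrite big_nil; have -> : (fun t => \sum_(i <- [::]) f i t) = fun=> 0.
      by apply/funext => t; rewrite big_nil.
    split; first exact: approximable0.
    have := integral_ofZ 0 mD approximable0; rewrite mul0r.
    by under eq_fun do rewrite scaler0.
  have -> : (fun t => \sum_(i <- i :: s) f i t) = (fun t => f i t + \sum_(i <- s) f i t).
    by apply/funext => t; rewrite big_cons.
  by rewrite big_cons -IH2; split; [exact: approximableD|exact: (integral_ofD mD (sf i) IH1)].
exact: h.
Qed.

Lemma dominatedB m m' D D' :
  dominated (@borel T) m D -> dominated (@borel T) m' D' ->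
  dominated (@borel T) (m - m') (fun A => D A + D' A).
Proof.
move=> [[m0 am] [D0 aD] h] [[m'0 am'] [D'0 aD'] h'].
have mE A : (m - m') A = m A - m' A by [].
split.
- split; first by rewrite mE m0 m'0 subr0.
  by move=> A B bA bB AB; rewrite !mE am // am' // opprD addrACA.
- split; first by rewrite D0 D'0 addr0.
  by move=> A B bA bB AB; rewrite aD // aD' // addrACA.
- by move=> A bA; rewrite mE (le_trans (hnormD _ _)) // hnormN lerD // ?h // h'.
Qed.

Lemma integral_of_measureB m m' D D' f :
  dominated (@borel T) m D -> dominated (@borel T) m' D' -> simple_approximable f ->
  integral_of (m - m') f = integral_of m f - integral_of m' f.
Proof.
move=> mD mD' sf; apply/eqP; rewrite -subr_eq0; apply/eqP; apply: modulus_small => e e0.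
have DT : 0 <= D setT by apply: (dominated_ge0 mD); exact: borelT.
have DT' : 0 <= D' setT by apply: (dominated_ge0 mD'); exact: borelT.
have C0 : 0 < 2 * (D setT + D' setT + 1) by rewrite mulr_gt0 // ltr_pwDr // addr_ge0.
have [W [c [v [cB fv]]]] := sf _ (divr_gt0 e0 C0).
have hd : e = e / (2 * (D setT + D' setT + 1)) * (2 * (D setT + D' setT + 1)).
  by rewrite divfK // gt_eqF.
have : 0 < e / (2 * (D setT + D' setT + 1)) by rewrite divr_gt0.
move: hd fv; set d := e / _ => hd fv d0.
have h1 := integral_of_approx mD sf cB fv.
have h2 := integral_of_approx mD' sf cB fv.
have h3 := integral_of_approx (dominatedB mD mD') sf cB fv.
have hs : coded_sum (m - m') c v = coded_sum m c v - coded_sum m' c v.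
  by rewrite /coded_sum -sumrB; apply: eq_bigr => w _; rewrite -innerNr -innerDr.
move: h3; rewrite hs; set a := coded_sum m c v in h1 *; set b := coded_sum m' c v in h2 *.
set I := integral_of m f in h1 *; set J := integral_of m' f in h2 *.
set L := integral_of _ f => h3.
have -> : L - (I - J) = (L - (a - b)) + ((J - b) + - (I - a)) by ring.
rewrite (le_trans (modulusD _ _)) //.
have := modulusD (J - b) (- (I - a)); rewrite modulusN.
have : 0 <= d * D setT by rewrite mulr_ge0 // ltW.
have : 0 <= d * D' setT by rewrite mulr_ge0 // ltW.
lra.
Qed.

End IntegralTheory.

(** * The variation measure *)

Section Variation.
Context {R : realType} {k : scalar_kind} {n : nat} {T : metricType R}.
Local Notation K := (scalar_field R k).
Local Notation X := 'rV[K]_n.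
Implicit Types (m : set T -> X) (A B : set T).

(** The sums whose extended supremum is [measure_variation], kept as real numbers so that bounds can
    be stated without [\bar R]. *)
Definition partition_sums m A : set R :=
  [set v | exists (p : nat) (P : 'I_p -> set T),
     [/\ forall i, borel (P i), trivIset [set: 'I_p] P, \bigcup_i P i = A &
         v = \sum_(i < p) hnorm (m (P i))]].

Lemma measure_variation_le m A (a : R) :
  (measure_variation m A <= a%:E)%E <-> forall v, partition_sums m A v -> v <= a.
Proof.
split=> [mA v [p [P [bP tP UP ->]]]|h].
  rewrite -lee_fin (le_trans _ mA) //; apply: ereal_sup_ubound.
  by exists p, P; split.
apply: ge_ereal_sup => _ [p [P [bP tP UP ->]]]; rewrite lee_fin; apply: h.
by exists p, P; split.
Qed.

Lemma partition_sums1 m A : borel A -> partition_sums m A (hnorm (m A)).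
Proof.
move=> bA; exists 1%N, (fun=> A); split => //.
- by apply/trivIsetP => i j _ _; rewrite (ord1 i) (ord1 j) eqxx.
- by apply/seteqP; split => [x [i _]|x Ax] //; exists ord0.
- by rewrite big_ord1.
Qed.

Lemma partition_sumsU m A B v w : A `&` B = set0 ->
  partition_sums m A v -> partition_sums m B w -> partition_sums m (A `|` B) (v + w).
Proof.
move=> AB [p [P [bP tP UP ->]]] [q [Q [bQ tQ UQ ->]]].
exists (p + q)%N, (fun i => match fintype.split i with inl j => P j | inr j => Q j end).
have PA j x : P j x -> A x by rewrite -UP => Px; exists j.
have QB j x : Q j x -> B x by rewrite -UQ => Qx; exists j.
split.
- by move=> i; case: fintype.split.
- move=> i j _ _ [x []]; case: (split_ordP i) => i' -> ; case: (split_ordP j) => j' -> Px Qx.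
  + by congr lshift; apply: (tP i' j' I I); exists x.
  + have []: set0 x by rewrite -AB; split; [exact: (PA _ _ Px)|exact: (QB _ _ Qx)].
  + have []: set0 x by rewrite -AB; split; [exact: (PA _ _ Qx)|exact: (QB _ _ Px)].
  + by congr rshift; apply: (tQ i' j' I I); exists x.
- apply/seteqP; split => x.
    move=> [i _]; case: (split_ordP i) => j _ h; [left|right].
      exact: (PA _ _ h).
    exact: (QB _ _ h).
  move=> [|]; [rewrite -UP|rewrite -UQ] => -[j _ h].
    by exists (lshift q j) => //; rewrite -[lshift q j]/(unsplit (inl j)) unsplitK.
  by exists (rshift p j) => //; rewrite -[rshift p j]/(unsplit (inr j)) unsplitK.
- rewrite big_split_ord /=; congr +%R; apply: eq_bigr => i _.
    by rewrite -[lshift q i]/(unsplit (inl i)) unsplitK.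
  by rewrite -[rshift p i]/(unsplit (inr i)) unsplitK.
Qed.

Definition variation m A : R := sup (partition_sums m A).

Section BoundedVariation.
Variables (m : set T -> X) (M : R).
Hypothesis am : sigma_additive_on_borel m.
Hypothesis mM : forall v, partition_sums m setT v -> v <= M.

Lemma partition_sums_bounded A v : borel A -> partition_sums m A v -> v <= M.
Proof.
move=> bA vA.
have /mM : partition_sums m setT (v + hnorm (m (~` A))).
  rewrite -(setvU A) setUC; apply: partition_sumsU => //; first exact: setICr.
  by apply: partition_sums1; exact: borelC.
by apply: le_trans; rewrite lerDl hnorm_ge0.
Qed.

Lemma has_sup_partition_sums A : borel A -> has_sup (partition_sums m A).
Proof.
move=> bA; split; first by exists (hnorm (m A)); exact: partition_sums1.
by exists M => v; exact: partition_sums_bounded.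
Qed.

Lemma variation_ub A v : borel A -> partition_sums m A v -> v <= variation m A.
Proof. by move=> bA; apply: sup_upper_bound; exact: has_sup_partition_sums. Qed.

Lemma hnorm_le_variation A : borel A -> hnorm (m A) <= variation m A.
Proof. by move=> bA; apply: variation_ub => //; exact: partition_sums1. Qed.

Lemma variation_ge0 A : borel A -> 0 <= variation m A.
Proof. by move=> bA; exact: le_trans (hnorm_ge0 _) (hnorm_le_variation bA). Qed.

Lemma variation_le A : borel A -> variation m A <= M.
Proof.
move=> bA; apply: ge_sup; first by have [] := has_sup_partition_sums bA.
by move=> v; exact: partition_sums_bounded.
Qed.

Lemma variation_superadditive A B : borel A -> borel B -> A `&` B = set0 ->
  variation m A + variation m B <= variation m (A `|` B).
Proof.
move=> bA bB AB; apply/ler_addgt0Pr => e e0.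
have e2 : 0 < e / 2 by rewrite divr_gt0.
have [v vA hv] := sup_adherent e2 (has_sup_partition_sums bA).
have [w wB hw] := sup_adherent e2 (has_sup_partition_sums bB).
have := variation_ub (borelU bA bB) (partition_sumsU AB vA wB).
rewrite /variation in hv hw *; lra.
Qed.

Lemma variation_mono A B : borel A -> borel B -> A `<=` B -> variation m A <= variation m B.
Proof.
move=> bA bB AB; rewrite -(setDUK AB).
apply: le_trans (variation_superadditive bA (borelD bB bA) _).
  by rewrite lerDl variation_ge0 //; exact: borelD.
by rewrite -subset0 => x [? []].
Qed.

(** Superadditivity bounds the partial sums from above. Conversely, a nearly optimal partition [P]
    of the union is cut by the [A i], and sigma-additivity of [m] replaces each [m (P j)] by a
    finite sum of the [m (P j]&[A i)]. *)
Lemma variation_countably_additive : countably_additive (variation m).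
Proof.
move=> A bA tA; have bU := borel_bigcup bA.
have upper N : \sum_(i < N) variation m (A i) <= variation m (\bigcup_i A i).
  have : \sum_(i < N) variation m (A i) <= variation m (\big[setU/set0]_(i < N) A i).
    elim: N => [|N IH]; first by rewrite !big_ord0 variation_ge0 //; exact: borel0.
    rewrite !big_ord_recr /=.
    apply: le_trans (variation_superadditive _ _ _); rewrite ?lerD2r //.
    + exact: borel_bigsetU.
    + rewrite -subset0 => x [+ ANx]; rewrite -bigcup_mkord => -[i /= iN Aix].
      have e : i = N by apply: (tA i N I I); exists x.
      by move: iN; rewrite e ltnn.
  move/le_trans; apply; apply: variation_mono => //; first exact: borel_bigsetU.
  by rewrite -bigcup_mkord => x [i _ Ax]; exists i.
apply/cvgrPdist_lt => e e0.
have e2 : 0 < e / 2 by rewrite divr_gt0.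
have [v [p [P [bP tP UP vE]]] hv] := sup_adherent e2 (has_sup_partition_sums bU).
(* The [p] pieces together lose at most [e / 2]; [p.+1] also covers the empty partition. *)
have e3 : 0 < e / (2 * p.+1%:R) by rewrite divr_gt0 // mulr_gt0.
have [j|N0 _ hN] := @filter_forall nat _ (fun j N => hnorm (m (P j) - \sum_(i < N) m (P j `&` A i)) < e / (2 * p.+1%:R)) \oo _.
  have Pj : P j = \bigcup_i (P j `&` A i).
    by rewrite -setI_bigcupr setIidl // -UP => x Px; exists j.
  have bPA i : borel (P j `&` A i) by exact: borelI.
  have tPA : trivIset [set: nat] (fun i => P j `&` A i) by exact: trivIset_setIl.
  have := am bPA tPA; rewrite -Pj => /cvg_hnorm h; exact: h.
exists N0 => // N /hN /= {}hN.
have hu := upper N; rewrite ger0_norm ?subr_ge0 // ltrBlDl.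
have hvN : v <= e / 2 + \sum_(i < N) variation m (A i).
  rewrite vE (@le_trans _ _ (\sum_(j < p) (e / (2 * p.+1%:R) + \sum_(i < N) hnorm (m (P j `&` A i))))) //.
    apply: ler_sum => j _; rewrite -{1}(subrK (\sum_(i < N) m (P j `&` A i)) (m (P j))).
    by rewrite (le_trans (hnormD _ _)) // lerD ?(ltW (hN j)) // hnorm_sum.
  rewrite big_split /= sumr_const card_ord exchange_big /=; apply: lerD.
    rewrite -[leLHS]mulr_natr invfM !mulrA -[leLHS]mulrA ger_pMr //.
    by rewrite ler_pdivrMl // mulr1 ler_nat.
  apply: ler_sum => i _; apply: variation_ub => //.
  exists p, (fun j => P j `&` A i); split => //.
  + by move=> j; exact: borelI.
  + exact: trivIset_setIr.
  + rewrite -setI_bigcupl UP setIC setIidl //.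
    by move=> x Ax; exists i.
have : variation m (\bigcup_i A i) - e / 2 < v by exact: hv.
lra.
Qed.

Lemma variation_dominated : dominated (@borel T) m (variation m).
Proof.
split; first exact: sigma_additive_finitely.
  exact/countably_additive_finitely/variation_countably_additive.
exact: hnorm_le_variation.
Qed.

End BoundedVariation.

Lemma cabv_bounded m : is_cabv m -> exists M : R, forall v, partition_sums m setT v -> v <= M.
Proof.
case=> _ mT _; exists (fine (measure_variation m setT)); apply/measure_variation_le.
rewrite fineK // ge0_fin_numE // (@le_trans _ _ (hnorm (m setT))%:E) ?lee_fin ?hnorm_ge0 //.
apply: ereal_sup_ubound.
by have [p [P [? ? ? ->]]] := partition_sums1 m (@borelT T); exists p, P.
Qed.

Lemma cabv_dominated m : is_cabv m -> dominated (@borel T) m (variation m).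
Proof.
by move=> hm; have [M hM] := cabv_bounded hm; case: hm => am _ _; exact: (variation_dominated am hM).
Qed.

Lemma cabv_variation_additive m : is_cabv m -> countably_additive (variation m).
Proof.
by move=> hm; have [M hM] := cabv_bounded hm; case: hm => am _ _; exact: (variation_countably_additive am hM).
Qed.

End Variation.

(** * Lipschitz bumps and regularity *)

Section Bump.
Context {R : realType} {T : metricType R}.
Implicit Types (C : set T) (r : R) (s t : T).

(** This is the larger of 0 and [1 - r * dist(t, C)]. Joining 0 to the set avoids the distance to a
    set and gives the value 0 when [C] is empty. *)
Definition bump C r t : R := sup ([set 0] `|` [set 1 - r * mdist c t | c in C]).

(** For [r > 0] this is the open neighbourhood of [C] of radius [1/r], outside which the bump
    vanishes. *)
Definition thickening C r : set T := [set t | exists2 c, C c & r * mdist c t < 1].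

Let bump_bound C r t (u : R) : 0 <= u -> (forall c, C c -> 1 - r * mdist c t <= u) ->
  bump C r t <= u.
Proof.
move=> u0 h; apply: ge_sup; first by exists 0; left.
by move=> _ [->//|[c Cc <-]]; exact: h.
Qed.

Let bump_has_sup C r t : 0 <= r -> has_sup ([set 0] `|` [set 1 - r * mdist c t | c in C]).
Proof.
move=> r0; split; first by exists 0; left.
exists 1 => _ [->//|[c Cc <-]].
by rewrite gerBl mulr_ge0 // mdist_ge0.
Qed.

Lemma bump_ge0 C r t : 0 <= r -> 0 <= bump C r t.
Proof. by move=> r0; apply: (sup_upper_bound (bump_has_sup C t r0)); left. Qed.

Lemma bump_le1 C r t : 0 <= r -> bump C r t <= 1.
Proof.
move=> r0; apply: bump_bound => // c _.
by rewrite gerBl mulr_ge0 // mdist_ge0.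
Qed.

Lemma bump_in C r t : 0 <= r -> C t -> bump C r t = 1.
Proof.
move=> r0 Ct; apply/eqP; rewrite eq_le bump_le1 //=.
apply: (sup_upper_bound (bump_has_sup C t r0)); right; exists t => //.
by rewrite mdistxx mulr0 subr0.
Qed.

Lemma bump_out C r t : 0 <= r -> ~ thickening C r t -> bump C r t = 0.
Proof.
move=> r0 Ct; apply/eqP; rewrite eq_le bump_ge0 // andbT.
apply: bump_bound => // c Cc; rewrite subr_le0 leNgt; apply/negP => h.
by apply: Ct; exists c.
Qed.

Lemma bump_lipschitz C r s t : 0 <= r -> `|bump C r s - bump C r t| <= r * mdist s t.
Proof.
move=> r0.
have h x y : bump C r x <= bump C r y + r * mdist x y.
  have rd : 0 <= r * mdist x y by rewrite mulr_ge0 // mdist_ge0.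
  apply: bump_bound => [|c Cc]; first by rewrite addr_ge0 ?bump_ge0.
  have : 1 - r * mdist c y <= bump C r y.
    by apply: (sup_upper_bound (bump_has_sup C y r0)); right; exists c.
  have : r * mdist c y <= r * (mdist c x + mdist x y).
    by rewrite ler_wpM2l // metric_triangle.
  lra.
have := h s t; have := h t s; rewrite (metric_sym t s) ler_norml => h1 h2.
by apply/andP; split; lra.
Qed.

Lemma open_thickening C r : 0 < r -> open (thickening C r).
Proof.
move=> r0; have -> : thickening C r = \bigcup_(c in C) [set t | mdist c t < r^-1].
  by apply/seteqP; split => t [c Cc] /= h; exists c => //; move: h; rewrite /= -ltr_pdivlMl // mulr1.
by apply: bigcup_open => c _; exact: open_mdist_ball.
Qed.

Lemma thickening_sub C r : C `<=` thickening C r.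
Proof. by move=> t Ct; exists t => //; rewrite mdistxx mulr0. Qed.

Lemma thickening_decr C (i : nat) : thickening C i.+2%:R `<=` thickening C i.+1%:R.
Proof.
move=> t [c Cc h]; exists c => //; apply: le_lt_trans h.
by rewrite ler_wpM2r ?mdist_ge0 // ler_nat.
Qed.

Lemma bigcap_thickening C : closed C -> \bigcap_i thickening C i.+1%:R = C.
Proof.
move=> cC; apply/seteqP; split => t; last by move=> Ct i _; exact: thickening_sub.
move=> h; apply: cC => A /nbhs_mdist[e e0 tA].
have [N hN] := natSinv_small e0; have [c Cc hc] := h N I.
exists c; split => //; apply: tA; rewrite metric_sym.
apply: lt_trans (hN N (leqnn N)).
by rewrite -[ltRHS]mulr1 ltr_pdivlMl.
Qed.

Section Regularity.
Variables (D : set T -> R) (aD : countably_additive D).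
Hypothesis D0 : forall A, borel A -> 0 <= D A.

Let fD := countably_additive_finitely aD.

Lemma measure_thickening_cvg C : closed C -> forall e, 0 < e ->
  exists N, forall i, (N <= i)%N -> D (thickening C i.+1%:R `\` C) < e.
Proof.
move=> cC e e0.
have [|i|N _ h] := measure_cvg_bigcap aD (B := fun i => thickening C i.+1%:R) _ _ e0.
- by move=> i; apply: borel_open; exact: open_thickening.
- exact: thickening_decr.
- by exists N => i /h /=; rewrite bigcap_thickening.
Qed.

(** The sets with this approximation property form a sigma-algebra containing the open sets. In a
    countable union only finitely many [C i] may be kept, since an infinite union need not be
    closed; the lost tail is small because [D] is finite. *)
Lemma borel_regular A : borel A -> forall e, 0 < e ->
  exists C U : set T, [/\ closed C, open U, C `<=` A, A `<=` U & D (U `\` C) < e].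
Proof.
pose G : set (set T) := [set A | forall e, 0 < e ->
  exists C U : set T, [/\ closed C, open U, C `<=` A, A `<=` U & D (U `\` C) < e]].
suff : @borel T `<=` G by exact.
apply: smallest_sub; first split.
- move=> e e0; exists set0, set0; split => //; first exact: closed0.
    exact: open0.
  by rewrite setDv; case: fD => ->.
- move=> B GB e e0; have [C [U [cC oU CB BU h]]] := GB e e0.
  exists (~` U), (~` C); split => //; first exact: open_closedC.
  + exact: closed_openC.
  + by rewrite setTD; exact: subsetC.
  + by rewrite setTD; exact: subsetC.
  + by rewrite setDE setCK setIC -setDE.
- move=> B GB e e0.
  (* Finite sums of the [d i] stay below [e / 2]; the other half pays for the tail of the union. *)
  pose d i : R := e / 2 ^+ i.+2.
  have d0 i : 0 < d i by rewrite divr_gt0 // exprn_gt0.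
  have [C hC] := choice (fun i => GB i _ (d0 i)).
  have [U hU] := choice hC.
  have bC i : borel (C i) by apply: borel_closed; have [] := hU i.
  have bU i : borel (U i) by apply: borel_open; have [] := hU i.
  have e2 : 0 < e / 2 by rewrite divr_gt0.
  have [N _ hN] := measure_cvg_bigcup aD bU e2.
  exists (\big[setU/set0]_(i < N) C i), (\bigcup_i U i); split.
  + by apply: closed_bigsetU => i _; have [] := hU i.
  + by apply: bigcup_open => i _; have [] := hU i.
  + rewrite -bigcup_mkord => x [i _ Cx]; exists i => //.
    by have [_ _ CB _ _] := hU i; exact: CB.
  + move=> x [i _ Bx]; exists i => //.
    by have [_ _ _ BU _] := hU i; exact: BU.
  have sum_le M : D (\big[setU/set0]_(i < M) (U i `\` C i)) <= e / 2 - e / 2 ^+ M.+1.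
    elim: M => [|M IH]; first by rewrite big_ord0 expr1 subrr; case: fD => ->.
    rewrite big_ord_recr /=.
    apply: le_trans (additiveU_le borel_algebra fD D0 _ _) _.
      by apply: (borel_bigsetU M (F := fun i => U i `\` C i)) => i; exact: borelD.
      exact: borelD.
    have [_ _ _ _ /ltW hd] := hU M; apply: le_trans (lerD IH hd) _.
    rewrite /d le_eqVlt; apply/orP; left; apply/eqP; rewrite !exprS.
    by field; rewrite expf_neq0.
  have hN2 := hN N (leqnn N).
  apply: (@le_lt_trans _ _ (D ((\bigcup_i U i `\` \big[setU/set0]_(i < N) U i) `|`
      \big[setU/set0]_(i < N) (U i `\` C i)))).
    apply: (additive_mono borel_algebra fD) => //.
    * by apply: borelD; [exact: borel_bigcup|exact: borel_bigsetU].
    * apply: borelU; first by apply: borelD; [exact: borel_bigcup|exact: borel_bigsetU].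
      by apply: (borel_bigsetU N (F := fun i => U i `\` C i)) => i; exact: borelD.
    * rewrite -(bigcup_mkord N (fun i => U i `\` C i)) -!bigcup_mkord => x [Ux nC].
      have [[i iN Uix]|nU] := pselect ((\bigcup_(i in [set i | (i < N)%N]) U i) x).
        by right; exists i => //; split => // Cx; apply: nC; exists i.
      by left.
  apply: le_lt_trans (additiveU_le borel_algebra fD D0 _ _) _.
  * by apply: borelD; [exact: borel_bigcup|exact: borel_bigsetU].
  * by apply: (borel_bigsetU N (F := fun i => U i `\` C i)) => i; exact: borelD.
  have := sum_le N; have : 0 < e / 2 ^+ N.+1 by rewrite divr_gt0 // exprn_gt0.
  by move: hN2 => /=; lra.
- move=> B oB e e0.
  (* An open set is exhausted from inside by the complements of the thickenings of its closed
     complement. *)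
  have cA : closed (~` B) by exact: open_closedC.
  have [N hN] := measure_thickening_cvg cA e0.
  exists (~` thickening (~` B) N.+1%:R), B; split => //.
  + by apply: open_closedC; exact: open_thickening.
  + by rewrite -{2}[B]setCK; apply: subsetC; exact: thickening_sub.
  + by have := hN N (leqnn N); rewrite !setDE !setCK setIC.
Qed.

End Regularity.
End Bump.

(** * Integrals of bumps determine the measure *)

Section BumpIntegral.
Context {R : realType} {k : scalar_kind} {n : nat} {T : metricType R}.
Local Notation K := (scalar_field R k).
Local Notation X := 'rV[K]_n.
Implicit Types (m : set T -> X) (D : set T -> R) (x : X).

Lemma integral_of_coded m D (W : finType) (c : T -> W) (v : W -> X) :
  dominated (@borel T) m D -> coding (@borel T) c ->
  simple_approximable (fun t => v (c t)) /\
  integral_of m (fun t => v (c t)) = coded_sum m c v.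
Proof.
move=> mD cB.
have sv : simple_approximable (fun t => v (c t)).
  by move=> e e0; exists W, c, v; split => // t; rewrite subrr hnorm0 ltW.
split => //; apply/eqP; rewrite -subr_eq0; apply/eqP; apply: modulus_eq0.
apply/eqP; rewrite eq_le modulus_ge0 andbT.
by rewrite -[leRHS](mul0r (D setT)) (integral_of_approx mD sv cB) // => t; rewrite subrr hnorm0.
Qed.

Lemma integral_of_indicator m D (A : set T) x :
  dominated (@borel T) m D -> borel A ->
  simple_approximable (fun t => (if `[<A t>] then x else 0)) /\
  integral_of m (fun t => (if `[<A t>] then x else 0)) = inner x (m A).
Proof.
move=> mD bA; have cB := coding_set borel_algebra bA.
have [h1 h2] := @integral_of_coded m D _ _ (fun b : bool => if b then x else 0) mD cB.
split => //; rewrite h2 /coded_sum big_bool /= inner0l addr0.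
by congr (inner _ (m _)); apply/seteqP; split => t /= /asboolP.
Qed.

Definition bump_vec (C : set T) (r : R) x (t : T) : X := of_real (bump C r t) *: x.

Lemma bump_vec_lipschitz C r x : 0 <= r -> lipschitz (r * hnorm x) (bump_vec C r x).
Proof.
move=> r0 s t; rewrite /bump_vec -scalerBl -of_realN -of_realD hnormZ modulus_of_real mulrAC.
by rewrite ler_wpM2r ?hnorm_ge0 // bump_lipschitz.
Qed.

Hypothesis compactT : compact [set: T].

(** The bump and the indicator of [C] differ only on the thickening minus [C], whose mass tends to
    0. Masses of closed sets are thus limits of integrals of Lipschitz functions. *)
Lemma integral_bump_cvg m D C x :
  dominated (@borel T) m D -> countably_additive D -> closed C ->
  forall e, 0 < e -> exists N, forall i, (N <= i)%N ->
    modulus (integral_of m (bump_vec C i.+1%:R x) - inner x (m C)) < e.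
Proof.
move=> mD aD cC e e0; have bC := borel_closed cC.
have D0 := dominated_ge0 mD.
have x1 : 0 < hnorm x + 1 by rewrite ltr_pwDr // hnorm_ge0.
have [N hN] := measure_thickening_cvg aD cC (divr_gt0 e0 x1).
exists N => i Ni.
have [s1 <-] := integral_of_indicator x mD bC.
have s2 := lipschitz_approximable compactT (bump_vec_lipschitz C x (ler0n R i.+1)).
have bS : borel (thickening C i.+1%:R `\` C).
  by apply: borelD => //; apply: borel_open; exact: open_thickening.
rewrite -(integral_ofB mD s2 s1).
apply: le_lt_trans (_ : hnorm x * D (thickening C i.+1%:R `\` C) + 0 * D setT < e).
  apply: (integral_of_local mD _ bS) => //.
  - have := approximableD s2 (approximableZ (-1) s1).
    by under [in X in X -> _]eq_fun do rewrite scaleN1r.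
  - move=> t [_ nC]; case: asboolP => // _; rewrite subr0 hnormZ modulus_of_real.
    by rewrite ger0_norm ?bump_ge0 // ler_piMl ?hnorm_ge0 // bump_le1.
  - move=> t nS; case: asboolP => Ct.
      by rewrite /bump_vec bump_in // of_real1 scale1r subrr hnorm0.
    rewrite subr0 /bump_vec bump_out // ?of_real0 ?scale0r ?hnorm0 //.
    by move=> h; apply: nS.
rewrite mul0r addr0; have := hN i Ni; rewrite ltr_pdivlMr // => h.
apply: le_lt_trans h; rewrite mulrC ler_wpM2l ?lerDl //.
exact: D0.
Qed.

Lemma zero_on_closed_eq0 m D : dominated (@borel T) m D -> countably_additive D ->
  (forall C, closed C -> m C = 0) -> forall A, borel A -> m A = 0.
Proof.
move=> mD aD mC A bA; have D0 := dominated_ge0 mD.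
apply: hnorm_eq0; apply/eqP; rewrite eq_le hnorm_ge0 andbT.
apply/ler_addgt0Pr => e e0; rewrite add0r.
have [C [U [cC oU CA AU h]]] := borel_regular aD D0 bA e0.
have [addm addD dm] := mD; have bC := borel_closed cC.
have := additiveD borel_algebra addm bC bA CA; rewrite (mC C cC) subr0 => <-.
apply: le_trans (dm _ (borelD bA bC)) _; apply: le_trans (ltW h).
apply: (additive_mono borel_algebra addD) => //.
- exact: borelD.
- by apply: borelD => //; exact: borel_open.
- by move=> t [At nC]; split => //; exact: AU.
Qed.

(** Bumps on [C] with the vector [m C] have integrals tending to the square of [hnorm (m C)], and
    regularity passes from closed to Borel sets. This makes the Monge-Kantorovich distance
    definite. *)
Lemma lipschitz_separates m D : dominated (@borel T) m D -> countably_additive D ->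
  (forall L f, lipschitz L f -> integral_of m f = 0) -> forall A, borel A -> m A = 0.
Proof.
move=> mD aD mf; apply: (zero_on_closed_eq0 mD aD) => C cC.
have h : inner (m C) (m C) = 0.
  apply: modulus_small => e e0; have [N hN] := integral_bump_cvg (m C) mD aD cC e0.
  have := hN N (leqnn N).
  rewrite (mf _ _ (bump_vec_lipschitz C (m C) (ler0n R N.+1))) sub0r modulusN.
  exact: ltW.
by apply: hnorm_eq0; rewrite /hnorm h modulus0 sqrtr0.
Qed.

End BumpIntegral.

(** * Lipschitz partitions of unity *)

Section PartitionOfUnity.
Context {R : realType} {T : metricType R}.
Hypothesis compactT : compact [set: T].

Lemma lipschitz_partition_of_unity (e : R) : 0 < e ->
  exists (p : nat) (c : 'I_p -> T) (phi : 'I_p -> T -> R) (L : R),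
  [/\ 0 <= L, forall i t, 0 <= phi i t, forall t, \sum_i phi i t = 1,
      forall i t, phi i t != 0 -> mdist (c i) t < e &
      forall i s t, `|phi i s - phi i t| <= L * mdist s t].
Proof.
move=> e0; have e2 : 0 < e / 2 by rewrite divr_gt0.
have [s hs] := finite_net compactT e2.
pose p := size s; pose c (i : 'I_p) := tnth (in_tuple s) i.
(* Hats of radius [e] stand on a net of mesh [e / 2], so at each point some hat exceeds [e / 2];
   this keeps the normalising sum away from 0. *)
pose psi (i : 'I_p) t := Num.max 0 (e - mdist (c i) t).
pose S t := \sum_i psi i t.
have psi0 i t : 0 <= psi i t by rewrite /psi le_max lexx.
have psie i t : psi i t <= e by rewrite /psi ge_max (ltW e0) gerBl mdist_ge0.
have psiL i x y : `|psi i x - psi i y| <= mdist x y.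
  have h u v : psi i u <= psi i v + mdist u v.
    have := psi0 i v; have := mdist_ge0 u v => d0 v0.
    rewrite {1}/psi ge_max addr_ge0 //=.
    have : e - mdist (c i) v <= psi i v by rewrite /psi le_max lexx orbT.
    have := metric_triangle (c i) u v; lra.
  have := h x y; have := h y x; rewrite (metric_sym y x) ler_norml => h1 h2.
  by apply/andP; split; lra.
have S_ge t : e / 2 <= S t.
  have [x xs xt] := hs t; have xs' : (index x s < p)%N by rewrite index_mem.
  rewrite /S (bigD1 (Ordinal xs')) //=.
  have -> : psi (Ordinal xs') t = Num.max 0 (e - mdist x t).
    by rewrite /psi /c (tnth_nth x) /= nth_index.
  rewrite (@le_trans _ _ (e - mdist x t)) //; first lra.
  rewrite (@le_trans _ _ (Num.max 0 (e - mdist x t))) ?le_max ?lexx ?orbT //.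
  by rewrite lerDl sumr_ge0.
have S_gt0 t : 0 < S t by exact: lt_le_trans (S_ge t).
have SL x y : `|S x - S y| <= p%:R * mdist x y.
  rewrite /S -sumrB (le_trans (ler_norm_sum _ _ _)) //.
  rewrite (@le_trans _ _ (\sum_(i < p) mdist x y)) //; first by apply: ler_sum.
  by rewrite sumr_const card_ord mulr_natl.
(* The quotient rule with [1 / S <= 2 / e]: the numerator contributes [2 / e], and the denominator
   contributes [e * p * (2 / e)^2], since [S] is [p]-Lipschitz. *)
exists p, c, (fun i t => psi i t / S t), (2 / e + 4 * p%:R / e); split.
- by rewrite addr_ge0 // ?divr_ge0 ?mulr_ge0 // ltW.
- by move=> i t; rewrite divr_ge0 // ltW.
- by move=> t; rewrite -mulr_suml -/(S t) divff // gt_eqF.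
- move=> i t; apply: contraNT; rewrite -leNgt => h.
  by rewrite /psi (max_idPl _) ?mul0r // subr_le0.
- move=> i x y.
  have -> : psi i x / S x - psi i y / S y =
      (psi i x - psi i y) / S x + psi i y * (S y - S x) / (S x * S y).
    by field; rewrite !gt_eqF.
  have inv_le t : (S t)^-1 <= 2 / e.
    by rewrite -[leRHS]invf_div lef_pV2 ?posrE.
  have inv0 t : 0 <= (S t)^-1 by rewrite invr_ge0 ltW.
  rewrite (le_trans (ler_normD _ _)) // [leRHS]mulrDl; apply: lerD.
    rewrite normrM (ger0_norm (inv0 x)) mulrC.
    by apply: ler_pM.
  rewrite !normrM (ger0_norm (psi0 i y)) invfM normrM !(ger0_norm (inv0 _)).
  rewrite (@le_trans _ _ (e * (p%:R * mdist x y) * (2 / e * (2 / e)))) //.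
    apply: ler_pM => //.
    - by rewrite mulr_ge0.
    - by rewrite mulr_ge0.
    - by apply: ler_pM => //; rewrite distrC.
    - by apply: ler_pM.
  rewrite le_eqVlt; apply/orP; left; apply/eqP; field; exact: lt0r_neq0.
Qed.

Lemma partition_approx (k : scalar_kind) (n p : nat) (c : 'I_p -> T)
    (phi : 'I_p -> T -> R) (e d : R) (f : T -> 'rV[scalar_field R k]_n) :
  (forall i t, 0 <= phi i t) -> (forall t, \sum_i phi i t = 1) ->
  (forall i t, phi i t != 0 -> mdist (c i) t < e) ->
  (forall s t, mdist s t < e -> hnorm (f s - f t) <= d) ->
  forall t, hnorm (f t - \sum_i of_real (phi i t) *: f (c i)) <= d.
Proof.
move=> phi0 phi1 phie fd t.
have -> : f t - \sum_i of_real (phi i t) *: f (c i) =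
    \sum_i of_real (phi i t) *: (f t - f (c i)).
  under [RHS]eq_bigr do rewrite scalerBr.
  by rewrite sumrB -scaler_suml -of_real_sum phi1 of_real1 scale1r.
rewrite (le_trans (hnorm_sum _ _ _)) // -[leRHS]mul1r -(phi1 t) mulr_suml.
apply: ler_sum => i _; rewrite hnormZ modulus_of_real ger0_norm //.
have [->|h] := eqVneq (phi i t) 0; first by rewrite !mul0r.
by rewrite ler_wpM2l // hnormBC; exact/fd/phie.
Qed.

End PartitionOfUnity.

(** * Realisation of weights on cells by a Borel measure *)

Section Cells.
Context {T : Type} (E : nat -> set T).
Implicit Types (t : T) (w : seq bool).

(* Membership of t in E_{k-1}, ..., E_0, in this order. *)
Fixpoint word t (k : nat) : seq bool :=
  if k is j.+1 then `[<E j t>] :: word t j else [::].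

Definition cell w : set T := [set t | word t (size w) = w].

Lemma size_word t k : size (word t k) = k.
Proof. by elim: k => //= k ->. Qed.

Lemma cell_cons b w : cell (b :: w) `<=` cell w.
Proof. by move=> t [_]. Qed.

Lemma cell_split w : cell w = cell (true :: w) `|` cell (false :: w).
Proof.
apply/seteqP; split => t; last by move=> [|] /cell_cons.
move=> tw; rewrite /cell /= tw.
by case: asboolP => _; [left|right].
Qed.

Lemma cell_disjoint w : cell (true :: w) `&` cell (false :: w) = set0.
Proof. by rewrite -subset0 => t [[h1 _] [h2 _]]; rewrite h1 in h2. Qed.

Lemma eq_word_mem s t k : word s k = word t k -> forall j, (j < k)%N -> E j s <-> E j t.
Proof.
elim: k => // k IH [h1 /IH{}IH] j; rewrite ltnS leq_eqVlt => /predU1P[->|/IH//].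
exact: (asbool_eq_equiv h1).
Qed.

End Cells.

Section BorelCells.
Context {T : topologicalType} (E : nat -> set T) (bE : forall j, borel (E j)).

Lemma borel_cell w : borel (cell E w).
Proof.
elim: w => [|b w IH].
  by have := @borelT T; congr borel; apply/seteqP; split.
have -> : cell E (b :: w) = cell E w `&` (if b then E (size w) else ~` E (size w)).
  apply/seteqP; split => t.
    by move=> [hb hw]; split => //; case: b hb => [/asboolP//|/negbT/asboolPn].
  move=> [hw hb]; rewrite /cell /= hw; congr cons.
  by case: b hb => hb; [apply/asboolP|apply/negbTE/asboolPn].
by apply: borelI => //; case: b => //; exact: borelC.
Qed.

Definition word_tuple (k : nat) (t : T) : k.-tuple bool :=
  Tuple (introT eqP (size_word E t k)).

Lemma coding_word k : coding (@borel T) (word_tuple k).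
Proof.
move=> w; have := borel_cell w; congr borel.
apply/seteqP; split => t; rewrite /cell /= size_tuple.
  by move=> h; apply: val_inj.
by move=> /(congr1 val).
Qed.

End BorelCells.

(* A finitely additive lambda on the cells is realised as Lebesgue measure:
   the cell of w gets the interval of length lambda w and left end
   interval_left w, and u in [0, lambda [::][ is sent to the point of T whose
   cells are those with intervals containing u. *)
Section Realisation.
Context {R : realType} (lam : seq bool -> R).
Hypothesis lam_ge0 : forall w, 0 <= lam w.
Hypothesis lam_split : forall w, lam w = lam (true :: w) + lam (false :: w).

(** The [false] child takes the left part of the interval of its parent and the [true] child the
    right part, with lengths that match by [lam_split]. *)
Fixpoint interval_left (w : seq bool) : R :=
  if w is b :: w' then interval_left w' + (if b then lam (false :: w') else 0) else 0.

Definition interval_of w : set R := [set` `[interval_left w, interval_left w + lam w[%R].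

(** The digits of [u]: the [true] child is entered as soon as its left end is reached, so half-open
    intervals leave no ambiguity. *)
Fixpoint walk (u : R) (k : nat) : seq bool :=
  if k is j.+1 then (interval_left (true :: walk u j) <= u) :: walk u j else [::].

Lemma size_walk u k : size (walk u k) = k.
Proof. by elim: k => //= k ->. Qed.

Lemma interval_walk w u :
  interval_of w u <-> interval_of [::] u /\ walk u (size w) = w.
Proof.
elim: w => [|b w IH]; first by split => [|[]].
have step : interval_of (b :: w) u <-> interval_of w u /\ (interval_left (true :: w) <= u) = b.
  rewrite /interval_of /= !in_itv /=; have h1 := lam_ge0 (true :: w).
  have h0 := lam_ge0 (false :: w); have hs := lam_split w.
  case: b.
    split=> [/andP[h2 h3]|[/andP[h2 h3] h4]]; last by apply/andP; split; lra.
    by rewrite h2; split => //; apply/andP; split; lra.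
  split=> [/andP[h2 h3]|[/andP[h2 h3] /negbT]].
    split; first by apply/andP; split; lra.
    by apply/negbTE; rewrite -ltNge; lra.
  by rewrite -ltNge => h4; apply/andP; split; lra.
split.
  by move=> /step[/IH[h1 h2] h3]; split => //=; rewrite h2 h3.
by move=> [h1 /= [h2 h3]]; apply/step; split; [apply/IH|rewrite -h3 -h2 h3].
Qed.

(** Cutting down to the root interval makes the measure finite, so that [fine] loses nothing on
    [lebesgue_sets]. *)
Definition lebesgue_on (B : set R) : R :=
  fine (@lebesgue_measure R (B `&` interval_of [::])).

Definition lebesgue_sets : set (set R) :=
  [set B | @measurable _ (measurableTypeR R) (B `&` interval_of [::])].

Let mI w : @measurable _ (measurableTypeR R) (interval_of w).
Proof. exact: measurable_itv. Qed.

Lemma lebesgue_interval w : @lebesgue_measure R (interval_of w) = (lam w)%:E.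
Proof.
rewrite lebesgue_measure_itv /= lte_fin ltrDl.
have := lam_ge0 w; rewrite le_eqVlt => /predU1P[<-|->]; first by rewrite ltxx.
by rewrite -EFinD addrC addKr.
Qed.

Let mu_fin B : lebesgue_sets B ->
  @lebesgue_measure R (B `&` interval_of [::]) = (lebesgue_on B)%:E.
Proof.
move=> mB; rewrite /lebesgue_on fineK // ge0_fin_numE ?measure_ge0 //.
apply: le_lt_trans (ltry (lam [::])); rewrite -lebesgue_interval.
by apply: le_measure; rewrite ?inE //; exact: mI.
Qed.

Lemma lebesgue_sets_algebra : set_algebra lebesgue_sets.
Proof.
split; rewrite /lebesgue_sets /=.
- by rewrite set0I; exact: measurable0.
- move=> A mA.
  have -> : ~` A `&` interval_of [::] = interval_of [::] `\` (A `&` interval_of [::]).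
    by rewrite setDIr setDv setU0 setIC setDE.
  exact: measurableD.
- by move=> A B mA mB; rewrite setIUl; exact: measurableU.
Qed.

Lemma lebesgue_on_additive : finitely_additive lebesgue_sets lebesgue_on.
Proof.
split; first by rewrite /lebesgue_on set0I measure0.
move=> A B mA mB AB; apply: EFin_inj; rewrite EFinD -!mu_fin //; last first.
  by have [_ _] := lebesgue_sets_algebra; apply.
rewrite setIUl measureU // setIACA AB set0I //.
Qed.

Lemma lebesgue_on_ge0 A : 0 <= lebesgue_on A.
Proof. by rewrite fine_ge0 // measure_ge0. Qed.

Lemma lebesgue_on_bigcup (A : nat -> set R) : (forall i, lebesgue_sets (A i)) ->
  trivIset setT A ->
  lebesgue_sets (\bigcup_i A i) /\
  (fun N => \sum_(i < N) lebesgue_on (A i)) @ \oo --> lebesgue_on (\bigcup_i A i).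
Proof.
move=> mA tA.
have mU : lebesgue_sets (\bigcup_i A i).
  by rewrite /lebesgue_sets /= setI_bigcupl; exact: bigcupT_measurable.
split => //.
have tA' : trivIset setT (fun i => A i `&` interval_of [::]) by exact: trivIset_setIr.
have := @measure_semi_sigma_additive _ _ _ (@lebesgue_measure R) _ mA tA'.
have eU : \bigcup_i (A i `&` interval_of [::]) = \bigcup_i A i `&` interval_of [::].
  by rewrite setI_bigcupl.
rewrite eU => /(_ mU) h.
have : (fun N => \sum_(0 <= i < N) @lebesgue_measure R (A i `&` interval_of [::]))%E @ \oo -->
    (lebesgue_on (\bigcup_i A i))%:E by rewrite -(mu_fin mU); exact: h.
move=> /fine_cvg.
set u := (X in X @ \oo --> _); set v := (X in _ -> X @ \oo --> _).
suff -> : u = v by [].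
apply/funext => N; rewrite /u /v /=.
rewrite big_mkord (eq_bigr (fun i : 'I_N => (lebesgue_on (A i))%:E)) => [|i _]; last exact: mu_fin.
by rewrite sumEFin.
Qed.

Lemma interval_of_sets w : lebesgue_sets (interval_of w).
Proof. by apply: measurableI. Qed.

Definition walk_tuple (k : nat) (u : R) : k.-tuple bool :=
  Tuple (introT eqP (size_walk u k)).

Lemma walk_fiber k (w : k.-tuple bool) :
  walk_tuple k @^-1` [set w] `&` interval_of [::] = interval_of w.
Proof.
apply/seteqP; split => u.
  by move=> [/(congr1 val) /= h1 h2]; apply/interval_walk; rewrite size_tuple.
move=> /interval_walk[h1]; rewrite size_tuple => h2; split => //.
exact: val_inj.
Qed.

Lemma coding_walk k : coding lebesgue_sets (walk_tuple k).
Proof. by move=> w; rewrite /lebesgue_sets /= walk_fiber. Qed.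

Lemma lebesgue_on_walk k (w : k.-tuple bool) :
  lebesgue_on (walk_tuple k @^-1` [set w]) = lam w.
Proof. by rewrite /lebesgue_on walk_fiber lebesgue_interval. Qed.

Lemma lebesgue_on_total : lebesgue_on setT = lam [::].
Proof. by rewrite /lebesgue_on setTI lebesgue_interval. Qed.

End Realisation.

(** * Transport of Lebesgue measure to [T] *)

Section Pushforward.
Context {R : realType} {T : metricType R} (compactT : compact [set: T]) (t0 : T).
Variables (E : nat -> set T) (lam : seq bool -> R).
Hypothesis bE : forall j, borel (E j).
Hypothesis sepE : forall e : R, 0 < e -> exists N, forall s t,
  (forall j, (j < N)%N -> E j s <-> E j t) -> mdist s t < e.
Hypothesis lam_ge0 : forall w, 0 <= lam w.
Hypothesis lam_split : forall w, lam w = lam (true :: w) + lam (false :: w).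
Hypothesis lam_cell : forall w, 0 < lam w -> cell E w !=set0.

(** Two points of a long cell are within [e / 3], and each passage from the closure to the cell
    costs another [e / 3]. *)
Lemma cell_closure_small (e : R) : 0 < e -> exists N, forall w s t, (N <= size w)%N ->
  closure (cell E w) s -> closure (cell E w) t -> mdist s t < e.
Proof.
move=> e0; have e3 : 0 < e / 3 by rewrite divr_gt0.
have [N hN] := sepE e3; exists N => w s t Nw sw tw.
have near x : closure (cell E w) x -> exists2 y, cell E w y & mdist x y < e / 3.
  move=> /(_ [set y | mdist x y < e / 3]) [|y [wy xy]]; last by exists y.
  by apply/nbhs_mdist; exists (e / 3).
have [s' s'w ss'] := near _ sw; have [t' t'w tt'] := near _ tw.
have : mdist s' t' < e / 3.
  apply: hN => j jN; apply: (eq_word_mem (k := size w)); first by rewrite s'w t'w.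
  exact: leq_trans Nw.
have := metric_triangle s s' t; have := metric_triangle s' t' t.
have := metric_sym t' t; lra.
Qed.

(** The cells along the walk decrease and are inhabited, but they are not closed; compactness gives
    a common point of their closures only. Outside the root interval [t0] is a dummy value. *)
Lemma walk_point u : exists x, interval_of lam [::] u ->
  forall k, closure (cell E (walk lam u k)) x.
Proof.
have [u0|nu0] := pselect (interval_of lam [::] u); last by exists t0.
have ne k : cell E (walk lam u k) !=set0.
  (* An interval containing [u] has positive length, and a cell of positive weight is inhabited. *)
  apply: lam_cell; have : interval_of lam (walk lam u k) u.
    by apply/(interval_walk lam_ge0 lam_split); rewrite size_walk.
  by rewrite /interval_of /= in_itv /= => /andP[]; lra.
have [y hy] := choice ne.
have sub j k : (k <= j)%N -> cell E (walk lam u j) `<=` cell E (walk lam u k).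
  elim: j => [|j IH]; first by rewrite leqn0 => /eqP ->.
  rewrite leq_eqVlt => /predU1P[-> //|]; rewrite ltnS => /IH h x.
  by move=> hx; apply: h; exact: cell_cons hx.
have [|x [_ hx]] := compactT (F := y @ \oo); first exact: filterT.
exists x => _ k B xB; apply: hx => //.
by exists k => // j /= kj; exact: (sub _ _ kj _ (hy j)).
Qed.

Let limit_point : {X : R -> T & forall u, interval_of lam [::] u ->
  forall k, closure (cell E (walk lam u k)) (X u)} := choice walk_point.

Definition cell_limit : R -> T := projT1 limit_point.

Lemma cell_limitP u k : interval_of lam [::] u ->
  closure (cell E (walk lam u k)) (cell_limit u).
Proof. by move=> h; exact: (projT2 limit_point). Qed.

Lemma cell_limit_measurable A : borel A -> lebesgue_sets lam (cell_limit @^-1` A).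
Proof.
pose G : set (set T) := [set A | lebesgue_sets lam (cell_limit @^-1` A)].
have [G0 GC GU] := lebesgue_sets_algebra lam.
suff : @borel T `<=` G by exact.
apply: smallest_sub; first split.
- exact: G0.
- by move=> B GB; rewrite /G /= setTD preimage_setC; exact: GC.
- move=> B GB; rewrite /G /= preimage_bigcup /lebesgue_sets /= setI_bigcupl.
  exact: bigcupT_measurable.
- move=> U oU; rewrite /G /lebesgue_sets /=.
  (* The preimage of [U] is the union of the intervals of those words whose closed cell lies in [U]:
     the closed cells of the walk of [u] shrink to its limit point, so one of them fits into [U]. *)
  pose J (o : option (seq bool)) := if o is Some w then
    if `[<closure (cell E w) `<=` U>] then interval_of lam w else set0 else set0.
  have -> : cell_limit @^-1` U `&` interval_of lam [::] = \bigcup_i J (unpickle i).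
    apply/seteqP; split => u.
      move=> [/= Uu u0]; have [e e0 he] : exists2 e : R, 0 < e & forall y, mdist (cell_limit u) y < e -> U y.
        by apply/nbhs_mdist; exact: open_nbhs_nbhs.
      have [N hN] := cell_closure_small e0.
      have Ju : J (unpickle (pickle (walk lam u N))) u.
        rewrite pickleK /J; case: asboolP => [_|[]].
          by apply/(interval_walk lam_ge0 lam_split); rewrite size_walk.
        move=> y hy; apply: he; apply: hN hy; first by rewrite size_walk.
        exact: cell_limitP.
      by exists (pickle (walk lam u N)).
    move=> [i _]; rewrite /J; case: unpickle => // w; case: asboolP => // wU uw.
    have [h1 h2] := (interval_walk lam_ge0 lam_split w u).1 uw; split => //=.
    by apply: wU; rewrite -h2; exact: cell_limitP.
  apply: bigcupT_measurable => i; rewrite /J; case: unpickle => [w|]; last exact: measurable0.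
  by case: asboolP => _; [exact: measurable_itv|exact: measurable0].
Qed.

Definition cell_measure (A : set T) : R := lebesgue_on lam (cell_limit @^-1` A).

Lemma cell_measure_ge0 A : 0 <= cell_measure A.
Proof. exact: lebesgue_on_ge0. Qed.

Lemma cell_measure_additive : countably_additive cell_measure.
Proof.
move=> A bA tA; rewrite /cell_measure preimage_bigcup.
apply: (lebesgue_on_bigcup lam_ge0 _ _).2.
  by move=> i; exact: cell_limit_measurable.
by move=> i j _ _ [x [xi xj]]; apply: (tA i j I I); exists (cell_limit x).
Qed.

Lemma cell_measure_total : cell_measure setT = lam [::].
Proof. by rewrite /cell_measure preimage_setT lebesgue_on_total. Qed.

(** A limit point may leave the cells of its walk, so [cell_measure] need not equal [lam w] on the
    cell of [w]. Closeness is therefore assumed on closures of cells, and both sums are compared on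
    the line, over the common coding [d]. *)
Lemma cell_measure_approx (k : scalar_kind) (W : finType) (c : T -> W)
    (kap : W -> scalar_field R k) (j : nat) (kap' : seq bool -> scalar_field R k) (e : R) :
  coding (@borel T) c ->
  (forall w t, size w = j -> closure (cell E w) t -> modulus (kap (c t) - kap' w) <= e) ->
  modulus (\sum_w kap w * of_real (cell_measure (c @^-1` [set w])) -
           \sum_(w : j.-tuple bool) kap' w * of_real (lam w)) <= e * lam [::].
Proof.
move=> cB h; have algL := lebesgue_sets_algebra lam.
have addL := lebesgue_on_additive lam_ge0.
pose d u := (c (cell_limit u), walk_tuple lam j u).
have cX : coding (lebesgue_sets lam) (c \o cell_limit).
  by move=> w; have := cell_limit_measurable (cB w).
have dL : coding (lebesgue_sets lam) d.
  by apply: coding_pair => //; exact: coding_walk.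
have addF (z : scalar_field R k) x y : z * of_real (x + y) = z * of_real x + z * of_real y.
  by rewrite of_realD mulrDr.
have zeroF (z : scalar_field R k) : z * of_real 0 = 0 by rewrite of_real0 mulr0.
have -> : \sum_w kap w * of_real (cell_measure (c @^-1` [set w])) =
    \sum_(w : W * j.-tuple bool) kap w.1 * of_real (lebesgue_on lam (d @^-1` [set w])).
  exact: (@coding_refine _ _ algL _ _ (lebesgue_on lam) _ _ d fst (fun w r => kap w * of_real r)).
have -> : \sum_(w : j.-tuple bool) kap' w * of_real (lam w) =
    \sum_(w : W * j.-tuple bool) kap' (tval w.2) * of_real (lebesgue_on lam (d @^-1` [set w])).
  rewrite -(@coding_refine _ _ algL _ _ (lebesgue_on lam) _ _ d snd
    (fun (w : j.-tuple bool) r => kap' w * of_real r)) //.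
  by apply: eq_bigr => w _; rewrite -(lebesgue_on_walk lam_ge0 lam_split).
rewrite -sumrB (le_trans (modulus_sum _ _ _)) //.
pose q (w : W * j.-tuple bool) := modulus (kap w.1 - kap' (tval w.2)).
rewrite (@le_trans _ _ (\sum_w q w * lebesgue_on lam (d @^-1` [set w]))) //.
  apply: ler_sum => w _; rewrite -mulrBl modulusM modulus_of_real.
  by rewrite ger0_norm // lebesgue_on_ge0.
(* Off the root interval nothing is known about [cell_limit], but the mass there is 0, so the crude
   bound by the sum of all [q w] suffices. *)
have := @coding_weight_local _ _ algL _ (lebesgue_on lam) _ d q (interval_of lam [::])
  e (\sum_w q w) addL (fun A _ => lebesgue_on_ge0 lam A) dL (interval_of_sets lam [::]).
move=> /(_ _ _)/le_trans; apply.
- move=> u u0; apply: h; first by rewrite size_tuple.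
  exact: cell_limitP.
- move=> u _; rewrite (bigD1 (d u)) //= lerDl sumr_ge0 // => w _; exact: modulus_ge0.
have -> : lebesgue_on lam (interval_of lam [::]) = lam [::].
  by rewrite /lebesgue_on setIid lebesgue_interval.
have -> : lebesgue_on lam (~` interval_of lam [::]) = 0.
  by rewrite /lebesgue_on setICl measure0.
by rewrite mulr0 addr0.
Qed.

End Pushforward.

(** * Limits of measures along ultrafilters *)

Section CountablyAdditiveSums.
Context {R : realType} {T : topologicalType}.
Implicit Types D : set T -> R.

Lemma countably_additiveD D D' : countably_additive D -> countably_additive D' ->
  countably_additive (fun A => D A + D' A).
Proof.
move=> aD aD' A bA tA; under eq_fun do rewrite big_split.
by apply: cvgD; [exact: aD|exact: aD'].
Qed.

Lemma countably_additiveZ D (r : R) : countably_additive D ->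
  countably_additive (fun A => D A * r).
Proof.
move=> aD A bA tA; under eq_fun do rewrite -mulr_suml.
by apply: cvgMr_tmp; exact: aD.
Qed.

Lemma countably_additive_sum (I : finType) (D : I -> set T -> R) :
  (forall i, countably_additive (D i)) -> countably_additive (fun A => \sum_i D i A).
Proof.
move=> aD.
suff h (s : seq I) : countably_additive (fun A => \sum_(i <- s) D i A) by exact: h.
elim: s => [|i s IH].
  have -> : (fun A => \sum_(i <- [::]) D i A) = fun=> 0 by apply/funext => A; rewrite big_nil.
  move=> A bA tA; under eq_fun do rewrite big1 //.
  exact: cvg_cst.
have -> : (fun A => \sum_(i <- i :: s) D i A) = fun A => D i A + \sum_(i <- s) D i A.
  by apply/funext => A; rewrite big_cons.
exact: countably_additiveD.
Qed.

End CountablyAdditiveSums.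

(** * Vector measures dominated by a finite measure *)

Section DominatedMeasures.
Context {R : realType} {k : scalar_kind} {n : nat} {T : metricType R}.
Local Notation K := (scalar_field R k).
Local Notation X := 'rV[K]_n.
Implicit Types (m : set T -> X) (D : set T -> R).

Lemma additive_bigsetU (V : zmodType) (p : set T -> V) (A : nat -> set T) N :
  finitely_additive (@borel T) p -> (forall i, borel (A i)) -> trivIset setT A ->
  p (\big[setU/set0]_(i < N) A i) = \sum_(i < N) p (A i).
Proof.
move=> [p0 addp] bA tA; elim: N => [|N IH]; first by rewrite !big_ord0.
rewrite !big_ord_recr /= addp ?IH //; first exact: borel_bigsetU.
rewrite -subset0 => x [+ ANx]; rewrite -bigcup_mkord => -[i /= iN Aix].
have e : i = N by apply: (tA i N I I); exists x.
by move: iN; rewrite e ltnn.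
Qed.

Lemma partition_coding (p : nat) (P : 'I_p -> set T) :
  (forall i, borel (P i)) -> trivIset [set: 'I_p] P ->
  exists c : T -> option 'I_p, coding (@borel T) c /\ forall i, c @^-1` [set Some i] = P i.
Proof.
move=> bP tP; pose c t := [pick i | `[<P i t>]].
have cP i : c @^-1` [set Some i] = P i.
  apply/seteqP; split => t; rewrite /c /=; first by case: pickP => // j /asboolP Pj [<-].
  move=> Pi; case: pickP => [j /asboolP Pj|/(_ i)]; last by case: asboolP.
  by congr Some; apply: (tP j i I I); exists t.
exists c; split => // -[i|]; first by rewrite cP.
have -> : c @^-1` [set None] = ~` \bigcup_j (if insub j is Some i then P i else set0).
  apply/seteqP; split => t; rewrite /c /=.
    case: pickP => // h _ [j _]; case: insubP => // i _ _ Pi.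
    by have := h i; case: asboolP.
  move=> h; case: pickP => // j /asboolP Pj; exfalso; apply: h.
  by exists (val j) => //=; rewrite valK.
apply: borelC; apply: borel_bigcup => j; case: insubP => [i _ _|_] //; exact: borel0.
Qed.

Lemma additive_partition_le D (p : nat) (P : 'I_p -> set T) :
  finitely_additive (@borel T) D -> (forall A, borel A -> 0 <= D A) ->
  (forall i, borel (P i)) -> trivIset [set: 'I_p] P -> \sum_(i < p) D (P i) <= D setT.
Proof.
move=> addD D0 bP tP; have [c [cB cP]] := partition_coding bP tP.
rewrite (additive_total borel_algebra addD cB).
under eq_bigr do rewrite -cP.
rewrite [leRHS](bigID (fun w => w == None)) /= [leRHS]addrC.
rewrite (@le_trans _ _ (\sum_(w : option 'I_p | w != None) D (c @^-1` [set w]))) //; last first.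
  by rewrite lerDl sumr_ge0 // => w _; exact: D0.
rewrite le_eqVlt; apply/orP; left; apply/eqP.
rewrite (reindex_omap Some id) //=; last by case.
by apply: eq_bigl => i; rewrite eqxx.
Qed.

(** The remainder of the series is the mass of the tail of the union, and [D] of that tail tends to
    0. *)
Lemma dominated_sigma_additive m D :
  dominated (@borel T) m D -> countably_additive D -> sigma_additive_on_borel m.
Proof.
move=> mD aD A bA tA; apply/cvg_hnorm => e e0.
have D0 := dominated_ge0 mD; have [addm addD mleD] := mD.
have [N _ hN] := measure_cvg_bigcup aD bA e0; exists N => // j /hN.
have bU := borel_bigsetU j bA; have bB := borel_bigcup bA.
have sub : \big[setU/set0]_(i < j) A i `<=` \bigcup_i A i.
  by rewrite -bigcup_mkord => x [i _ Ax]; exists i.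
apply: le_lt_trans.
rewrite -(additive_bigsetU j addm bA tA) -(additiveD borel_algebra addm bU bB sub).
by apply: mleD; exact: borelD.
Qed.

Lemma dominated_cabv m D : dominated (@borel T) m D -> countably_additive D ->
  (forall A, ~ borel A -> m A = 0) -> is_cabv m.
Proof.
move=> mD aD m0; split => //; first exact: dominated_sigma_additive aD.
apply: (@le_lt_trans _ _ (D setT)%:E); last exact: ltry.
apply/measure_variation_le => _ [p [P [bP tP _ ->]]].
have [_ addD mleD] := mD.
apply: le_trans (additive_partition_le addD (dominated_ge0 mD) bP tP).
by apply: ler_sum => i _; exact: mleD.
Qed.

Section Combination.
Variables (I : finType) (mu : I -> set T -> R) (z : I -> X).
Hypothesis mu_ge0 : forall i A, borel A -> 0 <= mu i A.
Hypothesis mu_additive : forall i, countably_additive (mu i).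

(** The default 0 follows the convention of [is_cabv] on non-Borel sets. *)
Definition vector_combination (A : set T) : X :=
  if `[<borel A>] then \sum_i of_real (mu i A) *: z i else 0.

Definition combination_bound (A : set T) : R := \sum_i mu i A * hnorm (z i).

Lemma combination_bound_additive : countably_additive combination_bound.
Proof. by apply: countably_additive_sum => i; exact: countably_additiveZ. Qed.

Lemma vector_combination_dominated :
  dominated (@borel T) vector_combination combination_bound.
Proof.
split; last 2 first.
- exact/countably_additive_finitely/combination_bound_additive.
- move=> A bA; rewrite /vector_combination asboolT //.
  rewrite (le_trans (hnorm_sum _ _ _)) //; apply: ler_sum => i _.
  by rewrite hnormZ modulus_of_real ger0_norm // mu_ge0.
have addmu i := countably_additive_finitely (@mu_additive i).
split.
  rewrite /vector_combination asboolT; last exact: borel0.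
  by apply: big1 => i _; case: (addmu i) => -> _; rewrite of_real0 scale0r.
move=> A B bA bB AB; rewrite /vector_combination !asboolT //; last exact: borelU.
rewrite -big_split; apply: eq_bigr => i _ /=; case: (addmu i) => _ -> //.
by rewrite of_realD scalerDl.
Qed.

Lemma vector_combination_cabv : is_cabv vector_combination.
Proof.
apply: (dominated_cabv vector_combination_dominated combination_bound_additive).
by move=> A nA; rewrite /vector_combination asboolF.
Qed.

Lemma coded_sum_combination (W : finType) (c : T -> W) (v : W -> X) :
  coding (@borel T) c ->
  coded_sum vector_combination c v =
  \sum_i \sum_w inner (v w) (z i) * of_real (mu i (c @^-1` [set w])).
Proof.
move=> cB; rewrite exchange_big; apply: eq_bigr => w _ /=.
rewrite /vector_combination asboolT; last exact: cB.
rewrite inner_sumr; apply: eq_bigr => i _.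
by rewrite innerZr scalar_conj_of_real mulrC.
Qed.

End Combination.

Hypothesis compactT : compact [set: T].

(** Every point misses one of the two closed sets, and near it the thin thickenings of that set do
    not occur; compactness makes the thickness uniform. *)
Lemma disjoint_thickenings (C C' : set T) : closed C -> closed C' -> C `&` C' = set0 ->
  \forall i \near \oo, forall t : T, ~ (thickening C i.+1%:R t /\ thickening C' i.+1%:R t).
Proof.
move=> cC cC' CC'.
have away (B : set T) (x : T) : closed B -> ~ B x -> exists2 r : R, 0 < r &
    exists N, forall y i, mdist x y < r -> (N <= i)%N -> ~ thickening B i.+1%:R y.
  move=> cB nB; have [r r0 hr] : exists2 r : R, 0 < r & forall y, mdist x y < r -> (~` B) y.
    by apply/nbhs_mdist; apply: open_nbhs_nbhs; split => //; exact: closed_openC.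
  have [N hN] := natSinv_small (divr_gt0 r0 (ltr0n R 2)).
  exists (r / 2); first exact: divr_gt0.
  exists N => y i xy Ni [b Bb hb]; apply: (hr b) => //.
  have : mdist b y < i.+1%:R^-1 by rewrite -[ltRHS]mulr1 ltr_pdivlMl.
  have := hN i Ni; have := metric_triangle x y b; have := metric_sym b y.
  move: (i.+1%:R^-1) => u; lra.
have [x|N hN] := compact_eventually compactT
  (P := fun i t => ~ (thickening C i.+1%:R t /\ thickening C' i.+1%:R t)); last by exists N.
have [Cx|nC] := pselect (C x).
  have nC' : ~ C' x by move=> C'x; have []: set0 x by rewrite -CC'.
  have [r r0 [N hN]] := away _ _ cC' nC'; exists r => //; exists N => y i xy Ni [_].
  exact: hN.
have [r r0 [N hN]] := away _ _ cC nC; exists r => //; exists N => y i xy Ni [+ _].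
exact: hN.
Qed.

(** [D] may be much larger than [a]: it only provides regularity and small errors, while the bound
    [a] comes from the test functions. *)
Lemma partition_sums_le_integral m D (a : R) :
  dominated (@borel T) m D -> countably_additive D ->
  (forall L f, lipschitz L f -> (forall t, hnorm (f t) <= 1) ->
    modulus (integral_of m f) <= a) ->
  forall v, partition_sums m setT v -> v <= a.
Proof.
move=> mD aD ma _ [p [P [bP tP UP ->]]]; apply/ler_addgt0Pr => e e0.
have D0 := dominated_ge0 mD; have [addm addD mleD] := mD.
have p1 : 0 < 2 * p.+1%:R :> R by rewrite mulr_gt0.
(* The error [p * d] is paid twice: for shrinking [P i] to [C i], and for replacing indicators by
   bumps. *)
set d := e / (2 * p.+1%:R); have d0 : 0 < d by exact: divr_gt0.
have pd : p%:R * d <= e / 2.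
  have -> : e / 2 = p.+1%:R * d by rewrite /d; field; rewrite addrC natr1 pnatr_eq0.
  by rewrite ler_wpM2r ?ler_nat // ltW.
have [C hC] := choice (fun i => borel_regular aD D0 (bP i) d0).
have cC i : closed (C i) by have [U []] := hC i.
have CP i : C i `<=` P i by have [U []] := hC i.
have DC i : D (P i `\` C i) < d.
  have [U [_ oU _ PU h]] := hC i; apply: le_lt_trans h.
  have bC := borel_closed (cC i).
  apply: (additive_mono borel_algebra addD D0).
  - exact: borelD.
  - by apply: borelD => //; exact: borel_open.
  - by move=> t [Pt nC]; split => //; exact: PU.
(* The direction of [m (C i)], for which the inner product with [m (C i)] is its norm. If [m (C i)]
   is 0, the inverse of 0 is 0 and so is [x i]. *)
pose x i : X := of_real (hnorm (m (C i)))^-1 *: m (C i).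
have x_le i : hnorm (x i) <= 1.
  rewrite hnormZ modulus_of_real ger0_norm ?invr_ge0 ?hnorm_ge0 //.
  have [->|h] := eqVneq (hnorm (m (C i))) 0; first by rewrite mulr0.
  by rewrite mulVf.
have x_inner i : inner (x i) (m (C i)) = of_real (hnorm (m (C i))).
  rewrite innerZl inner_hnorm -of_realM; congr of_real.
  have [->|h] := eqVneq (hnorm (m (C i))) 0; first by rewrite expr0n mulr0.
  by rewrite expr2 mulKf.
pose f (N : nat) t : X := \sum_i bump_vec (C i) N.+1%:R (x i) t.
have fL N : lipschitz (\sum_i N.+1%:R * hnorm (x i)) (f N).
  move=> s t; rewrite /f -sumrB (le_trans (hnorm_sum _ _ _)) // mulr_suml.
  by apply: ler_sum => i _; exact: bump_vec_lipschitz.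
have s_f N i : simple_approximable (bump_vec (C i) N.+1%:R (x i)).
  exact: (lipschitz_approximable compactT (bump_vec_lipschitz _ _ (ler0n R N.+1))).
have intf N : integral_of m (f N) = \sum_i integral_of m (bump_vec (C i) N.+1%:R (x i)).
  exact: (integral_of_sum mD (s_f N)).2.
have near_disj : \forall N \near \oo, forall ij : 'I_p * 'I_p, ij.1 != ij.2 -> forall t : T,
    ~ (thickening (C ij.1) N.+1%:R t /\ thickening (C ij.2) N.+1%:R t).
  apply: filter_forall => -[i j] /=; have [->|ij] := eqVneq i j.
    by apply: nearW => N; rewrite ?eqxx.
  have [|N _ hN] := disjoint_thickenings (cC i) (cC j).
    rewrite -subset0 => t [/CP Pi /CP Pj]; move: ij.
    by rewrite (tP i j I I) ?eqxx //; exists t.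
  by exists N => // N' /hN h _ t; exact: h.
have near_int : \forall N \near \oo, forall i : 'I_p,
    modulus (integral_of m (bump_vec (C i) N.+1%:R (x i)) - inner (x i) (m (C i))) < d.
  apply: filter_forall => i.
  have [N hN] := integral_bump_cvg compactT (x i) mD aD (cC i) d0.
  by exists N => // N' /hN.
have [N [disjN intN]] := filter_ex (filterI near_disj near_int).
(* With disjoint thickenings at most one bump is nonzero at [t]. *)
have f_le t : hnorm (f N t) <= 1.
  have [h|h] := pselect (exists i, thickening (C i) N.+1%:R t); last first.
    rewrite /f big1 ?hnorm0 // => i _; rewrite /bump_vec bump_out ?of_real0 ?scale0r //.
    by move=> ti; apply: h; exists i.
  have [i ti] := h; rewrite /f (bigD1 i) //= big1 ?addr0 => [|j ji].
    rewrite hnormZ modulus_of_real ger0_norm ?bump_ge0 //.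
    by rewrite mulr_ile1 ?bump_ge0 ?hnorm_ge0 ?bump_le1.
  rewrite /bump_vec bump_out ?of_real0 ?scale0r // => tj.
  by apply: (disjN (j, i) ji t).
have := ma _ _ (fL N) f_le; rewrite intf => h1.
have h2 : modulus (\sum_i of_real (hnorm (m (C i))) -
    \sum_i integral_of m (bump_vec (C i) N.+1%:R (x i)) : K) <= p%:R * d.
  rewrite -sumrB (le_trans (modulus_sum _ _ _)) //.
  rewrite (@le_trans _ _ (\sum_(i < p) d)) //; last by rewrite sumr_const card_ord mulr_natl.
  by apply: ler_sum => i _; rewrite -x_inner modulusB ltW.
have h3 : \sum_(i < p) hnorm (m (C i)) <= a + p%:R * d.
  have -> : \sum_(i < p) hnorm (m (C i)) = modulus (\sum_(i < p) of_real (hnorm (m (C i))) : K).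
    by rewrite -of_real_sum modulus_of_real ger0_norm // sumr_ge0 // => i _; exact: hnorm_ge0.
  rewrite -(subrK (\sum_i integral_of m (bump_vec (C i) N.+1%:R (x i))) (\sum_i of_real _)).
  by rewrite addrC (le_trans (modulusD _ _)) // lerD.
have h4 : \sum_(i < p) hnorm (m (P i)) <= \sum_(i < p) hnorm (m (C i)) + p%:R * d.
  have -> : p%:R * d = \sum_(i < p) d by rewrite sumr_const card_ord mulr_natl.
  rewrite -big_split; apply: ler_sum => i _ /=.
  have bC := borel_closed (cC i).
  rewrite -[m (P i)](subrK (m (C i))) [_ - _ + _]addrC (le_trans (hnormD _ _)) // lerD2l.
  rewrite -(additiveD borel_algebra addm bC (bP i) (CP i)).
  by rewrite (le_trans (mleD _ (borelD (bP i) bC))) // ltW.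
lra.
Qed.

End DominatedMeasures.

Lemma big_option (V : nmodType) (I : finType) (F : option I -> V) :
  \sum_w F w = F None + \sum_i F (Some i).
Proof.
rewrite (bigD1 None) //=; congr +%R.
rewrite (reindex_omap Some id) //=; last by case.
by apply: eq_bigl => i; rewrite eqxx.
Qed.

Lemma ultra_limit (R : realType) (S : Type) (F : set_system S) (FU : UltraFilter F)
    (g : S -> R) (B : R) :
  (forall s, `|g s| <= B) -> exists l : R, g @ F --> l.
Proof.
move=> gB; have PF : ProperFilter F by exact: ultra_proper.
have [|l [_ hl]] := @segment_compact R (- B) B (g @ F) _.
  by apply: nearW => s /=; rewrite in_itv /= -ler_norml.
exists l; apply/cvgrPdist_lt => e e0.
have [//|nF] := in_ultra_setVsetC [set s | `|l - g s| < e] FU.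
have [|x [hx1 hx2]] := hl [set y | ~ `|l - y| < e] [set y | `|l - y| < e] nF.
  by apply/nbhs_ballP; exists e.
by case: (hx1 hx2).
Qed.

(** * Nonnegative parts of a vector measure *)

Section Parts.
Context {R : realType} {k : scalar_kind} {n : nat} {T : metricType R}.
Local Notation K := (scalar_field R k).
Local Notation X := 'rV[K]_n.
Implicit Types (m : set T -> X).

Definition part_index : finType := option ('I_n * bool).

(* Nonnegative measures |m|, |m| + Re m_j and |m| + Im m_j, of which m is a
   linear combination with fixed vector coefficients. *)
Definition part m (i : part_index) (A : set T) : R :=
  if i is Some (j, b) then
    variation m A + (if b then imag_part else real_part) (m A ord0 j)
  else variation m A.

Definition unit_vec (jb : 'I_n * bool) : X :=
  (if jb.2 then imag_unit else 1) *: delta_mx ord0 jb.1.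

(** The coefficient of [|m|] cancels the copies of [|m|] that were added to the other parts. *)
Definition part_vec (i : part_index) : X :=
  if i is Some jb then unit_vec jb else - \sum_jb unit_vec jb.

Lemma part_sum m A : \sum_i of_real (part m i A) *: part_vec i = m A.
Proof.
rewrite big_option /= scalerN scaler_sumr addrC -sumrB.
pose F j b := of_real ((if b then imag_part else real_part) (m A ord0 j)) *: unit_vec (j, b).
transitivity (\sum_(jb : 'I_n * bool) F jb.1 jb.2).
  apply: eq_bigr => -[j b] _ /=; rewrite -scalerBl -of_realN -of_realD.
  by rewrite addrC addKr.
rewrite -(pair_bigA _ F) /= [RHS]row_sum_delta; apply: eq_bigr => j _.
by rewrite big_bool /F /unit_vec /= !scalerA -scalerDl addrC -scalar_parts.
Qed.

Lemma part_ge0 m i A : is_cabv m -> borel A -> 0 <= part m i A.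
Proof.
move=> hm bA; have [_ _ h] := cabv_dominated hm; have hA := h A bA.
have v0 : 0 <= variation m A by exact: le_trans (hnorm_ge0 _) hA.
case: i => [[j b]|] //=.
have hj := le_trans (modulus_le_hnorm (m A) j) hA.
have := real_part_le (m A ord0 j); have := imag_part_le (m A ord0 j).
by case: b; rewrite !ler_norml => /andP[h1 h2] /andP[h3 h4]; lra.
Qed.

Lemma part_le m i A (a : R) : is_cabv m -> borel A ->
  (forall v, partition_sums m setT v -> v <= a) -> part m i A <= a + a.
Proof.
move=> hm bA ma; have [am _ _] := hm.
have va : variation m A <= a by exact: (variation_le ma bA).
have v0 : 0 <= variation m A by exact: (variation_ge0 ma bA).
have hA : hnorm (m A) <= variation m A by exact: (hnorm_le_variation ma bA).
case: i => [[j b]|] /=; last by lra.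
have hj := le_trans (modulus_le_hnorm (m A) j) hA.
have := real_part_le (m A ord0 j); have := imag_part_le (m A ord0 j).
by case: b; rewrite !ler_norml => /andP[h1 h2] /andP[h3 h4]; lra.
Qed.

Lemma part_additive m i : is_cabv m -> finitely_additive (@borel T) (part m i).
Proof.
move=> hm; have [[m0 am] [v0 av] _] := cabv_dominated hm.
have rpart0 (b : bool) : (if b then imag_part else real_part) (0 : K) = 0 :> R.
  by rewrite -(subrr 0); case: b; rewrite ?imag_partB ?real_partB !subrr.
have rpartD (b : bool) (x y : K) : (if b then imag_part else real_part) (x + y) =
    (if b then imag_part else real_part) x + (if b then imag_part else real_part) y :> R.
  apply: (@addIr _ (- (if b then imag_part else real_part) y)); rewrite addrK.
  by case: b; rewrite -?imag_partB -?real_partB addrK.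
case: i => [[j b]|] /=; last by split.
split; first by rewrite /= v0 m0 mxE rpart0 addr0.
move=> A B bA bB AB; rewrite /= av // am // mxE rpartD.
by rewrite addrACA.
Qed.

End Parts.

(** * Existence of the weak-star limit *)

Section UltraLimit.
Context {R : realType} {k : scalar_kind} {n : nat} {T : metricType R}.
Local Notation K := (scalar_field R k).
Local Notation X := 'rV[K]_n.
Hypothesis compactT : compact [set: T].
Variables (t0 : T) (S : Type) (F : set_system S) (FU : UltraFilter F).
Variables (M : S -> set T -> X) (a : R).
Hypothesis cabvM : forall s, is_cabv (M s).
Hypothesis M_le : forall s v, partition_sums (M s) setT v -> v <= a.

Lemma ultra_limit_measure : exists m : set T -> X,
  [/\ is_cabv m, forall v, partition_sums m setT v -> v <= a &
    forall f, continuous f -> forall e : R, 0 < e ->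
      \forall s \near F, modulus (integral_of m f - integral_of (M s) f) < e].
Proof.
have PF : ProperFilter F by exact: ultra_proper.
have [s0 _] := filter_ex (@filterT _ F _).
have a0 : 0 <= a.
  by apply: le_trans (M_le (partition_sums1 (M s0) borelT)); exact: hnorm_ge0.
have [E [oE sepE]] := separating_sequence compactT.
have bE j : borel (E j) by exact: borel_open.
have lim_ex (iw : @part_index n * seq bool) : exists l : R,
    (fun s => part (M s) iw.1 (cell E iw.2)) @ F --> l.
  apply: (ultra_limit FU (B := a + a)) => s; have bC := borel_cell bE iw.2.
  by rewrite ger0_norm ?part_ge0 // (part_le _ (cabvM s) bC (@M_le s)).
have [lam0 hlam0] := choice lim_ex.
pose lam i w := lam0 (i, w).
have hlam i w : (fun s => part (M s) i (cell E w)) @ F --> lam i w by exact: (hlam0 (i, w)).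
have lam_ge0 i w : 0 <= lam i w.
  apply: (cvgr_to_ge (hlam i w)); apply: nearW => s; apply: part_ge0 => //.
  exact: borel_cell.
have lam_split i w : lam i w = lam i (true :: w) + lam i (false :: w).
  have e : (fun s => part (M s) i (cell E w)) =
      (fun s => part (M s) i (cell E (true :: w)) + part (M s) i (cell E (false :: w))).
    apply/funext => s; have [_ addp] := part_additive i (cabvM s).
    by rewrite (cell_split E w) addp //; [exact: borel_cell|exact: borel_cell|exact: cell_disjoint].
  have h1 := hlam i w; rewrite e in h1.
  exact: (cvg_unique (@norm_hausdorff _ R) h1 (cvgD (hlam i (true :: w)) (hlam i (false :: w)))).
have lam_cell i w : 0 < lam i w -> cell E w !=set0.
  move=> l0; apply: contrapT => /set0P/negP; rewrite negbK => /eqP e.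
  have h : (fun s => part (M s) i (cell E w)) @ F --> (0 : R).
    have -> : (fun s => part (M s) i (cell E w)) = fun=> 0.
      by apply/funext => s; rewrite e; have [-> _] := part_additive i (cabvM s).
    exact: cvg_cst.
  by move: l0; rewrite (cvg_unique (@norm_hausdorff _ R) (hlam i w) h) ltxx.
pose mu i := cell_measure compactT t0 (lam_ge0 i) (lam_split i) (@lam_cell i).
have mu_ge0 i A : borel A -> 0 <= mu i A by move=> _; exact: cell_measure_ge0.
have mu_add i : countably_additive (mu i) by exact: cell_measure_additive.
pose z : @part_index n -> X := part_vec.
pose m := vector_combination mu z.
pose D := combination_bound mu z.
have mD : dominated (@borel T) m D by exact: vector_combination_dominated.
have aD : countably_additive D by exact: combination_bound_additive.
have D_ge0 : 0 <= D setT by apply: (dominated_ge0 mD); exact: borelT.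
have int_lim f : continuous f -> forall e : R, 0 < e ->
      \forall s \near F, modulus (integral_of m f - integral_of (M s) f) < e.
  move=> cf e e0; have sf := continuous_approximable compactT cf.
  have DT : D setT = \sum_i lam i [::] * hnorm (z i).
    by apply: eq_bigr => i _; rewrite /mu cell_measure_total.
  (* The budget in units of [d]: [3 * D setT] on the side of [m], [a] on the side of [M s], 1 for
     the convergence of the weights, and 1 to make the inequality strict. *)
  have C0 : 0 < 3 * D setT + a + 2 by rewrite ltr_pwDr // addr_ge0 // mulr_ge0.
  set d := e / (3 * D setT + a + 2); have d0 : 0 < d by exact: divr_gt0.
  have [del del0 hdel] := uniformly_continuous compactT cf d0.
  have [N hN] := cell_closure_small sepE del0.
  pose tt (w : seq bool) := if pselect (cell E w !=set0) is left h then projT1 (cid h) else t0.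
  have f_cell w t : size w = N -> closure (cell E w) t -> hnorm (f t - f (tt w)) <= d.
    move=> wN wt; apply/ltW/hdel.
    have ne : cell E w !=set0 by have [x []] := wt setT filterT; exists x.
    apply: (hN w) => //; first by rewrite wN.
    apply: subset_closure; rewrite /tt; case: pselect => // h.
    by case: (cid h).
  have [W [c [v [cB fv]]]] := sf _ d0.
  (* A Riemann sum with the limit weights. The same sum with the weights of [M s] is exactly a coded
     sum for [M s], so the two sides differ only in finitely many weights. *)
  pose L := \sum_i \sum_(w : N.-tuple bool) inner (f (tt w)) (z i) * of_real (lam i w).
  (* One [d] replaces [f] by the step function [v]; two more lead from [v (c t)] through [f t] to
     the value at the representative of the cell. *)
  have h1 : modulus (integral_of m f - L) <= 3 * d * D setT.
    rewrite -(subrK (coded_sum m c v) (integral_of m f)) -addrA.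
    rewrite (le_trans (modulusD _ _)) //.
    rewrite (_ : 3 * d * D setT = d * D setT + 2 * d * D setT); last by ring.
    apply: lerD; first exact: integral_of_approx.
    rewrite /m coded_sum_combination // /L -sumrB (le_trans (modulus_sum _ _ _)) //.
    rewrite DT mulr_sumr; apply: ler_sum => i _.
    rewrite [leRHS](_ : _ = (2 * d * hnorm (z i)) * lam i [::]); last by ring.
    apply: (cell_measure_approx (kap := fun w => inner (v w) (z i))
      (kap' := fun w => inner (f (tt w)) (z i)) compactT t0 sepE (lam_ge0 i) (lam_split i) (@lam_cell i)) => // w t wN wt.
    rewrite -innerBl (le_trans (inner_le _ _)) // ler_wpM2r ?hnorm_ge0 //.
    rewrite (le_trans (hnorm_triangle (f t) _ _)) //.
    by rewrite mulr_natl mulr2n lerD // ?f_cell // hnormBC.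
  have h2 s : modulus (integral_of (M s) f -
      \sum_i \sum_(w : N.-tuple bool) inner (f (tt w)) (z i) * of_real (part (M s) i (cell E w)))
      <= d * a.
    have [am _ _] := cabvM s.
    have fw t : hnorm (f t - f (tt (word_tuple E N t))) <= d.
      by apply: f_cell; rewrite /= ?size_word //; apply: subset_closure; rewrite /cell /= size_word.
    have := integral_of_approx (v := fun w : N.-tuple bool => f (tt w)) (cabv_dominated (cabvM s)) sf (coding_word bE (k := N)) fw.
    have -> : coded_sum (M s) (word_tuple E N) (fun w : N.-tuple bool => f (tt w)) =
      \sum_i \sum_(w : N.-tuple bool) inner (f (tt w)) (z i) * of_real (part (M s) i (cell E w)).
      rewrite exchange_big; apply: eq_bigr => w _ /=.
      have -> : word_tuple E N @^-1` [set w] = cell E w.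
        apply/seteqP; split => t; rewrite /cell /= size_tuple; first by move=> /(congr1 val).
        by move=> h; exact: val_inj.
      rewrite -{1}(part_sum (M s) (cell E w)) inner_sumr; apply: eq_bigr => i _.
      by rewrite innerZr scalar_conj_of_real mulrC.
    move/le_trans; apply; rewrite ler_wpM2l ?(ltW d0) //.
    exact: (variation_le (@M_le s) borelT).
  pose Q := \sum_i \sum_(w : N.-tuple bool) modulus (inner (f (tt w)) (z i)).
  have Q0 : 0 <= Q by rewrite /Q !sumr_ge0 // => i _; rewrite sumr_ge0 // => w _; exact: modulus_ge0.
  have dQ : 0 < d / (Q + 1) by rewrite divr_gt0 // ltr_pwDr.
  have near_lam : \forall s \near F, forall iw : @part_index n * N.-tuple bool,
      `|lam iw.1 iw.2 - part (M s) iw.1 (cell E iw.2)| < d / (Q + 1).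
    apply: filter_forall => -[i w].
    exact: ((cvgrPdist_lt _ _).1 (hlam i w) _ dQ).
  apply: filterS near_lam => s hs.
  have h3 : modulus (L - \sum_i \sum_(w : N.-tuple bool)
      inner (f (tt w)) (z i) * of_real (part (M s) i (cell E w))) <= d.
    have hd : Q * (d / (Q + 1)) <= d.
      by rewrite mulrCA ger_pMr // ler_pdivrMr ?mul1r ?lerDl // ltr_pwDr.
    apply: le_trans hd; rewrite /L -sumrB (le_trans (modulus_sum _ _ _)) // /Q mulr_suml.
    apply: ler_sum => i _; rewrite -sumrB (le_trans (modulus_sum _ _ _)) // mulr_suml.
    apply: ler_sum => w _; rewrite -mulrBr -of_realN -of_realD modulusM modulus_of_real.
    by rewrite ler_wpM2l ?modulus_ge0 // ltW // (hs (i, w)).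
  set P := \sum_i \sum_(w : N.-tuple bool) _ in h3.
  have h2s := h2 s; rewrite -/P in h2s.
  rewrite (_ : integral_of m f - integral_of (M s) f =
    (integral_of m f - L) + ((L - P) - (integral_of (M s) f - P))); last by ring.
  have := modulusD (integral_of m f - L) ((L - P) - (integral_of (M s) f - P)).
  have := modulusD (L - P) (- (integral_of (M s) f - P)); rewrite modulusN.
  have de : e = d * (3 * D setT + a + 2) by rewrite /d divfK // gt_eqF.
  lra.
exists m; split => //.
  exact: vector_combination_cabv.
(* The majorant [D] is too crude for the radius; the bound by [a] passes to the limit through each
   single integral. *)
apply: (partition_sums_le_integral compactT mD aD) => L f fL f1.
have cf := lipschitz_continuous fL; have sf := continuous_approximable compactT cf.
apply/ler_addgt0Pr => e e0.
have [s hs] := filter_ex (int_lim f cf e e0).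
have [am _ _] := cabvM s.
have := integral_of_le (cabv_dominated (cabvM s)) sf f1.
have := variation_le (@M_le s) borelT.
have := modulusD (integral_of m f - integral_of (M s) f) (integral_of (M s) f).
rewrite subrK mul1r; lra.
Qed.

End UltraLimit.

(** * The Monge-Kantorovich metric *)

Section MongeKantorovich.
Context {R : realType} {k : scalar_kind} {n : nat} {T : metricType R}.
Local Notation K := (scalar_field R k).
Local Notation X := 'rV[K]_n.
Hypothesis compactT : compact [set: T].
Variable t0 : T.
Implicit Types (m : set T -> X) (D : set T -> R) (f : T -> X).

Let sup_norm_set f : [set hnorm (f t) | t in [set: T]] !=set0.
Proof. by exists (hnorm (f t0)); exists t0. Qed.

(** The real [sup] and [inf] yield pointwise bounds only after the values are known to be bounded,
    by compactness, and the set of values to be inhabited, by [t0]. *)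
Lemma BL1_lipschitz f : BL1 f -> lipschitz 1 f /\ forall t, hnorm (f t) <= 1.
Proof.
move=> [[L0 [L0_ge0 fL0]] fBL].
have inf0 : 0 <= lipschitz_norm f by apply: lb_le_inf; [exists L0|move=> L []].
have [C C0 fC] := approximable_bounded (lipschitz_approximable compactT fL0).
have sup_ub t : hnorm (f t) <= sup_norm f.
  apply: sup_upper_bound; last by exists t.
  by split; [exact: sup_norm_set|exists C => _ [s _ <-]; exact: fC].
have sup0 : 0 <= sup_norm f by exact: le_trans (hnorm_ge0 _) (sup_ub t0).
split=> [s t|t]; last by have := sup_ub t; lra.
rewrite (@le_trans _ _ (lipschitz_norm f * mdist s t)) //; last first.
  by rewrite ler_wpM2r ?mdist_ge0 //; lra.
have [d0|d0] := eqVneq (mdist s t) 0; first by have := fL0 s t; rewrite d0 !mulr0.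
have dgt0 : 0 < mdist s t by rewrite lt_def d0 mdist_ge0.
rewrite -ler_pdivrMr //; apply: lb_le_inf; first by exists L0.
by move=> L [L_ge0 fL]; rewrite ler_pdivrMr.
Qed.

Lemma lipschitz_BL1 (C L : R) f : 0 <= L -> lipschitz L f ->
  (forall t, hnorm (f t) <= C) -> C + L <= 1 -> BL1 f.
Proof.
move=> L0 fL fC CL; split; first by exists L.
apply: le_trans CL; apply: lerD.
  by apply: ge_sup; [exact: sup_norm_set|move=> _ [t _ <-]].
by apply: ge_inf; [exists 0 => L' []|split].
Qed.

Lemma BL1_zero : BL1 (fun _ : T => 0 : X).
Proof.
apply: (lipschitz_BL1 (C := 0) (lexx 0)) => [s t|t|]; rewrite ?addr0 ?ler01 //.
  by rewrite subrr hnorm0 mul0r.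
by rewrite hnorm0.
Qed.

Lemma BL1_approximable f : BL1 f -> simple_approximable f.
Proof. by move=> /BL1_lipschitz[fL _]; exact: lipschitz_approximable fL. Qed.

Lemma mk_norm_le m (c : R) : (forall f, BL1 f -> modulus (integral_of m f) <= c) ->
  mk_norm m <= c.
Proof.
move=> mc; apply: ge_sup; last by move=> _ [f fB <-]; exact: mc.
by eexists; exists (fun=> 0); [exact: BL1_zero|].
Qed.

Section Dominated.
Variables (m : set T -> X) (D : set T -> R) (mD : dominated (@borel T) m D).

Lemma mk_norm_ub f : BL1 f -> modulus (integral_of m f) <= mk_norm m.
Proof.
move=> fB; apply: sup_upper_bound; last by exists f.
split; first by exists (modulus (integral_of m f)); exists f.
exists (1 * D setT) => _ [g gB <-]; have [_ g1] := BL1_lipschitz gB.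
exact: (integral_of_le mD (BL1_approximable gB)).
Qed.

Lemma mk_norm_ge0 : 0 <= mk_norm m.
Proof. by apply: le_trans (mk_norm_ub BL1_zero); exact: modulus_ge0. Qed.

Lemma lipschitz_integral_le (C L : R) f : 0 <= C -> 0 <= L -> lipschitz L f ->
  (forall t, hnorm (f t) <= C) -> modulus (integral_of m f) <= (C + L + 1) * mk_norm m.
Proof.
move=> C0 L0 fL fC; have c0 : 0 < C + L + 1 by rewrite ltr_pwDr // addr_ge0.
have i0 : 0 <= (C + L + 1)^-1 by rewrite invr_ge0 ltW.
pose a : K := of_real (C + L + 1)^-1.
have ma : modulus a = (C + L + 1)^-1 by rewrite modulus_of_real ger0_norm.
have gB : BL1 (fun t => a *: f t).
  apply: (@lipschitz_BL1 ((C + L + 1)^-1 * C) ((C + L + 1)^-1 * L)).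
  - exact: mulr_ge0.
  - by move=> s t; rewrite -scalerBr hnormZ ma -mulrA ler_wpM2l.
  - by move=> t; rewrite hnormZ ma ler_wpM2l.
  - by rewrite -mulrDr mulrC ler_pdivrMr // mul1r lerDl.
have := mk_norm_ub gB.
rewrite (integral_ofZ _ mD (lipschitz_approximable compactT fL)) modulusM ma.
by rewrite ler_pdivrMl.
Qed.

End Dominated.

(** The test functions are the products of the [phi i] with the basis vectors. They do not depend on
    [f]: a function of [BL1] enters only through the coordinates of its values [f (c i)], which have
    modulus at most 1. *)
Lemma mk_norm_small (B e : R) : 0 <= B -> 0 < e ->
  exists (p : nat) (f : 'I_p -> T -> X) (eta : R),
  [/\ forall i, continuous (f i), 0 < eta &
      forall m D, dominated (@borel T) m D -> D setT <= B ->
        (forall i, modulus (integral_of m (f i)) < eta) -> mk_norm m < e].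
Proof.
move=> B0 e0; have B1 : 0 < 2 * (B + 1) by rewrite mulr_gt0 // ltr_pwDr.
(* The mesh uses half of [e] for the uniform error against mass [B]; [eta] will share the other half
   among the test functions. *)
set d := e / (2 * (B + 1)); have d0 : 0 < d by exact: divr_gt0.
have [p [c [phi [L [L0 phi0 phi1 phid phiL]]]]] := lipschitz_partition_of_unity compactT d0.
pose I : finType := ('I_p * 'I_n)%type.
pose g (ij : I) t : X := of_real (phi ij.1 t) *: delta_mx ord0 ij.2.
have gL ij : lipschitz L (g ij).
  move=> s t; rewrite /g -scalerBl -of_realN -of_realD hnormZ modulus_of_real hnorm_delta mulr1.
  exact: phiL.
have q0 : 0 < 2 * (#|I|%:R + 1) :> R by rewrite mulr_gt0 // ltr_pwDr.
set eta := e / (2 * (#|I|%:R + 1)); have eta0 : 0 < eta by exact: divr_gt0.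
exists #|I|, (fun i => g (enum_val i)), eta; split => // [i|m D mD DB mg].
  exact: lipschitz_continuous (gL _).
have DT : 0 <= D setT by apply: (dominated_ge0 mD); exact: borelT.
have {}mg ij : modulus (integral_of m (g ij)) < eta by rewrite -(enum_rankK ij).
have small : #|I|%:R * eta < e / 2.
  have -> : e / 2 = eta * (#|I|%:R + 1) by rewrite /eta; field; rewrite gt_eqF // ltr_pwDr.
  by rewrite mulrC ltr_pM2l // ltrDl.
have dB : d * D setT <= e / 2.
  have -> : e / 2 = d * (B + 1) by rewrite /d; field; rewrite gt_eqF // ltr_pwDr.
  by rewrite ler_wpM2l ?(ltW d0) // (le_trans DB) // lerDl.
apply: (@le_lt_trans _ _ (d * D setT + #|I|%:R * eta)); last by lra.
apply: mk_norm_le => f fB; have [fL f1] := BL1_lipschitz fB.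
have sg ij : simple_approximable (fun t => f (c ij.1) ord0 ij.2 *: g ij t).
  exact: (approximableZ _ (lipschitz_approximable compactT (gL ij))).
have [sh hE] := integral_of_sum mD sg.
set h := (fun t => \sum_(ij : I) f (c ij.1) ord0 ij.2 *: g ij t) in sh hE.
have hf t : h t = \sum_i of_real (phi i t) *: f (c i).
  rewrite /h -(pair_bigA _ (fun i j => f (c i) ord0 j *: g (i, j) t)) /=.
  apply: eq_bigr => i _; rewrite {2}[f (c i)]row_sum_delta scaler_sumr.
  by apply: eq_bigr => j _; rewrite /g !scalerA mulrC.
have fh t : hnorm (f t - h t) <= d.
  rewrite hf; apply: (partition_approx phi0 phi1 phid) => s t' st.
  by apply: le_trans (fL s t') _; rewrite mul1r ltW.
have h1 : modulus (integral_of m (fun t => f t - h t)) <= d * D setT.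
  apply: (integral_of_le mD) => //.
  have := approximableD (BL1_approximable fB) (approximableZ (-1) sh).
  by under [in X in X -> _]eq_fun do rewrite scaleN1r.
have h2 : modulus (integral_of m h) <= #|I|%:R * eta.
  rewrite hE (le_trans (modulus_sum _ _ _)) //.
  rewrite (@le_trans _ _ (\sum_(ij : I) eta)) //; last by rewrite sumr_const mulr_natl.
  apply: ler_sum => ij _; rewrite (integral_ofZ _ mD (lipschitz_approximable compactT (gL ij))).
  rewrite modulusM -[eta]mul1r ler_pM ?modulus_ge0 ?(ltW (mg _)) //.
  exact: le_trans (modulus_le_hnorm _ _) (f1 _).
rewrite -(subrK (integral_of m h) (integral_of m f)) (le_trans (modulusD _ _)) // lerD //.
by rewrite -(integral_ofB mD (BL1_approximable fB) sh).
Qed.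

Lemma integral_small f (B e : R) : continuous f -> 0 <= B -> 0 < e ->
  exists2 eta : R, 0 < eta & forall m D, dominated (@borel T) m D -> D setT <= B ->
    mk_norm m < eta -> modulus (integral_of m f) < e.
Proof.
move=> cf B0 e0; have B1 : 0 < 2 * (B + 1) by rewrite mulr_gt0 // ltr_pwDr.
set d := e / (2 * (B + 1)); have d0 : 0 < d by exact: divr_gt0.
have [r r0 hr] := uniformly_continuous compactT cf d0.
have [p [c [phi [L [L0 phi0 phi1 phid phiL]]]]] := lipschitz_partition_of_unity compactT r0.
pose g t : X := \sum_i of_real (phi i t) *: f (c i).
have fg t : hnorm (f t - g t) <= d.
  by apply: (partition_approx phi0 phi1 phid) => s t' st; exact/ltW/hr.
pose L' := \sum_i L * hnorm (f (c i)).
have L'0 : 0 <= L' by apply: sumr_ge0 => i _; rewrite mulr_ge0 // hnorm_ge0.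
have gL : lipschitz L' g.
  move=> s t; rewrite /g -sumrB (le_trans (hnorm_sum _ _ _)) // mulr_suml.
  apply: ler_sum => i _; rewrite -scalerBl -of_realN -of_realD hnormZ modulus_of_real mulrAC.
  by rewrite ler_wpM2r ?hnorm_ge0.
have sg := lipschitz_approximable compactT gL.
have sf := continuous_approximable compactT cf.
have [C C0 gC] := approximable_bounded sg.
have c0 : 0 < C + L' + 1 by rewrite ltr_pwDr // addr_ge0.
(* By [lipschitz_integral_le] the integral of [g] then stays below [e / 2]; the other half covers
   [f - g]. *)
exists (e / 2 / (C + L' + 1)); first by rewrite !divr_gt0.
move=> m D mD DB; rewrite ltr_pdivlMr // mulrC => mk.
have h1 : modulus (integral_of m (fun t => f t - g t)) <= d * D setT.
  apply: (integral_of_le mD) => //.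
  have := approximableD sf (approximableZ (-1) sg).
  by under [in X in X -> _]eq_fun do rewrite scaleN1r.
have h2 := lipschitz_integral_le mD C0 L'0 gL gC.
have dB : d * D setT <= e / 2.
  have -> : e / 2 = d * (B + 1) by rewrite /d; field; rewrite gt_eqF // ltr_pwDr.
  by rewrite ler_wpM2l ?(ltW d0) // (le_trans DB) // lerDl.
rewrite -(subrK (integral_of m g) (integral_of m f)) (le_lt_trans (modulusD _ _)) //.
by rewrite -(integral_ofB mD sf sg); lra.
Qed.

Section Distance.
Implicit Types mu nu : cabv k n T.

Definition diff_bound mu nu (A : set T) : R :=
  variation (\val mu) A + variation (\val nu) A.

Lemma cabvP mu : is_cabv (\val mu).
Proof. exact: set_valP. Qed.

Lemma diff_dominated mu nu :
  dominated (@borel T) (\val mu - \val nu) (diff_bound mu nu).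
Proof. by apply: dominatedB; exact/cabv_dominated/cabvP. Qed.

Lemma mk_dist_le mu nu (e : R) :
  (forall f, BL1 f -> modulus (integral_of (\val mu) f - integral_of (\val nu) f) <= e) ->
  mk_dist mu nu <= e.
Proof.
move=> h; apply: mk_norm_le => f fB.
by rewrite (integral_of_measureB (cabv_dominated (cabvP mu)) (cabv_dominated (cabvP nu))
  (BL1_approximable fB)); exact: h.
Qed.

Lemma mk_dist_ub mu nu f : BL1 f ->
  modulus (integral_of (\val mu) f - integral_of (\val nu) f) <= mk_dist mu nu.
Proof.
move=> fB; rewrite -(integral_of_measureB (cabv_dominated (cabvP mu))
  (cabv_dominated (cabvP nu)) (BL1_approximable fB)).
exact: (mk_norm_ub (diff_dominated mu nu)).
Qed.

Lemma mk_dist_is_metric : is_metric (@mk_dist R k n T).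
Proof.
split.
- move=> mu; apply/eqP; rewrite eq_le (mk_norm_ge0 (diff_dominated mu mu)) andbT.
  by apply: mk_dist_le => f _; rewrite subrr modulus0.
- move=> mu nu h; apply: val_inj; apply/funext => A; apply/eqP; rewrite -subr_eq0; apply/eqP.
  have [bA|nA] := pselect (borel A); last first.
    by have [_ _ ->] := cabvP mu => //; have [_ _ ->] := cabvP nu => //; rewrite subrr.
  have mD := diff_dominated mu nu.
  have aD : countably_additive (diff_bound mu nu).
    by apply: countably_additiveD; exact/cabv_variation_additive/cabvP.
  apply: (lipschitz_separates compactT mD aD _ bA) => L f fL.
  have [C C0 fC] := approximable_bounded (lipschitz_approximable compactT fL).
  have fL' : lipschitz `|L| f.
    by move=> s t; apply: le_trans (fL s t) _; rewrite ler_wpM2r ?mdist_ge0 // ler_norm.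
  have := lipschitz_integral_le mD C0 (normr_ge0 L) fL' fC.
  rewrite [mk_norm _]h mulr0 => le0; apply: modulus_eq0; apply/eqP.
  by rewrite eq_le le0 modulus_ge0.
- have sym mu nu : mk_dist mu nu <= mk_dist nu mu.
    by apply: mk_dist_le => f fB; rewrite modulusB; exact: mk_dist_ub.
  by move=> mu nu; apply: le_anti; apply/andP; split; exact: sym.
- move=> nu mu pi; apply: mk_dist_le => f fB.
  rewrite -(subrK (integral_of (\val nu) f) (integral_of (\val mu) f)) -addrA.
  by rewrite (le_trans (modulusD _ _)) // lerD // mk_dist_ub.
Qed.

End Distance.
End MongeKantorovich.

(** * Compactness of the ball and comparison of its topologies *)

Section BallTopology.
Context {R : realType} {k : scalar_kind} {n : nat} {T : metricType R}.
Local Notation K := (scalar_field R k).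
Local Notation X := 'rV[K]_n.
Hypothesis compactT : compact [set: T].
Variables (t0 : T) (a : R).
Local Notation ball := (cabv_ball a : set (cabv k n T)).

Lemma ball_sums_le (mu : ball) v :
  partition_sums (\val (\val mu)) [set: T] v -> v <= a.
Proof. by move: v; apply/measure_variation_le; exact: (set_valP mu). Qed.

Lemma ball_diff_le (mu nu : ball) : diff_bound (\val mu) (\val nu) setT <= a + a.
Proof.
by apply: lerD; apply: variation_le borelT; exact: ball_sums_le.
Qed.

Lemma ball_radius_ge0 (mu : ball) : 0 <= a + a.
Proof.
apply: le_trans (ball_diff_le mu mu).
by apply: (dominated_ge0 (diff_dominated _ _)); exact: borelT.
Qed.

Lemma mk_dist_on_is_metric : is_metric (@mk_dist_on R k n T ball).
Proof.
have [h1 h2 h3 h4] := @mk_dist_is_metric R k n T compactT t0.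
split; rewrite /mk_dist_on.
- by move=> mu; exact: h1.
- by move=> mu nu /h2; exact: val_inj.
- by move=> mu nu; exact: h3.
- by move=> nu mu pi; exact: h4.
Qed.

Local Notation dP := mk_dist_on_is_metric.

Lemma ball_open_mdist (U : set (metric_space dP)) :
  open U <-> forall mu, U mu -> exists2 e : R, 0 < e &
    forall nu : ball, mk_dist (\val mu) (\val nu) < e -> U nu.
Proof.
rewrite openE; split => h mu Umu.
  by have /nbhs_mdist := h mu Umu.
by apply/nbhs_mdist; exact: h.
Qed.

Lemma ball_compact : compact [set: metric_space dP].
Proof.
rewrite compact_ultra => F FU _.
pose M (s : metric_space dP) : set T -> X := \val (\val (s : ball)).
have [m [hm m_le m_lim]] := ultra_limit_measure compactT t0 FU (M := M) (a := a)
  (fun s => cabvP _) (fun s v => @ball_sums_le s v).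
pose m1 : cabv k n T := @SigSub _ _ _ m (mem_set (hm : [set m | is_cabv m] m)).
have m1a : cabv_ball a m1 by apply/measure_variation_le.
pose m2 : metric_space dP := @SigSub _ _ _ m1 (mem_set (m1a : ball m1)).
exists m2; split => // A /nbhs_mdist[e e0 hA].
(* The limit is controlled one integral at a time; a Monge-Kantorovich neighbourhood in the ball
   reduces to finitely many of them. *)
have [p [f [eta [cf eta0 hf]]]] := mk_norm_small (k := k) (n := n) compactT t0 (ball_radius_ge0 m2) e0.
have PF : ProperFilter F by exact: ultra_proper.
have : \forall s \near F, forall i : 'I_p, modulus (integral_of m (f i) - integral_of (M s) (f i)) < eta.
  by apply: filter_forall => i; exact: m_lim.
apply: filterS => s hs; apply: hA.
apply: (hf _ _ (diff_dominated m1 (\val (s : ball)))) => [|i].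
  exact: (ball_diff_le m2 s).
rewrite (integral_of_measureB (cabv_dominated hm) (cabv_dominated (cabvP _))
  (continuous_approximable compactT (cf i))).
exact: hs.
Qed.

Lemma ball_weak_open (U : set ball) :
  open (U : set (metric_space dP)) <->
  open (U : set (set_type (cabv_ball a : set (weak_star k n T)))).
Proof.
have diffE (mu nu : cabv k n T) (f : T -> X) : continuous f ->
    integral_of (\val mu - \val nu) f = integral_of (\val mu) f - integral_of (\val nu) f.
  move=> cf; apply: (integral_of_measureB (cabv_dominated (cabvP mu)) (cabv_dominated (cabvP nu))).
  exact: continuous_approximable.
split; last first.
  move=> [V oV VU]; apply/ball_open_mdist => mu; rewrite -VU => Vmu.
  have [p [f [e [cf e0 hV]]]] := oV _ Vmu.
  have hi i : exists eta : R, 0 < eta /\ forall nu : ball, mk_dist (\val mu) (\val nu) < eta ->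
      modulus (integral_of (\val (\val nu) - \val (\val mu)) (f i)) < e.
    have [eta eta0 h] := integral_small compactT t0 (cf i) (ball_radius_ge0 mu) e0.
    exists eta; split => // nu munu.
    rewrite diffE // modulusB -diffE //.
    exact: (h _ _ (diff_dominated _ _) (ball_diff_le mu nu)).
  have [eta heta] := choice hi.
  have [d [d0 hd]] : exists d : R, 0 < d /\ forall i : 'I_p, d < eta i.
    (* The right neighbourhoods of 0 provide a positive number below finitely many, also when the
       family is empty. *)
    have h : \forall d \near 0^'+, forall i : 'I_p, d < eta i.
      by apply: filter_forall => i; apply: nbhs_right_lt; have [] := heta i.
    have [d [d0 hd]] := filter_ex (filterI (nbhs_right_gt 0) h).
    by exists d.
  exists d => // nu munu; apply: hV => i.
  by have [_] := heta i; apply; exact: lt_trans (hd i).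
move=> /ball_open_mdist oU.
(* [U] has to be the trace of a weak-star open set of the whole space: [V] collects all basic
   neighbourhoods whose trace on the ball lies in [U], with centres allowed outside the ball. *)
pose V : set (weak_star k n T) := [set nu | exists (mu : cabv k n T) (p : nat)
  (f : 'I_p -> T -> X) (e : R), [/\ forall i, continuous (f i), weak_star_nbhd mu f e nu &
   forall nu' : ball, weak_star_nbhd mu f e (\val nu') -> U nu']].
exists V.
  move=> nu [mu [p [f [e [cf nuV VU]]]]].
  (* [d] lies below every margin left by [nu], so the neighbourhood of [nu] with radius [d] fits
     into the one around [mu]. *)
  have [d [d0 hd]] : exists d : R, 0 < d /\ forall i : 'I_p,
      d < e - modulus (integral_of (\val nu - \val mu) (f i)).
    have h : \forall d \near 0^'+, forall i : 'I_p,
        d < e - modulus (integral_of (\val nu - \val mu) (f i)).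
      by apply: filter_forall => i; apply: nbhs_right_lt; rewrite subr_gt0; exact: nuV.
    have [d [d0 hd]] := filter_ex (filterI (nbhs_right_gt 0) h).
    by exists d.
  exists p, f, d; split => // nu' hnu'.
  exists mu, p, f, e; split => // i.
  have := hnu' i; have := hd i; rewrite !diffE //.
  have := modulusD (integral_of (\val nu') (f i) - integral_of (\val nu) (f i))
    (integral_of (\val nu) (f i) - integral_of (\val mu) (f i)).
  by rewrite addrA subrK; lra.
apply/seteqP; split => nu /=.
  by move=> [mu [p [f [e [cf nuV VU]]]]]; exact: VU.
move=> Unu; have [e e0 he] := oU nu Unu.
have [p [f [eta [cf eta0 hf]]]] := mk_norm_small (k := k) (n := n) compactT t0 (ball_radius_ge0 nu) e0.
exists (\val nu), p, f, eta; split => //.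
  move=> i; rewrite diffE // subrr modulus0 //.
move=> nu' hnu'; apply: he.
apply: (hf _ _ (diff_dominated _ _) (ball_diff_le nu nu')) => i.
by rewrite diffE // modulusB -diffE //; exact: hnu'.
Qed.

End BallTopology.

Lemma compact_complete (R : realType) (M : metricType R) :
  compact [set: M] -> complete_space M.
Proof.
move=> cM F PF cF; have [x [_ xF]] := cM F PF filterT.
exists x => A /nbhs_mdist[e e0 hA].
have e2 : 0 < e / 2 by rewrite divr_gt0.
have /cF : entourage [set xy : M * M | mdist xy.1 xy.2 < e / 2].
  rewrite -entourage_ballE; exists (e / 2) => // xy /=.
  by rewrite ballEmdist.
move=> [[P Q] /= [FP FQ] PQ].
have [y [Py xy]] := xF P [set y | mdist x y < e / 2] FP
  ((nbhs_mdist _ _).2 (ex_intro2 _ _ (e / 2) e2 (fun _ => id))).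
apply: filterS FQ => z Qz; apply: hA.
have := PQ (y, z) (conj Py Qz) => /=; have := metric_triangle x y z.
by move: xy => /=; lra.
Qed.

Lemma complete_sequence (R : realType) (M : metricType R) (u : nat -> M) :
  complete_space M ->
  (forall e : R, 0 < e -> exists N, forall i j, (N <= i)%N -> (N <= j)%N ->
    mdist (u i) (u j) < e) ->
  exists l, forall e : R, 0 < e -> \forall N \near \oo, mdist l (u N) < e.
Proof.
move=> complete uC; have [|l ul] := complete (u @ \oo) _.
  move=> A; rewrite -entourage_ballE => -[e /= e0 eA]; have [N hN] := uC e e0.
  exists (u @` [set j | (N <= j)%N], u @` [set j | (N <= j)%N]).
    by split; exists N => // j /= Nj; exists j.
  by move=> [y z] /= [[i Ni <-] [j Nj <-]]; apply: eA => /=; rewrite ballEmdist; exact: hN.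
by exists l => e e0; apply: (ul [set y | mdist l y < e]); apply/nbhs_mdist; exists e.
Qed.

(** * Finite combinations of point masses *)

Section Dirac.
Context {R : realType} {k : scalar_kind} {n : nat} {T : metricType R}.
Local Notation K := (scalar_field R k).
Local Notation X := 'rV[K]_n.

Definition point_mass (x : T) (A : set T) : R := if `[<A x>] then 1 else 0.

Lemma point_mass_ge0 x A : 0 <= point_mass x A.
Proof. by rewrite /point_mass; case: asboolP. Qed.

Lemma point_mass_additive x : countably_additive (point_mass x).
Proof.
move=> A _ tA; rewrite {2}/point_mass.
have out i : ~ A i x -> point_mass x (A i) = 0.
  by rewrite /point_mass; case: asboolP.
case: asboolP => [[i0 _ Ax]|nA].
  apply: cvg_near_cst; exists i0.+1 => // N /= i0N.
  rewrite (bigD1 (Ordinal i0N)) //= big1 => [|j ji].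
    by rewrite /point_mass asboolT // addr0.
  apply: out => Aj; move/eqP: ji; apply; apply: val_inj => /=.
  by apply: (tA j i0 I I); exists x.
apply: cvg_near_cst; apply: nearW => N; apply: big1 => j _.
by apply: out => Aj; apply: nA; exists j.
Qed.

Lemma integral_point_masses (I : finType) (x : I -> T) (z : I -> X) f :
  simple_approximable f ->
  integral_of (vector_combination (fun i => point_mass (x i)) z) f =
  \sum_i inner (f (x i)) (z i).
Proof.
move=> sf; set mu := fun i => point_mass (x i).
have mD := vector_combination_dominated z (fun i A _ => point_mass_ge0 (x i) A)
  (fun i => @point_mass_additive (x i)).
rewrite -/mu in mD *; set D := combination_bound mu z in mD.
have D0 : 0 <= D setT by apply: (dominated_ge0 mD); exact: borelT.
apply/eqP; rewrite -subr_eq0; apply/eqP; apply: modulus_small => e e0.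
set B := \sum_i hnorm (z i).
have B0 : 0 <= B by apply: sumr_ge0 => i _; exact: hnorm_ge0.
have C0 : 0 < D setT + B + 1 by rewrite ltr_pwDr // addr_ge0.
set d := e / (D setT + B + 1); have d0 : 0 < d by exact: divr_gt0.
have [W [c [v [cB fv]]]] := sf _ d0.
have h1 := integral_of_approx mD sf cB fv.
have h2 : coded_sum (vector_combination mu z) c v = \sum_i inner (v (c (x i))) (z i).
  rewrite coded_sum_combination //; apply: eq_bigr => i _.
  rewrite (bigD1 (c (x i))) //= big1 ?addr0 => [|w wi].
    by rewrite /mu /point_mass asboolT // of_real1 mulr1.
  rewrite /mu /point_mass asboolF ?of_real0 ?mulr0 //= => e'.
  by rewrite e' eqxx in wi.
have h3 : modulus (\sum_i inner (v (c (x i))) (z i) - \sum_i inner (f (x i)) (z i)) <= d * B.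
  rewrite -sumrB (le_trans (modulus_sum _ _ _)) // mulr_sumr.
  apply: ler_sum => i _; rewrite -innerBl (le_trans (inner_le _ _)) //.
  by rewrite ler_wpM2r ?hnorm_ge0 // hnormBC.
rewrite h2 in h1.
rewrite -(subrK (\sum_i inner (v (c (x i))) (z i)) (integral_of _ f)) -addrA.
rewrite (le_trans (modulusD _ _)) // (le_trans (lerD h1 h3)) //.
have -> : e = d * (D setT + B + 1) by rewrite /d divfK // gt_eqF.
lra.
Qed.

End Dirac.

(** * Failure of completeness on the whole space *)

Section NotComplete.
Context {R : realType} {T : metricType R}.
Hypothesis compactT : compact [set: T].

(** If all points were isolated, compactness would make the radius of isolation uniform, and a
    finite net of that radius would be all of [T]. *)
Lemma accumulation_point : infinite_set [set: T] ->
  exists t : T, forall r : R, 0 < r -> exists x, 0 < mdist t x /\ mdist t x < r.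
Proof.
move=> infT; apply: contrapT => noacc; apply: infT.
have isolated (t : T) : exists2 r : R, 0 < r & forall x, mdist t x < r -> x = t.
  apply: contrapT => h; apply: noacc; exists t => r r0; apply: contrapT => nx.
  apply: h; exists r => // x tx; apply/esym; apply: mdist_positivity; apply: contrapT => /eqP d0.
  by apply: nx; exists x; split => //; rewrite lt_def d0 mdist_ge0.
have [x|N hN] := compact_eventually compactT
    (P := fun i t => forall x, mdist t x < i.+1%:R^-1 -> x = t).
  have [r r0 hr] := isolated x; have [N hN] := natSinv_small r0.
  exists r => //; exists N => y i /hr -> Ni z xz; apply: hr.
  exact: lt_trans (hN i Ni).
have [s hs] := finite_net compactT (natSinv_gt0 (R := R) N).
apply: sub_finite_set (finite_seq s) => t _ /=.
by have [c cs /(hN N (leqnn N)) ->] := hs t.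
Qed.

(** Halving serves twice: it makes the distances to [t] summable, and it keeps [x i] at distance at
    least [mdist t (x i) / 2] from [t] and from the other terms. *)
Lemma fast_sequence : infinite_set [set: T] -> exists (t : T) (x : nat -> T),
  (forall i, 0 < mdist t (x i)) /\ mdist t (x 0%N) < 1 /\
  forall i, mdist t (x i.+1) < mdist t (x i) / 2.
Proof.
move=> /accumulation_point[t ht].
have step (y : T) : exists z, 0 < mdist t y -> 0 < mdist t z /\ mdist t z < mdist t y / 2.
  have [y0|y0] := pselect (0 < mdist t y); last by exists y.
  by have [z hz] := ht _ (divr_gt0 y0 (ltr0n R 2)); exists z.
have [g hg] := choice step; have [x0 [x00 x01]] := ht 1 ltr01.
have pos i : 0 < mdist t (iter i g x0) by elim: i => //= i /hg[].
by exists t, (fun i => iter i g x0); split => //; split => // i /=; have [] := hg _ (pos i).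
Qed.

Context {k : scalar_kind} {n : nat} (n_gt0 : (0 < n)%N).
Local Notation K := (scalar_field R k).
Local Notation X := 'rV[K]_n.

Lemma mk_dist_not_complete (dP : is_metric (@mk_dist R k n T)) :
  infinite_set [set: T] -> ~ complete_space (metric_space dP).
Proof.
move=> /fast_sequence[t [x [x_pos [x0 x_half]]]] complete.
pose u : X := delta_mx ord0 (Ordinal n_gt0).
have u1 : hnorm u = 1 by exact: hnorm_delta.
have x_mono i j : (i <= j)%N -> mdist t (x j) <= mdist t (x i).
  elim: j => [|j IH]; first by rewrite leqn0 => /eqP ->.
  rewrite leq_eqVlt => /predU1P[-> //|/IH h].
  by have := x_half j; have := x_pos j; lra.
have x_lt i j : (i < j)%N -> mdist t (x j) < mdist t (x i) / 2.
  by move=> /x_mono/le_lt_trans; apply; exact: x_half.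
have x_small i : mdist t (x i) <= (2 ^+ i)^-1.
  elim: i => [|i IH]; first by rewrite expr0 invr1 ltW.
  by rewrite exprS invfM; have := x_half i; lra.
have x_apart i j : i != j -> mdist t (x i) / 2 <= mdist (x i) (x j).
  have := x_pos i; have := x_pos j; have := metric_triangle t (x i) (x j).
  have := metric_triangle t (x j) (x i); have := metric_sym (x i) (x j).
  by rewrite neq_ltn => + + + + + /orP[] /x_lt; lra.
(* mu_N = sum_(i < N) (delta_(x i) - delta_t) u *)
pose pt (N : nat) (ib : 'I_N * bool) := if ib.2 then x ib.1 else t.
pose coef (N : nat) (ib : 'I_N * bool) : X := if ib.2 then u else - u.
pose mu N := vector_combination (fun ib => point_mass (R := R) (@pt N ib)) (@coef N).
have cabv_mu N : is_cabv (mu N).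
  apply: vector_combination_cabv => [ib A _|ib]; first exact: point_mass_ge0.
  exact: point_mass_additive.
have int_mu N f : simple_approximable f ->
    integral_of (mu N) f = \sum_(i < N) inner (f (x i) - f t) u.
  move=> sf; rewrite integral_point_masses //.
  rewrite -(pair_bigA _ (fun (i : 'I_N) (b : bool) => inner (f (pt N (i, b))) (coef N (i, b)))) /=.
  apply: eq_bigr => i _; rewrite big_bool /pt /coef /=.
  by rewrite innerNr innerBl.
pose seq_mu N : cabv k n T := @SigSub _ _ _ (mu N) (mem_set (cabv_mu N : [set m | is_cabv m] (mu N))).
have [d_xx d_eq d_sym d_tri] := dP.
(* Consecutive terms differ by one pair of opposite point masses, on which a 1-Lipschitz function
   has integral at most [mdist t (x N)]. *)
have dist_step N : mk_dist (seq_mu N) (seq_mu N.+1) <= (2 ^+ N)^-1.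
  apply: le_trans (x_small N); apply: (mk_dist_le compactT t) => f fB.
  have sf := BL1_approximable compactT t fB; have [fL _] := BL1_lipschitz compactT t fB.
  rewrite !int_mu // big_ord_recr /= opprD addrA subrr add0r modulusN.
  rewrite (le_trans (inner_le _ _)) // u1 mulr1 (le_trans (fL _ _)) // mul1r.
  by rewrite metric_sym.
(* The geometric sum is kept in telescoped form, so that the induction closes. *)
have dist_le N j : mk_dist (seq_mu N) (seq_mu (N + j)%N) <= 2 * (2 ^+ N)^-1 - 2 * (2 ^+ (N + j))^-1.
  elim: j => [|j IH]; first by rewrite addn0 d_xx subrr.
  apply: le_trans (d_tri (seq_mu (N + j)%N) _ _) _.
  rewrite addnS; apply: le_trans (lerD IH (dist_step _)) _.
  rewrite exprS invfM; lra.
have mu_cauchy (e : R) : 0 < e -> exists N, forall i j, (N <= i)%N -> (N <= j)%N ->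
    mk_dist (seq_mu i) (seq_mu j) < e.
  move=> e0; have [N0 hN0] := natSinv_small (divr_gt0 e0 (ltr0n R 4)).
  have tail j : (N0 <= j)%N -> mk_dist (seq_mu N0) (seq_mu j) < e / 2.
    move=> Nj; rewrite -(subnKC Nj); apply: le_lt_trans (dist_le _ _) _.
    have h1 : (2 ^+ N0)^-1 <= N0.+1%:R^-1 :> R.
      by rewrite lef_pV2 ?posrE ?exprn_gt0 // -natrX ler_nat ltn_expl.
    have h2 := hN0 N0 (leqnn N0).
    have : 0 < (2 ^+ (N0 + (j - N0)))^-1 :> R by rewrite invr_gt0 exprn_gt0.
    by move: h1 h2; move: (N0.+1%:R^-1) => v; lra.
  exists N0 => i j Ni Nj; apply: le_lt_trans (d_tri (seq_mu N0) _ _) _.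
  by rewrite (d_sym (seq_mu i)) [e]splitr; apply: ltrD; exact: tail.
have [nu near_nu] := @complete_sequence R (metric_space dP) seq_mu complete mu_cauchy.
have nuD := cabv_dominated (cabvP (nu : cabv k n T)).
have nuA := cabv_variation_additive (cabvP (nu : cabv k n T)).
set V := variation (\val (nu : cabv k n T)) in nuD nuA.
have V0 := dominated_ge0 nuD.
have closed_x i : closed [set x i].
  by apply: compact_closed; [exact: metric_hausdorff|exact: compact_set1].
(* A bump at [x i] thinner than [mdist t (x i) / 2] vanishes at [t] and at the other terms, so its
   integral against [mu N] is 1 once [i < N]. The limit inherits this value, and thinner bumps
   isolate the atom. *)
have atom i : inner u (\val (nu : cabv k n T) [set x i]) = 1.
  apply/eqP; rewrite -subr_eq0; apply/eqP; apply: modulus_small => e e0.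
  have e2 : 0 < e / 2 by rewrite divr_gt0.
  have [N1 hN1] := integral_bump_cvg compactT u nuD nuA (closed_x i) e2.
  have [N2 hN2] := natSinv_small (divr_gt0 (x_pos i) (ltr0n R 2)).
  pose j := maxn N1 N2; pose f := bump_vec [set x i] j.+1%:R u.
  have fL := bump_vec_lipschitz [set x i] u (ler0n R j.+1) : lipschitz _ f.
  have sf := lipschitz_approximable compactT fL.
  have f1 s : hnorm (f s) <= 1.
    by rewrite hnormZ u1 mulr1 modulus_of_real ger0_norm ?bump_ge0 // bump_le1.
  have f_far s : mdist t (x i) / 2 <= mdist (x i) s -> f s = 0.
    move=> far; rewrite /f /bump_vec bump_out ?of_real0 ?scale0r // => -[c -> h].
    have hj : j.+1%:R^-1 < mdist t (x i) / 2 by apply: hN2; exact: leq_maxr.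
    have : mdist (x i) s < j.+1%:R^-1 by rewrite -[ltRHS]mulr1 ltr_pdivlMl.
    by move: hj; move: (j.+1%:R^-1) => v; lra.
  have int_f N : (i < N)%N -> integral_of (mu N) f = 1.
    move=> iN; rewrite int_mu // (bigD1 (Ordinal iN)) //= big1 => [|j' ji].
      rewrite (f_far t); last by have := x_pos i; rewrite (metric_sym (x i)); lra.
      by rewrite /f /bump_vec bump_in // of_real1 scale1r subr0 addr0 inner_hnorm u1 expr1n of_real1.
    rewrite (f_far t); last by have := x_pos i; rewrite (metric_sym (x i)); lra.
    rewrite (f_far (x j')) ?subrr ?inner0l //.
    by apply: x_apart; rewrite eq_sym; exact: ji.
  pose L := j.+1%:R * hnorm u; have L0 : 0 <= L by rewrite mulr_ge0 // hnorm_ge0.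
  have c0 : 0 < 1 + L + 1 by rewrite ltr_pwDr // addr_ge0.
  have near_i : \forall N \near \oo, (i < N)%N by exists i.+1.
  have [N [hN iN]] := filter_ex (filterI (near_nu _ (divr_gt0 e2 c0)) near_i).
  have {}hN : mk_dist (nu : cabv k n T) (seq_mu N) < e / 2 / (1 + L + 1) by exact: hN.
  have h1 := lipschitz_integral_le compactT t (diff_dominated (nu : cabv k n T) (seq_mu N)) ler01 L0 fL f1.
  rewrite (integral_of_measureB nuD (cabv_dominated (cabv_mu N)) sf) (int_f N iN) in h1.
  have h2 : (1 + L + 1) * mk_norm (\val (nu : cabv k n T) - mu N) < e / 2.
    by rewrite mulrC -ltr_pdivlMr.
  have h3 := hN1 j (leq_maxl _ _); rewrite -/f modulusB in h3.
  have := modulusD (inner u (\val (nu : cabv k n T) [set x i]) - integral_of (\val (nu : cabv k n T)) f)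
    (integral_of (\val (nu : cabv k n T)) f - 1).
  by rewrite addrA subrK; lra.
have V_atom i : 1 <= V [set x i].
  have bx : borel [set x i] by apply: borel_closed; exact: closed_x.
  have [_ _ h] := nuD; apply: le_trans (h _ bx).
  have := inner_le u (\val (nu : cabv k n T) [set x i]).
  by rewrite atom modulus1 u1 mul1r.
have x_inj i j : x i = x j -> i = j.
  move=> e; apply/eqP; apply: contraT => /x_apart; rewrite e mdistxx.
  by have := x_pos j; lra.
(* The contradiction: a finite measure cannot carry infinitely many atoms of mass at least 1. *)
have V_ge N : N%:R <= V setT.
  have [_ addV _] := nuD.
  have bx i : borel [set x i] by apply: borel_closed; exact: closed_x.
  have tx : trivIset setT (fun i => [set x i]).
    by move=> i j _ _ [y /= [-> /x_inj]].
  apply: (@le_trans _ _ (V (\big[setU/set0]_(i < N) [set x i]))); last first.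
    by apply: (additive_mono borel_algebra addV V0) => //; [exact: (borel_bigsetU N bx)|exact: borelT].
  rewrite (additive_bigsetU N addV bx tx).
  rewrite (@le_trans _ _ (\sum_(i < N) 1)) ?ler_sum //.
  by rewrite sumr_const card_ord.
have := V_ge (Num.truncn (V setT)).+1.
by rewrite leNgt truncnS_gt.
Qed.

End NotComplete.

Unset Implicit Arguments.

Theorem theorem13 (R : realType) (k : scalar_kind) (n : nat) (T : metricType R)
    (n_gt0 : (0 < n)%N) (compactT : compact [set: T])
    (T_ge2 : exists s t : T, s <> t) :
  (forall a : R, 0 < a ->
     exists dP : is_metric (@mk_dist_on R k n T (cabv_ball a)),
       [/\ compact [set: metric_space dP],
           complete_space (metric_space dP) &
           forall U : set (cabv_ball a),
             open (U : set (metric_space dP)) <->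
             open (U : set (set_type (cabv_ball a : set (weak_star k n T))))]) /\
  (infinite_set [set: T] ->
     exists dP : is_metric (@mk_dist R k n T),
       ~ complete_space (metric_space dP)).
Proof.
have [t0 _] := T_ge2; split => [a _|infT].
  exists (mk_dist_on_is_metric compactT t0 a); split.
  - exact: ball_compact.
  - by apply: compact_complete; exact: ball_compact.
  - by move=> U; exact: ball_weak_open.
exists (mk_dist_is_metric compactT t0).
exact: mk_dist_not_complete.
Qed.
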